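(* Let $d\in \mathbb{N}$ and $\mathbf{s}=(s_1,\dots,s_d)\in\mathbb{N}^d$ with $s_1\ge 3$, $|\mathbf{s}|=s_1+\cdots+s_d$. For each $j$ let $l_j$ be one of the functions $m\mapsto 2m$, $m\mapsto 2m+1$, $m\mapsto 2m-1$; put $\nu(l)=1$ if $l(m)=2m-1$ and $\nu(l)=0$ otherwise; let $\succ_j$ be ''$\ge$'' if $l_j(m)=2m+1$ and ''$>$'' otherwise, and set \[ T=\sum_{n_1 \succ_1 \cdots \succ_{d-1} n_d\succ_d 0}\frac{ b_{n_1}^2}{l_1(n_1)^{s_1}\cdots l_d(n_d)^{s_d}}. \] (a) If $l_1(m)\ne 2m-1$ and for every $j\ge2$ with $l_j(m)=2m-1$ we have $l_{j-1}(m)\ne 2m$, then $T\in \mathsf{CMZV}^4_{|\mathbf{s}|}$. In particular this holds if $l_1(m)=2m+1$ and $l_j(m)\ne 2m$ for all $j$. If instead $l_1(m)=2m-1$ and for every $j\ge2$ with $l_j(m)=2m-1$ we have $l_{j-1}(m)\ne 2m$, then $T\in \mathsf{CMZV}^4_{|\mathbf{s}|}+\mathsf{CMZV}^4_{|\mathbf{s}|+1}+\mathsf{CMZV}^4_{|\mathbf{s}|+2}$. (b) In general, $T\in \mathsf{CMZV}^4_{\le |\mathbf{s}|+2\nu(l_1)}\otimes\mathbb{Q}[i]$. (c) The claim in (b) still holds if any of the relations between consecutive indices $n_j,n_{j+1}$ ($1\le j\le d$, $n_{d+1}=0$) is changed from ''$>$'' to ''$\ge$'' or vice versa, provided the series is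 defined; i.e. for arbitrary choices of each ''$\succ$'' among ''$\ge$'', ''$>$'', \[ \sum_{n_1\succ\cdots\succ n_d \succ 0}\frac{ b_{n_1}^2}{l_1(n_1)^{s_1}\cdots l_d(n_d)^{s_d}} \in \mathsf{CMZV}^4_{\le |\mathbf{s}|+2\nu(l_1)}\otimes\mathbb{Q}[i]. \]
   Context: $b_n=4^n\binom{2n}{n}^{-1}$ for $n\in\mathbb{N}_0$. For $\mathbf{k}\in\mathbb{N}^r$ and fourth roots of unity $z_1,\dots,z_r$ with $(k_1,z_1)\ne(1,1)$, $\operatorname{Li}_{\mathbf{k}}(\mathbf{z})=\sum_{m_1>\cdots>m_r>0} \frac{z_1^{m_1}\cdots z_r^{m_r}}{m_1^{k_1}\cdots m_r^{k_r}}$ (a colored multiple zeta value of level 4 and weight $k_1+\cdots+k_r$). $\mathsf{CMZV}^4_w$ is the $\mathbb{Q}$-span of all such values of weight $w$ ($\mathsf{CMZV}^4_0=\mathbb{Q}$), $\mathsf{CMZV}^4_{\le w}=\sum_{k\le w}\mathsf{CMZV}^4_k$, and $V\otimes\mathbb{Q}[i]$ is the $\mathbb{Q}[i]$-span of $V$. *)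

(* Defs.v *)
From mathcomp Require Export all_boot all_order all_algebra.
From mathcomp Require Export complex.
From mathcomp Require Export all_classical all_reals all_analysis.
Export Order.TTheory GRing.Theory Num.Theory.
Export numFieldNormedType.Exports.

Set Implicit Arguments.
Unset Strict Implicit.
Unset Printing Implicit Defensive.

#[global] Open Scope classical_set_scope.
#[global] Open Scope ring_scope.

Section NestedSums.
Variable p : nat.
Implicit Types (n : 'I_p -> nat) (strict : 'I_p -> bool).

(* The paper's n_1, ..., n_p are n 0, ..., n (p - 1); the successor of the last
   index is the convention n_{p+1} = 0. *)
Definition next_index n (j : 'I_p) : nat := oapp n 0%N (insub j.+1).

(* strict j selects ">" or ">=" between n_j and n_{j+1}, including the last
   comparison with 0. *)
Definition chain strict n : bool :=
  [forall j, if strict j then (n j > next_index n j)%N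
             else (n j >= next_index n j)%N].

(* All indices are bounded by the leading one, so that the N-th partial sum of
   the series over the leading index is a sum over tuples with entries < N. *)
Definition nested_psum (V : nmodType) strict (f : ('I_p -> nat) -> V)
    (N : nat) : V :=
  \sum_(n : {ffun 'I_p -> 'I_N} | chain strict (fun j => n j))
     f (fun j => n j).

End NestedSums.

Section CMZV.
Variable R : realType.
Local Notation C := R[i].

(* C^o carries the topology of the complex modulus. The limit exists whenever
   all k j > 0, all |z j| <= 1 and (k 0, z 0) <> (1, 1); it is conditional when
   k 0 = 1. *)
Definition Li r (k : 'I_r -> nat) (z : 'I_r -> C) : C :=
  limn (nested_psum (fun=> true)
    (fun m => \prod_j (z j ^+ m j / (m j)%:R ^+ k j)) : nat -> C^o).

Definition span_over (F G : set C) : set C :=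
  [set x | exists (m : nat) (c g : 'I_m -> C),
     [/\ forall i, F (c i), forall i, G (g i) & x = \sum_i c i * g i]].

Definition sum_sets m (V : 'I_m -> set C) : set C :=
  [set x | exists2 y : 'I_m -> C, forall i, V i (y i) & x = \sum_i y i].

Definition Qset : set C := [set x | exists a : rat, x = ratr a].

Definition Qiset : set C :=
  [set x | exists a b : rat, x = ratr a + ratr b * 'i%C].

Definition cmzv4 (w : nat) : set C :=
  [set x | exists (r : nat) (k : 'I_r.+1 -> nat) (z : 'I_r.+1 -> C),
     [/\ forall j, (0 < k j)%N, forall j, z j ^+ 4 = 1,
         (k ord0, z ord0) <> (1%N, 1), (\sum_j k j)%N = w & x = Li k z]].

Definition CMZV4 (w : nat) : set C :=
  if w is 0 then Qset else span_over Qset (cmzv4 w).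

Definition CMZV4_le (w : nat) : set C := sum_sets (fun k : 'I_w.+1 => CMZV4 k).

Definition tensor_Qi (V : set C) : set C := span_over Qiset V.

End CMZV.

Variant lform := L2m | L2m_plus1 | L2m_minus1.

Definition lval (l : lform) (m : nat) : int :=
  match l with
  | L2m => 2 * m%:Z
  | L2m_plus1 => 2 * m%:Z + 1
  | L2m_minus1 => 2 * m%:Z - 1
  end.

Definition nu (l : lform) : nat := if l is L2m_minus1 then 1 else 0.

Definition std_strict (l : lform) : bool := if l is L2m_plus1 then false else true.

Section AperySeries.
Variables (R : realType) (d : nat).

Definition bseq (n : nat) : R := 4 ^+ n / 'C(n.*2, n)%:R.

Definition apery_psum (strict : 'I_d.+1 -> bool) (l : 'I_d.+1 -> lform)
    (s : 'I_d.+1 -> nat) : nat -> R :=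
  nested_psum strict
    (fun n => bseq (n ord0) ^+ 2 / \prod_j (lval (l j) (n j))%:~R ^+ s j).

Definition apery_sum strict l s : R := limn (apery_psum strict l s).

(* In a field of the library 0^-1 = 0, hence the explicit condition that no
   denominator vanishes on the range of summation. *)
Definition apery_defined (strict : 'I_d.+1 -> bool) (l : 'I_d.+1 -> lform) : Prop :=
  forall n : 'I_d.+1 -> nat, chain strict n -> forall j, lval (l j) (n j) != 0.

End AperySeries.

(* Main.v *)
(* Put x = sin t with u = tan (t / 2), and attach to a sequence c the generating
   function Phi(c) = sum_n b_n c_n x^(2n). Since (2n+1) b_(n+1) = (2n+2) b_n,
   passing from c to (sum_(m<n) c_m) / (2n), to (sum_(m<=n) c_m) / (2n+1), to
   c_n / (2n) or to c_n / (2n+1) amounts to one integration of Phi(c) against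
   dt, cot t dt, csc t dt, ..., whose expressions in u have poles only at 0,
   infinity and the fourth roots of unity. For the nested sums built from the
   first two operations, Phi(c) is thus, up to a trigonometric factor, an
   iterated integral in u, whose Taylor coefficients are combinations of the
   summands of Li_k(z) at fourth roots of unity. A further factor b_n and the
   outermost sum turn into one more integration up to u = 1, i.e. t = pi / 2,
   and Abel's theorem identifies the limit with a combination of convergent
   colored values; tracking rational versus purely imaginary coefficients gives
   the Q-statement (a).

   The remaining series reduce to these. The shift n -> n + 1 turns a leading
   1/(2n-1) into 1/(2n+1) at the cost of the factor (1 + 1/(2n+1))^2 from b_n^2,
   hence of two additional weights, and partial fractions separate products of
   1/(2n-1), 1/(2n) and 1/(2n+1). The products of total degree three that would
   leave divergent pieces, such as 1/(4n^2 (2n+1)), are integrated directly, one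
   from each pair related by Abel summation. *)

(* No integral is ever formed: an iterated integral is carried as its Taylor coefficients at u = 0,
   and two primitives are identified by equal derivatives on (0, 1) and a common limit at 0. The
   estimates rest on one majorant, 1 / b_n, of order n^(-1/2). Since sum_(m<=n) 1 / b_m = (2n+1) /
   b_n, it survives summation followed by division by n, for the nested sums as for the summands of
   Li, so no logarithm has to be estimated. Rationality is a parity count. Only the form dt has
   imaginary Fourier coefficients on Z/4, and the factor in front of the power series is 1 exactly
   when dt was used an even number of times; the last integration makes the count even. The obstacle
   is divergence. As b_n^2 grows like n, a partial sum times a product of degree two in 1/(2n-1),
   1/(2n), 1/(2n+1) need not be summable, whereas partial fractions lower the degree. They are
   applied down to degree three only; there the homogeneous relation 2 (2n) = (2n-1) + (2n+1) links
   mixed monomials without leaving degree three. *)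
Require Import Defs.
From mathcomp Require Import ring lra zify.

Set Implicit Arguments.
Unset Strict Implicit.
Unset Printing Implicit Defensive.

(** * Real power series on the open unit disc *)

Section PowerSeries.
Variable R : realType.
Implicit Types (a b : nat -> R) (u x : R).

Definition PS a u : R := limn (pseries a u).

Definition conv a := forall u, `|u| < 1 -> cvgn (pseries a u).

Lemma PS_cvg a u : conv a -> `|u| < 1 -> pseries a u @ \oo --> PS a u.
Proof. by move=> ca /ca. Qed.

Lemma pseriesD a b u : pseries (fun n => a n + b n) u = pseries a u + pseries b u.
Proof.
apply/funext => n; rewrite /pseries /series /= fctE -big_split /=.
by apply: eq_bigr => i _; rewrite mulrDl.
Qed.

Lemma pseriesZ k a u : pseries (fun n => k * a n) u = (fun n => k * pseries a u n).
Proof.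
apply/funext => n; rewrite /pseries /series /= mulr_sumr.
by apply: eq_bigr => i _; rewrite mulrA.
Qed.

Lemma convD a b : conv a -> conv b -> conv (fun n => a n + b n).
Proof. by move=> ca cb u u1; rewrite pseriesD; apply: is_cvgD; [apply: ca|apply: cb]. Qed.

Lemma PSD a b u : conv a -> conv b -> `|u| < 1 ->
  PS (fun n => a n + b n) u = PS a u + PS b u.
Proof.
move=> ca cb u1; apply/cvg_lim => //; rewrite pseriesD.
by apply: cvgD; apply: PS_cvg.
Qed.

Lemma convZ k a : conv a -> conv (fun n => k * a n).
Proof. by move=> ca u u1; rewrite pseriesZ; apply: is_cvgMr; apply: ca. Qed.

Lemma PSZ k a u : conv a -> `|u| < 1 -> PS (fun n => k * a n) u = k * PS a u.
Proof.
move=> ca u1; apply/cvg_lim => //; rewrite pseriesZ.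
by apply: cvgMr; apply: PS_cvg.
Qed.

Lemma convB a b : conv a -> conv b -> conv (fun n => a n - b n).
Proof.
move=> ca cb; have -> : (fun n => a n - b n) = (fun n => a n + (-1) * b n).
  by apply/funext => n; rewrite mulN1r.
by apply: convD => //; exact: convZ.
Qed.

Lemma PSB a b u : conv a -> conv b -> `|u| < 1 ->
  PS (fun n => a n - b n) u = PS a u - PS b u.
Proof.
move=> ca cb u1; have -> : (fun n => a n - b n) = (fun n => a n + (-1) * b n).
  by apply/funext => n; rewrite mulN1r.
by rewrite (PSD ca (convZ (k := -1) cb) u1) (PSZ _ cb u1) mulN1r.
Qed.

Lemma eq_PS a b : a =1 b -> PS a = PS b.
Proof. by move=> /funext ->. Qed.

Lemma eq_conv a b : a =1 b -> conv a -> conv b.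
Proof. by move=> /funext ->. Qed.

Lemma pseriesS a u n : pseries a u n.+1 = a 0%N + u * pseries (a \o S) u n.
Proof.
rewrite /pseries /series /= big_nat_recl //= mulr1 mulr_sumr; congr (_ + _).
by apply: eq_bigr => i _; rewrite exprS; ring.
Qed.

Lemma bounded_conv a M : (forall n, `|a n| <= M) -> conv a.
Proof.
move=> aM u u1; apply: normed_cvg.
apply: (@series_le_cvg _ _ (geometric M `|u|)) => //=.
- by move=> n; rewrite mulr_ge0 // (le_trans _ (aM 0%N)).
- by move=> n; rewrite normrM normrX ler_wpM2r.
- by apply: is_cvg_geometric_series; rewrite normr_id.
Qed.

Lemma conv_bounded a u : conv a -> `|u| < 1 -> exists M : R, forall n, `|a n * u ^+ n| <= M.
Proof.
move=> ca u1; have [K [_ Kf]] := cvg_series_bounded (ca u u1).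
by exists (K + 1) => n; apply: (Kf (K + 1)) => //; rewrite ltrDl.
Qed.

Lemma conv_tail a : conv a -> conv (a \o S).
Proof.
move=> ca u u1.
case: (eqVneq u 0) => [->|u0].
  (* Division by [u] is impossible at 0; convergence at 1/2 is used instead. *)
  apply: (@is_cvg_pseries_inside _ _ (1/2)); last by rewrite normr0 normr_gt0; lra.
  have h : `|1/2 : R| < 1 by rewrite ger0_norm; lra.
  have := ca _ h; have -> : pseries (a \o S) (1/2) =
     (fun n => 2 * (pseries a (1/2) n.+1 - a 0%N)).
    by apply/funext => n; rewrite pseriesS; field.
  move=> c; apply: is_cvgMr; apply: is_cvgB; last exact: is_cvg_cst.
  by apply/cvg_ex; exists (PS a (1/2)); rewrite cvg_shiftS.
have := ca _ u1; have -> : pseries (a \o S) u =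
     (fun n => u^-1 * (pseries a u n.+1 - a 0%N)).
  by apply/funext => n; rewrite pseriesS; field.
move=> c; apply: is_cvgMr; apply: is_cvgB; last exact: is_cvg_cst.
by apply/cvg_ex; exists (PS a u); rewrite cvg_shiftS.
Qed.

Lemma PSS a u : conv a -> `|u| < 1 -> PS a u = a 0%N + u * PS (a \o S) u.
Proof.
move=> ca u1; have ct := conv_tail ca.
apply/cvg_lim => //; rewrite -cvg_shiftS.
under eq_fun do rewrite pseriesS.
by apply: cvgD; [exact: cvg_cst|apply: cvgMr; apply: PS_cvg].
Qed.

Lemma conv_natmul a : conv a -> conv (fun n => n%:R * a n).
Proof.
move=> ca u u1.
have u0 : 0 <= `|u| := normr_ge0 _.
have [q [q0 q1 uq]] : exists q : R, [/\ 0 < q, q < 1 & `|u| < q].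
  by exists ((1 + `|u|) / 2); split; lra.
have [M aM] : exists M : R, forall n, `|a n * q ^+ n| <= M.
  by apply: conv_bounded ca _; rewrite gtr0_norm.
have M0 : 0 <= M by rewrite (le_trans _ (aM 0%N)).
(* As |u| = q r^2, the term n a_n u^n splits into the bounded a_n q^n, the bounded n r^n, and a
   geometric r^n. *)
pose r : R := Num.sqrt (`|u| / q).
have rr : r ^+ 2 = `|u| / q by rewrite sqr_sqrtr // divr_ge0 // ltW.
have r0 : 0 <= r by rewrite sqrtr_ge0.
have r1 : r < 1.
  by rewrite -(@ltr_pXn2r _ 2) ?nnegrE // rr expr1n ltr_pdivrMr // mul1r.
have nr n : n%:R * r ^+ n <= (1 - r)^-1.
  have h : n%:R * r ^+ n <= \sum_(i < n) r ^+ i.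
    rewrite -[n in n%:R]card_ord -sumr_const mulr_suml ler_sum // => i _.
    by rewrite mul1r; apply: ler_wiXn2l => //; [exact: ltW|exact: ltnW].
  rewrite (le_trans h) // -[X in _ <= X]mul1r ler_pdivlMr ?subr_gt0 //.
  have := subrX1 r n; rewrite -(opprB 1 (r ^+ n)) -(opprB 1 r) mulNr => /oppr_inj.
  by rewrite mulrC => <-; rewrite gerBl exprn_ge0.
apply: normed_cvg.
apply: (@series_le_cvg _ _ (geometric (M / (1 - r)) r)) => //=.
- by move=> n; rewrite mulr_ge0 ?exprn_ge0 // divr_ge0 // subr_ge0 ltW.
- move=> n; rewrite !normrM normrX ger0_norm //.
  have -> : `|u| = q * r * r by rewrite -mulrA -expr2 rr; field; lra.
  rewrite !exprMn.
  have -> : n%:R * `|a n| * (q ^+ n * r ^+ n * r ^+ n) =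
    (`|a n| * q ^+ n) * (n%:R * r ^+ n) * r ^+ n by ring.
  rewrite ler_wpM2r ?exprn_ge0 // ler_pM //.
  + by rewrite mulr_ge0 // exprn_ge0 // ltW.
  + by rewrite mulr_ge0 // exprn_ge0.
  + by rewrite -(ger0_norm (exprn_ge0 n (ltW q0))) -normrM.
- by apply: is_cvg_geometric_series; rewrite ger0_norm.
Qed.

Lemma conv_diffs a : conv a -> conv (pseries_diffs a).
Proof. by move=> /conv_natmul /conv_tail. Qed.

Lemma is_derive_PS a u : conv a -> `|u| < 1 ->
  is_derive u (1 : R) (PS a) (PS (pseries_diffs a) u).
Proof.
move=> ca u1; have cd := conv_diffs ca; have cdd := conv_diffs cd.
have u0 : 0 <= `|u| := normr_ge0 _.
have h : `|(1 + `|u|) / 2| = (1 + `|u|) / 2 by rewrite ger0_norm; lra.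
by apply: (@pseries_snd_diffs _ a ((1 + `|u|) / 2));
  [apply: ca|apply: cd|apply: cdd|]; rewrite h; lra.
Qed.

Lemma PS_diffs a u : conv a -> `|u| < 1 ->
  u * PS (pseries_diffs a) u = PS (fun n => n%:R * a n) u.
Proof. by move=> ca u1; rewrite [RHS](PSS (conv_natmul ca)) // mul0r add0r. Qed.

Lemma PS0 a : conv a -> PS a 0 = a 0%N.
Proof. by move=> ca; rewrite PSS ?normr0 // mul0r addr0. Qed.
End PowerSeries.

(** * Differentiation rules, and equality of functions from equal derivatives *)

Section Derivatives.
Variable R : realType.
Implicit Types (f g : R -> R) (u a b : R).

Lemma der_add f g u a b : is_derive u (1 : R) f a -> is_derive u (1 : R) g b ->
  is_derive u (1 : R) (fun x => f x + g x) (a + b).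
Proof. by move=> ha hb; exact: is_deriveD. Qed.

Lemma der_opp f u a : is_derive u (1 : R) f a ->
  is_derive u (1 : R) (fun x => - f x) (- a).
Proof. by move=> ha; exact: is_deriveN. Qed.

Lemma der_mul f g u a b : is_derive u (1 : R) f a -> is_derive u (1 : R) g b ->
  is_derive u (1 : R) (fun x => f x * g x) (a * g u + f u * b).
Proof.
move=> ha hb; apply: (is_derive_eq (is_deriveM ha hb)).
by rewrite /GRing.scale /=; ring.
Qed.

Lemma der_inv f u a : f u != 0 -> is_derive u (1 : R) f a ->
  is_derive u (1 : R) (fun x => (f x)^-1) (- a / f u ^+ 2).
Proof.
move=> fu ha; apply: (is_derive_eq (is_deriveV fu ha)).
by rewrite /GRing.scale /=; ring.
Qed.

Lemma der_cst (k : R) u : is_derive u (1 : R) (fun=> k) 0.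
Proof. exact: is_derive_cst. Qed.

Lemma der_id u : is_derive u (1 : R) (fun x => x) 1.
Proof. exact: is_derive_id. Qed.

Lemma der_sqr f u a : is_derive u (1 : R) f a ->
  is_derive u (1 : R) (fun x => f x ^+ 2) (2 * f u * a).
Proof.
move=> ha; apply: (is_derive_eq (der_mul ha ha)).
by ring.
Qed.

Lemma der_cvg_right f u a : is_derive u (1 : R) f a -> f v @[v --> u^'+] --> f u.
Proof.
by case=> fu _; apply: cvg_at_right_filter; apply/differentiable_continuous/derivable1_diffP.
Qed.

(** This replaces integration: [f - g] is constant on (0, 1) by the mean value theorem, and the
    limit at 0 fixes the constant. Only a one-sided limit is asked for, because the functions in use
    contain factors such as 1 / sin t. *)
Lemma eq_of_derive f g (df : R -> R) :
  (forall u, 0 < u < 1 -> is_derive u (1 : R) f (df u)) ->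
  (forall u, 0 < u < 1 -> is_derive u (1 : R) g (df u)) ->
  f u - g u @[u --> 0^'+] --> (0 : R) ->
  forall u, 0 < u < 1 -> f u = g u.
Proof.
move=> fd gd lim0.
pose h u := f u - g u.
have hd u : 0 < u < 1 -> is_derive u (1 : R) h 0.
  move=> u01; apply: is_derive_eq; last exact: (subrr (df u)).
  by apply: der_add; [exact: fd|apply: der_opp; exact: gd].
have hc u v : 0 < u < 1 -> 0 < v -> v <= u -> h v = h u.
  move=> /andP[u0 u1] v0 vu.
  have [||c _] := @MVT_segment _ h (fun=> 0) v u vu.
  - move=> y; rewrite in_itv /= => /andP[vy yu]; apply: hd.
    by rewrite (lt_trans v0 vy) (lt_trans yu u1).
  - apply: derivable_within_continuous => y; rewrite in_itv /= => /andP[vy yu].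
    by have [] : is_derive y (1 : R) h 0 by apply: hd; rewrite (lt_le_trans v0 vy) (le_lt_trans yu u1).
  - by rewrite mul0r => /eqP; rewrite subr_eq0 => /eqP.
move=> u u01; apply/eqP; rewrite -subr_eq0 -/(h u); apply/eqP.
have h1 : h v @[v --> 0^'+] --> h u.
  have u0 : 0 < u by case/andP: u01.
  apply: cvg_near_cst; near=> v; apply: hc; first exact: u01.
  - by near: v; apply: nbhs_right_gt.
  - by near: v; apply: nbhs_right_le.
exact: (cvg_unique _ h1 lim0).
Unshelve. all: by end_near. Qed.

End Derivatives.

Ltac der := repeat first [apply: der_cst | apply: der_id | apply: der_opp | apply: der_add
  | apply: der_sqr | apply: der_mul | apply: der_inv].

(** * The parametrisation u = tan (t / 2) and even power series in sin t *)

Section Param.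
Variable R : realType.
Implicit Types (u : R).

(* With u = tan (t / 2): the functions sin t, cos t and dt / du. *)
Definition sn u : R := 2 * u / (1 + u ^+ 2).
Definition cs u : R := (1 - u ^+ 2) / (1 + u ^+ 2).
Definition tau u : R := 2 / (1 + u ^+ 2).

Lemma sqr1_gt0 u : 0 < 1 + u ^+ 2.
Proof. by rewrite ltr_pwDl // sqr_ge0. Qed.

Lemma sn2cs2 u : cs u ^+ 2 = 1 - sn u ^+ 2.
Proof. by rewrite /cs /sn; have := sqr1_gt0 u => h; field; rewrite gt_eqF. Qed.

Lemma der_sn u : is_derive u (1 : R) sn (cs u * tau u).
Proof.
have h := sqr1_gt0 u; rewrite /sn /cs /tau.
apply: is_derive_eq; first by der; rewrite gt_eqF.
by rewrite /GRing.scale /=; field; rewrite gt_eqF.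
Qed.

Lemma der_cs u : is_derive u (1 : R) cs (- sn u * tau u).
Proof.
have h := sqr1_gt0 u; rewrite /sn /cs /tau.
apply: is_derive_eq; first by der; rewrite gt_eqF.
by rewrite /GRing.scale /=; field; rewrite gt_eqF.
Qed.

Lemma sn_gt0 u : 0 < u -> 0 < sn u.
Proof. by move=> u0; rewrite /sn divr_gt0 ?sqr1_gt0 // mulr_gt0. Qed.

Lemma cs_gt0 u : 0 < u < 1 -> 0 < cs u.
Proof.
move=> /andP[u0 u1]; rewrite /cs divr_gt0 ?sqr1_gt0 // subr_gt0.
by rewrite expr_lt1 // ltW.
Qed.

Lemma sn2_lt1 u : 0 <= u < 1 -> `|sn u ^+ 2| < 1.
Proof.
move=> /andP[u0 u1]; rewrite ger0_norm ?sqr_ge0 // -subr_gt0 -sn2cs2 exprn_gt0 //.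
by rewrite /cs divr_gt0 ?sqr1_gt0 // subr_gt0 expr_lt1.
Qed.

Definition PX (al : nat -> R) u := PS al (sn u ^+ 2).

(** Coefficients of x d/dx applied to the sum of al_n x^(2n). *)
Definition twice_mul (al : nat -> R) n : R := n.*2%:R * al n.

Lemma conv_twice_mul al : conv al -> conv (twice_mul al).
Proof.
move=> ca; apply: (@eq_conv _ (fun n => 2 * (n%:R * al n))).
  by move=> n; rewrite /twice_mul -mul2n natrM mulrA.
exact/convZ/conv_natmul.
Qed.

Lemma PX0 al : conv al -> PX al u @[u --> 0^'+] --> al 0%N.
Proof.
move=> ca; have s0 : sn 0 ^+ 2 = 0 by rewrite /sn mulr0 mul0r expr0n.
have y1 : `|sn 0 ^+ 2| < 1 by apply: sn2_lt1; rewrite lexx /=.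
have := der_cvg_right (@is_derive1_comp _ (PS al) (fun u => sn u ^+ 2) _ _ _ (is_derive_PS ca y1) (der_sqr (der_sn 0))).
by rewrite /= s0 PS0.
Qed.

Lemma sn_cvg0 : sn u @[u --> 0^'+] --> (0 : R).
Proof. by have := der_cvg_right (der_sn 0); rewrite {2}/sn mulr0 mul0r. Qed.

Lemma cs_cvg0 : cs u @[u --> 0^'+] --> (1 : R).
Proof. by have := der_cvg_right (der_cs 0); rewrite {2}/cs expr0n /= subr0 addr0 divr1. Qed.

Lemma der_PX al u : conv al -> 0 < u < 1 ->
  is_derive u (1 : R) (PX al) (cs u / sn u * tau u * PX (twice_mul al) u).
Proof.
move=> ca /andP[u0 u1].
have y1 : `|sn u ^+ 2| < 1 by apply: sn2_lt1; rewrite ltW.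
have x0 : sn u != 0 by rewrite gt_eqF // sn_gt0.
have H := @is_derive1_comp _ (PS al) (fun u => sn u ^+ 2) _ _ _ (is_derive_PS ca y1) (der_sqr (der_sn u)).
apply: (is_derive_eq H).
rewrite (_ : PX (twice_mul al) u = 2 * PX (fun n => n%:R * al n) u); last first.
  rewrite /PX -PSZ //; last exact: conv_natmul.
  by congr (PS _ _); apply/funext => n; rewrite /twice_mul -mul2n natrM mulrA.
by rewrite /PX -PS_diffs //; field.
Qed.

Section FourDerivatives.
Variables (al ga : nat -> R) (u : R).
Hypotheses (cal : conv al) (u01 : 0 < u < 1).

Let x0 : sn u != 0. Proof. by rewrite gt_eqF // sn_gt0 //; case/andP: u01. Qed.
Let y1 : `|sn u ^+ 2| < 1.
Proof. by apply: sn2_lt1; case/andP: u01 => /ltW -> ->. Qed.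
Let ctw := conv_twice_mul cal.

Let t0 : twice_mul al 0%N = 0. Proof. exact: mul0r. Qed.

Lemma PX_twiceD1 : PX (fun n => n.*2.+1%:R * al n) u = PX (twice_mul al) u + PX al u.
Proof.
rewrite /PX -PSD //; congr (PS _ _); apply/funext => n.
by rewrite /twice_mul -natr1; ring.
Qed.

(** For al_n = b_n c'_n the relation (2n+1) b_(n+1) = (2n+2) b_n turns the left side of the
    recurrence into b_n times the difference of (2n+2) c'_(n+1) and 2n c'_n. It is thus tailored to
    c'_n = (sum_(m<n) c_m) / (2n). *)
Lemma der_cot_PX : al 0%N = 0 ->
  (forall n, n.*2.+1%:R * al n.+1 - n.*2%:R * al n = ga n) ->
  is_derive u (1 : R) (fun u => cs u / sn u * PX al u) (tau u * PX ga u).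
Proof.
move=> a0 rec.
have E : PX ga u = PX (twice_mul al \o S) u - PX (al \o S) u - PX (twice_mul al) u.
  have c1 := conv_tail ctw; have c2 := conv_tail cal.
  rewrite /PX -(PSB c1 c2 y1) -(PSB (convB c1 c2) ctw y1).
  by congr (PS _ _); apply/funext => n; rewrite -rec /twice_mul /= doubleS -!natr1; ring.
apply: (is_derive_eq (der_mul (der_mul (der_cs u) (der_inv x0 (der_sn u))) (der_PX cal u01))).
rewrite E; have := PSS cal y1; have := PSS ctw y1; rewrite -!/(PX _ u) a0 t0 !add0r => h1 h2.
have {h1} : PX (twice_mul al \o S) u = PX (twice_mul al) u / sn u ^+ 2 by rewrite h1; field.
have {h2} : PX (al \o S) u = PX al u / sn u ^+ 2 by rewrite h2; field.
move=> -> ->; move: (PX (twice_mul al) u) (PX al u) => p q.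
apply/eqP; rewrite -subr_eq0; apply/eqP.
(* The difference is arranged as a combination that vanishes by cos^2 = 1 - sin^2, the one relation
   [field] cannot see. *)
transitivity ((p * cs u ^+ 2 - q - (p * (1 - sn u ^+ 2) - q) + q - q * (sn u ^+ 2 + cs u ^+ 2)) * tau u / sn u ^+ 2); first by field.
by rewrite sn2cs2; field.
Qed.

(** Here al_n = b_n c'_n makes the left side b_(n+1) times the difference of (2n+3) c'_(n+1) and
    (2n+1) c'_n, as fits c'_n = (sum_(m<=n) c_m) / (2n+1). *)
Lemma der_sncs_PX : conv ga -> al 0%N = ga 0%N ->
  (forall n, n.+1.*2.+1%:R * al n.+1 - n.+1.*2%:R * al n = ga n.+1) ->
  is_derive u (1 : R) (fun u => sn u * cs u * PX al u) (tau u * PX ga u).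
Proof.
move=> cga a0 rec.
apply: (is_derive_eq (der_mul (der_mul (der_sn u) (der_cs u)) (der_PX cal u01))).
have c1 := conv_tail ctw; have c2 := conv_tail cal.
have E : PX (ga \o S) u = PX (twice_mul al \o S) u + PX (al \o S) u - PX (twice_mul al) u - 2 * PX al u.
  rewrite /PX -(PSZ _ cal y1) -(PSD c1 c2 y1) -(PSB (convD c1 c2) ctw y1).
  rewrite -(PSB (convB (convD c1 c2) ctw) (convZ (k := 2) cal) y1).
  congr (PS _ _); apply/funext => n.
  by rewrite /= -rec /twice_mul /= !doubleS -!natr1; ring.
have := PSS cal y1; have := PSS ctw y1; have := PSS cga y1.
rewrite -!/(PX _ u) -a0 {}E t0 add0r => -> h1 h2.
have {h1} : PX (twice_mul al \o S) u = PX (twice_mul al) u / sn u ^+ 2 by rewrite h1; field.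
have {h2} : PX (al \o S) u = (PX al u - al 0%N) / sn u ^+ 2 by rewrite h2; field.
move=> -> ->; move: (PX (twice_mul al) u) (PX al u) => p q.
apply/eqP; rewrite -subr_eq0; apply/eqP.
transitivity ((p + q) * tau u * (cs u ^+ 2 - (1 - sn u ^+ 2))); first by field.
by rewrite sn2cs2; ring.
Qed.

Lemma der_sn_PX : (forall n, n.*2.+1%:R * al n = ga n) ->
  is_derive u (1 : R) (fun u => sn u * PX al u) (cs u * tau u * PX ga u).
Proof.
move=> rec; apply: (is_derive_eq (der_mul (der_sn u) (der_PX cal u01))).
have -> : PX ga u = PX (twice_mul al) u + PX al u.
  by rewrite -PX_twiceD1; congr (PX _ _); apply/funext.
by field.
Qed.

(** This one is for al_n = r_n / b_n: since (2n+2) / b_(n+1) = (2n+1) / b_n, the left side is (2n+1)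
    / b_n times r_n - r_(n+1). It serves the summation by parts behind the limit at u = 1. *)
Lemma der_cs_PX : conv ga ->
  (forall n, n.*2.+1%:R * al n - n.+1.*2%:R * al n.+1 = ga n) ->
  is_derive u (1 : R) (fun u => - (cs u * PX al u)) (sn u * tau u * PX ga u).
Proof.
move=> cga rec.
apply: (is_derive_eq (der_opp (der_mul (der_cs u) (der_PX cal u01)))).
have c1 := conv_tail ctw; have c2 := conv_tail cal.
have -> : PX ga u = PX (twice_mul al) u + PX al u - PX (twice_mul al \o S) u.
  rewrite /PX -(PSD ctw cal y1) -(PSB (convD ctw cal) c1 y1).
  by congr (PS _ _); apply/funext => n; rewrite /= -rec /twice_mul /= -!natr1; ring.
have := PSS ctw y1; rewrite -!/(PX _ u) t0 add0r => h1.
have {h1} : PX (twice_mul al \o S) u = PX (twice_mul al) u / sn u ^+ 2 by rewrite h1; field.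
move=> ->; move: (PX (twice_mul al) u) (PX al u) => p q.
apply/eqP; rewrite -subr_eq0; apply/eqP.
transitivity (p * tau u / sn u * (1 - sn u ^+ 2 - cs u ^+ 2)); first by field.
by rewrite sn2cs2; ring.
Qed.

End FourDerivatives.
End Param.

(* The 1-form (l0 / u + (l1 + l2 u + l3 u^2 + l4 u^3) / (1 - u^4)) du. *)
Record letter := Letter { l0 : int; l1 : int; l2 : int; l3 : int; l4 : int }.

(** * Integration against a letter as an operator on Taylor coefficients *)

Section Letters.
Variable R : realType.
Implicit Types (l : letter) (a : nat -> R) (u : R).

(** The Taylor coefficients of u phi(u), periodic modulo 4 from index 1 on. *)
Definition eps l (m : nat) : int :=
  if m is m'.+1 then
    match (m' %% 4)%N with 0%N => l1 l | 1%N => l2 l | 2%N => l3 l | _ => l4 l end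
  else l0 l.

Definition phi l u : R := (l0 l)%:~R / u +
  ((l1 l)%:~R + (l2 l)%:~R * u + (l3 l)%:~R * u ^+ 2 + (l4 l)%:~R * u ^+ 3) / (1 - u ^+ 4).

Definition letconv l a (m : nat) : R := \sum_(k < m) (eps l (m - k)%N)%:~R * a k.

(** Taylor coefficients of the primitive of phi times the series of [a]. The convention 0^-1 = 0
    gives the constant term 0, that is, integration from 0. *)
Definition letop l a (m : nat) : R := ((l0 l)%:~R * a m + letconv l a m) / m%:R.

(** Boundedness is the invariant because [letop] keeps it: the convolution of two bounded sequences
    grows at most linearly, and [letop] divides by m. *)
Definition bnd a := exists M : R, forall n, `|a n| <= M.

Lemma bnd_conv a : bnd a -> conv a.
Proof. by move=> [M aM]; exact: bounded_conv aM. Qed.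

Lemma eps_bounded l : exists2 E : R, 0 <= E & forall m, `|(eps l m)%:~R : R| <= E.
Proof.
exists (`|(l0 l)%:~R| + `|(l1 l)%:~R| + `|(l2 l)%:~R| + `|(l3 l)%:~R| + `|(l4 l)%:~R|).
  by rewrite !addr_ge0.
have H (x0 x1 x2 x3 x4 : R) : [/\ `|x0| <= `|x0| + `|x1| + `|x2| + `|x3| + `|x4|,
    `|x1| <= `|x0| + `|x1| + `|x2| + `|x3| + `|x4|,
    `|x2| <= `|x0| + `|x1| + `|x2| + `|x3| + `|x4|,
    `|x3| <= `|x0| + `|x1| + `|x2| + `|x3| + `|x4| &
    `|x4| <= `|x0| + `|x1| + `|x2| + `|x3| + `|x4|].
  have := normr_ge0 x0; have := normr_ge0 x1; have := normr_ge0 x2.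
  by have := normr_ge0 x3; have := normr_ge0 x4; split; lra.
have [h0 h1 h2 h3 h4] := H (l0 l)%:~R (l1 l)%:~R (l2 l)%:~R (l3 l)%:~R (l4 l)%:~R.
case=> [|m] //=.
by case: (m %% 4)%N => [|[|[|k]]].
Qed.

Lemma letconv_le l a : bnd a -> exists2 M : R, 0 <= M & forall m, `|letconv l a m| <= m%:R * M.
Proof.
move=> [M aM]; have [E E0 epsE] := eps_bounded l.
have M0 : 0 <= M by rewrite (le_trans _ (aM 0%N)).
exists (E * M); first exact: mulr_ge0.
move=> m; rewrite (le_trans (ler_norm_sum _ _ _)) //.
rewrite -[m in m%:R]card_ord -sumr_const mulr_suml; apply: ler_sum => i _.
by rewrite mul1r normrM ler_pM.
Qed.

Lemma bnd_letop l a : bnd a -> bnd (letop l a).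
Proof.
move=> ba; have [M M0 cM] := letconv_le l ba; case: ba => N aN.
have N0 : 0 <= N by rewrite (le_trans _ (aN 0%N)).
exists (`|(l0 l)%:~R| * N + M) => m; rewrite /letop normrM normfV [`|m%:R|]ger0_norm //.
case: m => [|m]; first by rewrite invr0 mulr0 addr_ge0 // mulr_ge0.
rewrite ler_pdivrMr ?ltr0n // (le_trans (ler_normD _ _)) // mulrDl lerD //; last first.
  by rewrite mulrC.
rewrite normrM -mulrA ler_wpM2l // (le_trans (aN _)) //.
by rewrite ler_peMr // ler1n.
Qed.

Lemma conv_letconv l a : bnd a -> conv (letconv l a).
Proof.
move=> ba; have [M M0 cM] := letconv_le l ba.
have b1 : bnd (fun m => letconv l a m / m%:R).
  exists M => -[|m]; first by rewrite invr0 mulr0 normr0.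
  by rewrite normrM normfV [`|m.+1%:R|]ger0_norm // ler_pdivrMr ?ltr0n // mulrC.
apply: (@eq_conv _ (fun m => m%:R * (letconv l a m / m%:R))).
  case=> [|m]; first by rewrite mul0r /letconv big_ord0.
  by rewrite mulrC divfK // pnatr_eq0.
exact/conv_natmul/bnd_conv.
Qed.

(** Multiplication by 1 - u^4 read on coefficients, by the period 4 of [eps]. *)
Lemma letconv_rec l a m : letconv l a (m + 4)%N = letconv l a m +
  ((l4 l)%:~R * a m + (l3 l)%:~R * a m.+1 + (l2 l)%:~R * a m.+2 + (l1 l)%:~R * a m.+3).
Proof.
rewrite /letconv addn4 !big_ord_recr /=.
have h4 : (m.+4 - m = 4)%N by rewrite -addn4 addKn.
have h3 : (m.+4 - m.+1 = 3)%N by rewrite subSS -addn3 addKn.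
have h2 : (m.+4 - m.+2 = 2)%N by rewrite !subSS -addn2 addKn.
have h1 : (m.+4 - m.+3 = 1)%N by rewrite !subSS -addn1 addKn.
rewrite h1 h2 h3 h4 -!addrA; congr (_ + _).
apply: eq_bigr => i _; congr (_%:~R * _).
have im := ltn_ord i.
have -> : (m.+4 - i = (m - i).-1.+1 + 4)%N.
  by rewrite prednK ?subn_gt0 // -addn4 addnBAC // ltnW.
rewrite -[in RHS](prednK (_ : 0 < m - i)%N) ?subn_gt0 //.
by rewrite addn4 /eps -addn4 modnDr.
Qed.

Lemma PS_letconv l a u : bnd a -> 0 < u < 1 ->
  PS (letconv l a) u = u * ((l1 l)%:~R + (l2 l)%:~R * u + (l3 l)%:~R * u ^+ 2
     + (l4 l)%:~R * u ^+ 3) / (1 - u ^+ 4) * PS a u.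
Proof.
move=> ba /andP[u0 u1]; have ca := bnd_conv ba; have cs := conv_letconv (l := l) ba.
have un : `|u| < 1 by rewrite ger0_norm // ltW.
have u4 : 1 - u ^+ 4 != 0 by rewrite subr_eq0 eq_sym lt_eqF // expr_lt1 // ltW.
set s := letconv l a in cs *.
have a1 := conv_tail ca; have a2 := conv_tail a1; have a3 := conv_tail a2.
have s1 := conv_tail cs; have s2 := conv_tail s1; have s3 := conv_tail s2.
have ea := PSS ca un; have ea1 := PSS a1 un; have ea2 := PSS a2 un.
have es := PSS cs un; have es1 := PSS s1 un; have es2 := PSS s2 un; have := PSS s3 un.
have z4 := convZ (k := (l4 l)%:~R) ca; have z3 := convZ (k := (l3 l)%:~R) a1.
have z2 := convZ (k := (l2 l)%:~R) a2; have z1 := convZ (k := (l1 l)%:~R) a3.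
(* The fourth shift of [s] closes up by the recurrence, which determines the generating function
   without a Cauchy product. *)
have -> : PS (((s \o S) \o S) \o S \o S) u = PS s u +
   ((l4 l)%:~R * PS a u + ((l3 l)%:~R * PS (a \o S) u + ((l2 l)%:~R * PS (a \o S \o S) u
   + (l1 l)%:~R * PS (a \o S \o S \o S) u))).
  rewrite -(PSZ _ ca un) -(PSZ _ a1 un) -(PSZ _ a2 un) -(PSZ _ a3 un).
  rewrite -(PSD z2 z1 un) -(PSD z3 (convD z2 z1) un) -(PSD z4 (convD z3 (convD z2 z1)) un).
  rewrite -(PSD cs (convD z4 (convD z3 (convD z2 z1))) un).
  by congr (PS _ u); apply/funext => n; rewrite /s /= -addn4 letconv_rec !addrA.
move=> es3; move: ea ea1 ea2 es es1 es2 es3.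
have -> : s 0%N = 0 by rewrite /s /letconv big_ord0.
have v1 : s 1%N = (l1 l)%:~R * a 0%N.
  by rewrite /s /letconv !big_ord_recr big_ord0 /= add0r.
have v2 : s 2%N = (l2 l)%:~R * a 0%N + (l1 l)%:~R * a 1%N.
  by rewrite /s /letconv !big_ord_recr big_ord0 /= add0r.
have v3 : s 3%N = (l3 l)%:~R * a 0%N + (l2 l)%:~R * a 1%N + (l1 l)%:~R * a 2%N.
  by rewrite /s /letconv !big_ord_recr big_ord0 /= add0r.
rewrite /= v1 v2 v3.
move: (PS s u) (PS (s \o S) u) (PS (s \o S \o S) u) (PS (s \o S \o S \o S) u).
move: (PS (a \o S \o S \o S) u) (PS (a \o S \o S) u) (PS (a \o S) u) (PS a u).
move=> A3 A2 A1 A S0 S1 S2 S3 ea ea1 ea2 es es1 es2 es3.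
apply: (mulIf u4); rewrite mulrAC divfK // [LHS]mulrBr mulr1 {1}es es1 es2 es3.
by rewrite ea ea1 ea2; ring.
Qed.

Lemma PS_right0 a : bnd a -> PS a u @[u --> 0^'+] --> a 0%N.
Proof.
move=> ba; have ca := bnd_conv ba.
have h : `|0 : R| < 1 by rewrite normr0.
by have := der_cvg_right (is_derive_PS ca h); rewrite PS0.
Qed.

(** The condition on [a 0] removes a term in 1 / u, whose primitive would be a logarithm rather than
    a power series. *)
Lemma der_letop l a u : bnd a -> (l0 l)%:~R * a 0%N = 0 -> 0 < u < 1 ->
  is_derive u (1 : R) (PS (letop l a)) (phi l u * PS a u).
Proof.
move=> ba la u01; have cl := bnd_conv (bnd_letop l ba).
have [u0 u1] := andP u01.
have un : `|u| < 1 by rewrite ger0_norm // ltW.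
have u4 : 1 - u ^+ 4 != 0 by rewrite subr_eq0 eq_sym lt_eqF // expr_lt1 // ltW.
apply: (is_derive_eq (is_derive_PS cl un)).
apply: (mulfI (lt0r_neq0 u0)); rewrite PS_diffs //.
have -> : PS (fun n => n%:R * letop l a n) u = (l0 l)%:~R * PS a u + PS (letconv l a) u.
  have ca := bnd_conv ba; have cc := conv_letconv (l := l) ba.
  rewrite -PSZ // -PSD //; last exact: convZ.
  congr (PS _ _); apply/funext => -[|n].
    by rewrite mul0r /letconv big_ord0 addr0.
  by rewrite /letop mulrC divfK // pnatr_eq0.
rewrite PS_letconv // /phi; field.
by rewrite u4 lt0r_neq0.
Qed.

Lemma int_letter l a (g : R -> R) : bnd a -> (l0 l)%:~R * a 0%N = 0 ->
  (forall u, 0 < u < 1 -> is_derive u (1 : R) g (phi l u * PS a u)) ->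
  g u @[u --> 0^'+] --> (0 : R) -> forall u, 0 < u < 1 -> g u = PS (letop l a) u.
Proof.
move=> ba la gd g0; apply: eq_of_derive gd _ _.
  by move=> u u01; exact: der_letop.
rewrite -[0 in X in _ --> X]subr0; apply: cvgB => //.
by have := PS_right0 (bnd_letop l ba); rewrite {2}/letop invr0 mulr0.
Qed.

Lemma series_trunc (s : nat -> R) K N : (forall n, 0 <= s n) ->
  series (fun n => if (n < K)%N then s n else 0) N <= series s K.
Proof.
move=> s0; rewrite /series /=; have [NK|KN] := leqP N K.
  rewrite [leRHS](big_cat_nat (leq0n N) NK) //=.
  rewrite ler_wpDr ?sumr_ge0 // ler_sum_nat // => i /andP[_ iN].
  by rewrite (leq_trans iN NK).
rewrite (big_cat_nat (leq0n K) (ltnW KN)) //=.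
rewrite [X in _ + X]big_nat_cond [X in _ + X]big1 ?addr0; last first.
  by move=> i; rewrite andbT => /andP[Ki _]; rewrite ltnNge Ki.
by rewrite ler_sum_nat // => i /andP[_ ->].
Qed.

(** A null sequence stays null under weighted means: the weights m(u) w_n y(u)^n have bounded total
    mass, and each single one tends to 0. It is used with w = 1, m = 1 - u, y = u for Abel's
    theorem, and with w = 1 / b, m = cos t, y = sin^2 t, where the total mass is exactly 1. *)
Lemma lim1_weight (w s : nat -> R) (m y : R -> R) C :
  (forall n, 0 <= w n <= 1) -> s @ \oo --> (0 : R) ->
  (forall u, 0 < u < 1 -> [/\ 0 <= m u, 0 <= y u < 1 & m u * PS w (y u) <= C]) ->
  m u @[u --> 1^'-] --> (0 : R) ->
  m u * PS (fun n => s n * w n) (y u) @[u --> 1^'-] --> (0 : R).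
Proof.
move=> w01 s0 my m0.
have [M [_ sM]] := cvg_seq_bounded (cvgP _ s0).
have {sM} sM n : `|s n| <= M + 1 by apply: sM; rewrite ?ltrDl.
have cw : conv w by apply: (@bounded_conv _ _ 1) => n; have /andP[w0 w1] := w01 n; rewrite ger0_norm.
have csw : conv (fun n => s n * w n).
  apply: (@bounded_conv _ _ (M + 1)) => n; have /andP[w0 w1] := w01 n.
  by rewrite normrM (ger0_norm w0) (le_trans _ (sM n)) // ler_piMr.
apply/cvgr0Pnorm_le => e e0.
pose C' := Num.max C 1.
have C'0 : 0 < C' by rewrite lt_max ltr01 orbT.
pose d := e / 2 / C'.
have d0 : 0 < d by rewrite !divr_gt0.
have [K _ sK] : \forall n \near \oo, `|s n| <= d by move/cvgr0Pnorm_le : s0; apply.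
pose B := series (fun n => `|s n|) K.
have B0 : 0 <= B by rewrite /B /series /= sumr_ge0.
(* The terms below [K] cost at most [B] in all; from [K] on the sequence is at most [d]. *)
have PSle u : 0 <= y u < 1 -> `|PS (fun n => s n * w n) (y u)| <= B + d * PS w (y u).
  move=> /andP[y0 y1]; have yn : `|y u| < 1 by rewrite ger0_norm.
  have H : (fun N => `|pseries (fun n => s n * w n) (y u) N|) @ \oo --> `|PS (fun n => s n * w n) (y u)|.
    by apply: cvg_norm; exact: PS_cvg.
  have H2 : (fun N => B + d * pseries w (y u) N) @ \oo --> B + d * PS w (y u).
    by apply: cvgD; [exact: cvg_cst|apply: cvgMr; exact: PS_cvg].
  apply: (ler_cvg_to H H2); near=> N => /=.
  rewrite /pseries /series /= (le_trans (ler_norm_sum _ _ _)) //.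
  apply: (@le_trans _ _ (\sum_(0 <= n < N) ((if (n < K)%N then `|s n| else 0) + d * (w n * y u ^+ n)))).
    apply: ler_sum => n _; have /andP[w0 w1] := w01 n.
    have yn0 : 0 <= y u ^+ n by exact: exprn_ge0.
    have yn1 : y u ^+ n <= 1 by apply: exprn_ile1 => //; exact: ltW.
    rewrite !normrM (ger0_norm w0) (ger0_norm yn0) -mulrA.
    have wy0 : 0 <= w n * y u ^+ n by rewrite mulr_ge0.
    have wy1 : w n * y u ^+ n <= 1 by rewrite mulr_ile1.
    case: ltnP => nK; first by apply: ler_wpDr; [rewrite mulr_ge0 // ltW|rewrite ler_piMr].
    by rewrite add0r ler_wpM2r // sK.
  rewrite big_split /= -mulr_sumr lerD2r.
  exact: (@series_trunc (fun n => `|s n|)).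
near=> u.
have u01 : 0 < u < 1.
  by apply/andP; split; near: u; [apply: nbhs_left_gt|apply: nbhs_left_lt].
have [mu0 yu mC] := my u u01.
rewrite normrM (ger0_norm mu0).
apply: (@le_trans _ _ (m u * B + d * (m u * PS w (y u)))).
  by rewrite mulrCA -mulrDr ler_wpM2l // PSle.
have h1 : d * (m u * PS w (y u)) <= e / 2.
  apply: (@le_trans _ _ (d * C')); last by rewrite /d divfK // gt_eqF.
  by rewrite ler_wpM2l ?(ltW d0) // (le_trans mC) // le_max lexx.
have h2 : m u * B <= e / 2.
  have : `|m u| <= e / 2 / (B + 1).
    near: u; move/cvgr0Pnorm_le : m0; apply; rewrite divr_gt0 ?divr_gt0 //.
    by rewrite ltr_wpDl.
  rewrite ger0_norm // => h; apply: (@le_trans _ _ (e / 2 / (B + 1) * (B + 1))).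
    by rewrite ler_pM // lerDl.
  by rewrite divfK // gt_eqF // ltr_wpDl.
lra.
Unshelve. all: by end_near. Qed.

End Letters.

(** * The numbers b_n, Abel's theorem, and limits at u = 1 *)

Section Boundary.
Variable R : realType.
Implicit Types (a t e f : nat -> R) (u : R).

Local Notation b := (bseq R).

Lemma b0 : b 0%N = 1.
Proof. by rewrite /bseq expr0 bin0 divr1. Qed.

Lemma b_gt0 n : 0 < b n.
Proof. by rewrite /bseq divr_gt0 ?exprn_gt0 // ltr0n bin_gt0 -addnn leq_addr. Qed.

Lemma b_neq0 n : b n != 0.
Proof. by rewrite gt_eqF ?b_gt0. Qed.

Lemma bS n : b n.+1 * n.*2.+1%:R = b n * n.+1.*2%:R.
Proof.
have H : ('C(n.+1.*2, n.+1) * n.+1 = 2 * n.*2.+1 * 'C(n.*2, n))%N.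
  have h1 : ('C(n.*2, n) * n`! * n`! = n.*2`!)%N.
    by have := bin_fact (leq_addr n n); rewrite addnK addnn mulnA.
  have h2 : ('C(n.+1.*2, n.+1) * n.+1`! * n.+1`! = n.+1.*2`!)%N.
    by have := bin_fact (leq_addr n.+1 n.+1); rewrite addnK addnn mulnA.
  have f0 := fact_gt0 n.
  have f1 : (0 < n`! * n`! * n.+1)%N by rewrite !muln_gt0 f0.
  apply/eqP; rewrite -(eqn_pmul2l f1); apply/eqP.
  move: h1 h2; rewrite doubleS !factS => h1 h2.
  have -> : (n`! * n`! * n.+1 * ('C(n.*2.+2, n.+1) * n.+1) =
     'C(n.*2.+2, n.+1) * (n.+1 * n`!) * (n.+1 * n`!))%N by ring.
  rewrite h2 -h1 -!muln2; ring.
have c0 : ('C(n.+1.*2, n.+1))%:R != 0 :> R by rewrite pnatr_eq0 -lt0n bin_gt0 -addnn leq_addr.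
have c1 : ('C(n.*2, n))%:R != 0 :> R by rewrite pnatr_eq0 -lt0n bin_gt0 -addnn leq_addr.
have HR : ('C(n.+1.*2, n.+1))%:R * n.+1%:R = 2 * n.*2.+1%:R * ('C(n.*2, n))%:R :> R.
  by rewrite -!natrM H.
rewrite /bseq; apply: (mulIf c0); apply: (mulIf c1).
rewrite (_ : _ * _ * _ * _ = 4 ^+ n.+1 * (n.*2.+1%:R * ('C(n.*2, n))%:R)); last by field.
rewrite [RHS](_ : _ = 4 ^+ n * n.+1.*2%:R * ('C(n.+1.*2, n.+1))%:R); last by field.
have D : n.+1.*2%:R = n.+1%:R * 2 :> R by rewrite -muln2 natrM.
rewrite D exprS; apply: (@mulfI _ 2); first by rewrite pnatr_eq0.
by rewrite [RHS](_ : _ = 4 ^+ n * 4 * ('C(n.+1.*2, n.+1)%:R * n.+1%:R)); [rewrite HR; ring|ring].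
Qed.

Lemma bS_div n : b n.+1 = b n * n.+1.*2%:R / n.*2.+1%:R.
Proof. by rewrite -bS mulfK // pnatr_eq0. Qed.

Lemma b_ge1 n : 1 <= b n.
Proof.
elim: n => [|n IH]; first by rewrite b0.
rewrite bS_div ler_pdivlMr ?ltr0n // mul1r.
apply: (@le_trans _ _ n.+1.*2%:R); first by rewrite ler_nat doubleS.
by rewrite ler_peMl.
Qed.

Lemma invb01 n : 0 <= (b n)^-1 <= 1.
Proof. by rewrite invr_ge0 ltW ?b_gt0 //= invf_le1 ?b_gt0 ?b_ge1. Qed.

(* b_n^2 / (2 n) is nonincreasing. *)
Lemma b_sqr_le n : b n ^+ 2 <= 4 * n.+1%:R.
Proof.
case: n => [|n]; first by rewrite b0 expr1n mulr1 ler1n.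
suff : b n.+1 ^+ 2 <= 4 * n.+1%:R.
  by move/le_trans; apply; rewrite ler_pM2l // ler_nat.
elim: n => [|n IH].
  rewrite bS_div b0 /= mul1r divr1 mulr1 -[_ ^+ 2]/(2 * 2); lra.
rewrite bS_div; set m : R := n%:R.
have m0 : 0 <= m by exact: ler0n.
have E2 : n.+2.*2%:R = 2 * m + 4 by rewrite -muln2 natrM -!natr1 -/m; ring.
have E1 : n.+1.*2.+1%:R = 2 * m + 3 by rewrite -muln2 -natr1 natrM -!natr1 -/m; ring.
have E3 : n.+1%:R = m + 1 by rewrite -natr1.
have E4 : n.+2%:R = m + 2 by rewrite -!natr1 -/m; ring.
rewrite E2 E1 E4; rewrite E3 in IH.
rewrite expr_div_n ler_pdivrMr ?exprn_gt0 //; last by lra.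
rewrite exprMn.
apply: (@le_trans _ _ (4 * (m + 1) * (2 * m + 4) ^+ 2)).
  by rewrite ler_wpM2r ?sqr_ge0.
rewrite -subr_ge0 (_ : _ - _ = 4 * (m + 2)); last by ring.
by rewrite mulr_ge0 //; lra.
Qed.

(** This makes 1 / b_n a fixed point of summing up to n and dividing by 2n+1. As (2n+1) / b_n =
    (2n+2) / b_(n+1), it is also, away from 0, one of summing below n and dividing by 2n. *)
Lemma series_invb n : series (fun m => (b m)^-1) n.+1 = n.*2.+1%:R / b n.
Proof.
elim: n => [|n IH]; first by rewrite /series /= big_nat1 b0 double0 invr1 mulr1.
rewrite seriesSr IH bS_div.
have bn := b_neq0 n.
rewrite doubleS -!natr1; field.
by rewrite bn !natr1 ?pnatr_eq0.
Qed.

Lemma PS_series t u : conv t -> conv (series t \o S) -> `|u| < 1 ->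
  PS t u = (1 - u) * PS (series t \o S) u.
Proof.
move=> ct cs u1; rewrite mulrBl mul1r [in X in X - _](PSS cs u1).
have -> : PS (series t \o S \o S) u = PS (series t \o S) u + PS (t \o S) u.
  rewrite -PSD //; last exact: conv_tail.
  by congr (PS _ _); apply/funext => n /=; rewrite seriesSr.
by rewrite (PSS ct u1) /series /= big_nat1; ring.
Qed.

Lemma PS_one u : `|u| < 1 -> (1 - u) * PS (fun=> 1) u = 1.
Proof.
move=> u1; have c1 : conv (fun=> 1 : R) by apply: (@bounded_conv _ _ 1) => n; rewrite normr1.
by rewrite mulrBl mul1r [in X in X - _](PSS c1 u1) addrK.
Qed.

Lemma onem_cvg1 : (1 - u) @[u --> 1^'-] --> (0 : R).
Proof.
rewrite -(subrr (1 : R)); apply: cvgB; first exact: cvg_cst.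
by apply: cvg_at_left_filter; exact: cvg_id.
Qed.

Lemma cvg_bnd a (l : R) : a @ \oo --> l -> bnd a.
Proof.
move=> al; have [M [_ sM]] := cvg_seq_bounded (cvgP _ al).
by exists (M + 1) => n; apply: sM; rewrite ?ltrDl.
Qed.

(** By [PS_series] the difference from the limit is (1 - u) times the power series of the
    remainders, a weighted mean of a null sequence. *)
Lemma abel t (S0 : R) : series t @ \oo --> S0 -> PS t u @[u --> 1^'-] --> S0.
Proof.
move=> tS.
have tS' : (series t \o S) @ \oo --> S0 by move: tS; rewrite -cvg_shiftS.
have cs := bnd_conv (cvg_bnd tS').
have ct := bnd_conv (cvg_bnd (cvg_series_cvg_0 (cvgP _ tS))).
have c1 : conv (fun=> 1 : R) by apply: (@bounded_conv _ _ 1) => n; rewrite normr1.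
have H : (1 - u) * PS (fun n => ((series t \o S) n - S0) * 1) u @[u --> 1^'-] --> (0 : R).
  apply: (@lim1_weight _ (fun=> 1) (fun n => (series t \o S) n - S0) (fun u => 1 - u) id 1).
  - by move=> n; rewrite ler01 lexx.
  - by rewrite -(subrr S0); apply: cvgB; [|exact: cvg_cst].
  - move=> u /andP[u0 u1]; rewrite subr_ge0 (ltW u1) (ltW u0) u1; split=> //.
    by rewrite PS_one // ger0_norm // ltW.
  - exact: onem_cvg1.
have {}H : (1 - u) * PS (fun n => ((series t \o S) n - S0) * 1) u + S0 @[u --> 1^'-] --> S0.
  by rewrite -[X in _ --> X]add0r; apply: cvgD => //; exact: cvg_cst.
apply: cvg_trans H; apply: near_eq_cvg; near=> u.
have un : `|u| < 1.
  have u0 : 0 < u by near: u; apply: nbhs_left_gt.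
  by rewrite ger0_norm ?ltW //; near: u; apply: nbhs_left_lt.
rewrite (@eq_PS _ _ (fun n => (series t \o S) n + (- S0) * 1)); last by move=> n; rewrite !mulr1.
rewrite PSD //; last exact: convZ.
by rewrite PSZ // mulrDr -PS_series // mulrCA PS_one // mulr1 subrK.
Unshelve. all: by end_near. Qed.

Definition Phi f u := PX (fun n => b n * f n) u.

Lemma cs_cvg1 : cs u @[u --> 1^'-] --> (0 : R).
Proof.
have c1 : cs (1 : R) = 0 by rewrite /cs expr1n subrr mul0r.
rewrite -[X in _ --> X]c1; apply: cvg_at_left_filter.
by apply/differentiable_continuous/derivable1_diffP; case: (der_cs (1 : R)).
Qed.

(** The 1 / b_n are the binomial coefficients of (1 - x^2)^(-1/2) = 1 / cos t. The recurrence of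
    [der_cs_PX] gives the derivative 0. *)
Lemma cs_PX_invb u : 0 < u < 1 -> cs u * PX (fun n => (b n)^-1) u = 1.
Proof.
have cb : conv (fun n => (b n)^-1).
  by apply: (@bounded_conv _ _ 1) => n; have /andP[h0 h1] := invb01 n; rewrite ger0_norm.
have cz : conv (fun=> 0 : R) by apply: (@bounded_conv _ _ 0) => n; rewrite normr0.
have PS00 y : PS (fun=> 0 : R) y = 0.
  rewrite /PS (_ : pseries _ _ = cst 0) ?lim_cst //.
  by apply/funext => n; rewrite /pseries /series /= big1 // => i _; rewrite mul0r.
move=> u01; apply/eqP; rewrite -eqr_opp; apply/eqP; move: u u01.
apply: (@eq_of_derive _ (fun u => - (cs u * PX (fun n => (b n)^-1) u)) (fun=> - 1) (fun=> 0)).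
- move=> u u01; apply: (is_derive_eq (@der_cs_PX _ _ (fun=> 0) u cb u01 cz _)).
    move=> n; rewrite bS_div.
    have bn := b_neq0 n.
    have p1 : n.*2.+1%:R != 0 :> R by rewrite pnatr_eq0.
  have p2 : n.+1.*2%:R != 0 :> R by rewrite pnatr_eq0.
  move: (n.*2.+1%:R : R) (n.+1.*2%:R : R) p1 p2 => p q p1 p2.
  by field; rewrite bn p1 p2.
  by rewrite /PX PS00 mulr0.
- rewrite -[X in _ --> X](subrr (- 1)); apply: cvgB; last exact: cvg_cst.
  apply: cvgN; rewrite -[X in _ --> X]mulr1; apply: cvgM; first exact: cs_cvg0.
  by have := PX0 cb; rewrite b0 invr1.
Qed.

(* With r_k = b_k^-1 * sum_{n >= k} e_n one takes
   g = S0 - cos t * sum_k r_k x^(2k), whose derivative follows by summation by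
   parts; cos t * sum_k r_k x^(2k) tends to 0 at u = 1 because the e_n are summable. *)
Lemma primitive_odd e f (S0 : R) : bnd (fun n => b n * f n) ->
  (forall n, e n = b n ^+ 2 * f n / n.*2.+1%:R) -> series e @ \oo --> S0 ->
  exists g : R -> R,
    [/\ forall u, 0 < u < 1 -> is_derive u (1 : R) g (sn u * tau u * Phi f u),
        g u @[u --> 0^'+] --> (0 : R) & g u @[u --> 1^'-] --> S0].
Proof.
move=> bf ef eS.
pose s n := S0 - series e n.
pose r n := s n * (b n)^-1.
have s0 : s @ \oo --> (0 : R).
  by rewrite -(subrr S0); apply: cvgB => //; exact: cvg_cst.
have [M sM] := cvg_bnd s0.
have cr : conv r.
  apply: (@bounded_conv _ _ M) => n; have /andP[w0 w1] := invb01 n.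
  by rewrite normrM (ger0_norm w0) (le_trans _ (sM n)) // ler_piMr.
exists (fun u => S0 + - (cs u * PX r u)); split.
- move=> u u01; rewrite -[X in is_derive _ _ _ X]add0r; apply: (der_add (der_cst S0 u)).
  apply: der_cs_PX => //; first exact: bnd_conv.
  move=> n; rewrite /r /s seriesSr ef bS_div.
  have bn := b_neq0 n.
  have p1 : n.*2.+1%:R != 0 :> R by rewrite pnatr_eq0.
  have p2 : n.+1.*2%:R != 0 :> R by rewrite pnatr_eq0.
  move: (n.*2.+1%:R : R) (n.+1.*2%:R : R) p1 p2 => p q p1 p2.
  by field; rewrite bn p1 p2.
- rewrite -[X in _ --> X](subrr S0); apply: cvgB; first exact: cvg_cst.
  rewrite -[X in _ --> X]mul1r; apply: cvgM; first exact: cs_cvg0.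
  have := PX0 cr; rewrite /r /s b0 invr1 mulr1.
  by rewrite [series e 0%N]big_geq // subr0.
- rewrite -[X in _ --> X]subr0; apply: cvgB; first exact: cvg_cst.
  have H : forall u, 0 < u < 1 ->
      [/\ 0 <= cs u, 0 <= sn u ^+ 2 < 1 & cs u * PS (fun n => (b n)^-1) (sn u ^+ 2) <= 1].
    move=> u u01; rewrite ltW ?cs_gt0 // sqr_ge0 /=.
    have y1 : `|sn u ^+ 2| < 1 by apply: sn2_lt1; case/andP: u01 => /ltW -> ->.
    by split=> //; [rewrite -[_ ^+ 2]ger0_norm ?sqr_ge0|have := cs_PX_invb u01 => ->].
  exact: (lim1_weight invb01 s0 H cs_cvg1).
Qed.

(** The odd case after the shift n -> n + 1: b_n f'_n = b_(n+1) f_(n+1) gives Phi(f) = sin^2 t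
    Phi(f'), and b_n / (2n+1) = b_(n+1) / (2n+2) matches the summands. *)
Lemma primitive_even e f (S0 : R) : bnd (fun n => b n * f n) -> f 0%N = 0 ->
  (forall n, e n = b n ^+ 2 * f n / n.*2%:R) -> series e @ \oo --> S0 ->
  exists g : R -> R,
    [/\ forall u, 0 < u < 1 -> is_derive u (1 : R) g (tau u / sn u * Phi f u),
        g u @[u --> 0^'+] --> (0 : R) & g u @[u --> 1^'-] --> S0].
Proof.
move=> bf f0 ef eS.
pose f' n := b n.+1 * f n.+1 / b n.
have bb : (fun n => b n * f' n) = (fun n => b n * f n) \o S.
  by apply/funext => n; rewrite /f' /= mulrC divfK // b_neq0.
have bf' : bnd (fun n => b n * f' n).
  by rewrite bb; case: bf => M fM; exists M => n; exact: fM.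
have e0 : e 0%N = 0 by rewrite ef invr0 mulr0.
have [||g [gd g0 g1]] := @primitive_odd (e \o S) f' S0 bf'.
- move=> n; rewrite /= ef /f' bS_div.
  have bn := b_neq0 n.
  have p1 : n.*2.+1%:R != 0 :> R by rewrite pnatr_eq0.
  have p2 : n.+1.*2%:R != 0 :> R by rewrite pnatr_eq0.
  move: (n.*2.+1%:R : R) (n.+1.*2%:R : R) p1 p2 => p q p1 p2.
  by field; rewrite bn p1 p2.
- have -> : series (e \o S) = (fun n => series e n.+1).
    by apply/funext => n; rewrite /series /= big_nat_recl //= e0 add0r.
  by rewrite cvg_shiftS.
exists g; split=> // u u01; apply: (is_derive_eq (gd u u01)).
have y1 : `|sn u ^+ 2| < 1 by apply: sn2_lt1; case/andP: u01 => /ltW -> ->.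
have x0 : sn u != 0 by rewrite gt_eqF // sn_gt0 //; case/andP: u01.
by rewrite /Phi /PX (PSS (bnd_conv bf) y1) bb f0; field.
Qed.

End Boundary.

(* The entry (o, s) stands for the exponent s + 1, see std below. *)
Definition word := seq (bool * nat).

Definition weight (w : word) : nat := sumn [seq p.2.+1 | p <- w].

(* The factors by which a generating function may differ from a power series:
   1, tan t, csc t and csc t * sec t. *)
Variant kind := K1 | Ktan | Kcsc | Kcscsec.

(** A summation step leaves a trigonometric factor, tan t or csc t sec t. The next division by 2n
    removes it, and the next division by 2n+1 reduces it to csc t; after that it is stable. Hence
    only the leading entry matters. *)
Definition kind_of (w : word) : kind :=
  match w with
  | [::] => K1
  | (false, 0%N) :: _ => Ktan
  | (false, _) :: _ => K1
  | (true, 0%N) :: _ => Kcscsec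
  | (true, _) :: _ => Kcsc
  end.

Definition is_K1 k := if k is K1 then true else false.

(** The forms dt, cot t dt and csc t dt over the denominator 1 - u^4; for instance dt = 2 (1 - u^2)
    du / (1 - u^4). *)
Definition letter_tau := Letter 0 2 0 (-2) 0.
Definition letter_cot := Letter 1 0 (-2) 0 2.
Definition letter_csc := Letter 1 0 0 0 0.

(** The product of dt with the factor named by [k]. *)
Definition letter_of k := match k with
  | K1 => letter_tau
  | Ktan => Letter 0 0 4 0 0
  | Kcsc => letter_csc
  | Kcscsec => Letter 1 0 2 0 2
  end.

(* Letters whose Fourier coefficients on Z/4 are rational (false) or purely
   imaginary (true). *)
Definition parity_letter (p : bool) (l : letter) : Prop :=
  if p then [/\ l0 l = 0, l2 l = 0, l4 l = 0 & l3 l = - l1 l] else l1 l = l3 l.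

(** * Generating functions of the nested sums as iterated integrals *)

Section StdWords.
Variable R : realType.
Implicit Types (u : R) (w : word) (c : nat -> R).

Local Notation b := (bseq R).

Definition Ai (n : nat) : R := (n.*2%:R)^-1.
Definition Bi (n : nat) : R := (n.*2.+1%:R)^-1.
Definition delta0 (n : nat) : R := (n == 0%N)%:R.

Fixpoint std (w : word) (n : nat) : R :=
  match w with
  | [::] => delta0 n
  | (o, s) :: w' => if o then series (std w') n.+1 * Bi n ^+ s.+1
                    else series (std w') n * Ai n ^+ s.+1
  end.

Lemma Ai0 : Ai 0 = 0. Proof. exact: invr0. Qed.
Lemma Bi0 : Bi 0 = 1. Proof. exact: invr1. Qed.
Lemma Ai_ge0 n : 0 <= Ai n. Proof. by rewrite invr_ge0. Qed.
Lemma Bi_ge0 n : 0 <= Bi n. Proof. by rewrite invr_ge0. Qed.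
Lemma Ai_le1 n : Ai n <= 1.
Proof. by case: n => [|n]; [rewrite Ai0|rewrite invf_le1 ?ltr0n // ler1n]. Qed.
Lemma Bi_le1 n : Bi n <= 1.
Proof. by rewrite invf_le1 ?ltr0n // ler1n. Qed.

Lemma series0 c : series c 0 = 0. Proof. by rewrite /series /= big_geq. Qed.

(** Induction by [series_invb]: one factor 1/(2n) or 1/(2n+1) restores the majorant after summation,
    and further factors are at most 1. *)
Lemma std_bounds w n : 0 <= std w n <= (b n)^-1.
Proof.
have b0n m : 0 <= (b m)^-1 by rewrite invr_ge0 ltW ?b_gt0.
elim: w n => [|[q s] w IH] n /=.
  rewrite /delta0; case: n => [|n] /=; last by rewrite lexx b0n.
  by rewrite b0 invr1 ler01 lexx.
have ser_ge0 m : 0 <= series (std w) m.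
  by rewrite /series /= sumr_ge0 // => i _; case/andP: (IH i).
have ser_le m : series (std w) m <= series (fun m => (b m)^-1) m.
  by rewrite /series /=; apply: ler_sum => i _; case/andP: (IH i).
case: q.
  have B0 := Bi_ge0 n; have B1 := Bi_le1 n.
  rewrite mulr_ge0 ?exprn_ge0 //=.
  apply: (@le_trans _ _ (series (std w) n.+1 * Bi n)).
    by rewrite ler_wpM2l // exprS ler_piMr // exprn_ile1.
  apply: (@le_trans _ _ (series (fun m => (b m)^-1) n.+1 * Bi n)).
    by rewrite ler_wpM2r.
  rewrite series_invb /Bi mulrAC divff ?mul1r //; by rewrite pnatr_eq0.
case: n => [|n]; first by rewrite series0 mul0r lexx b0n.
have B0 := Ai_ge0 n.+1; have B1 := Ai_le1 n.+1.
rewrite mulr_ge0 ?exprn_ge0 //=.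
apply: (@le_trans _ _ (series (std w) n.+1 * Ai n.+1)).
  by rewrite ler_wpM2l // exprS ler_piMr // exprn_ile1.
apply: (@le_trans _ _ (series (fun m => (b m)^-1) n.+1 * Ai n.+1)).
  by rewrite ler_wpM2r.
rewrite series_invb /Ai bS_div.
have p1 : n.*2.+1%:R != 0 :> R by rewrite pnatr_eq0.
have p2 : n.+1.*2%:R != 0 :> R by rewrite pnatr_eq0.
rewrite le_eqVlt; apply/orP; left; apply/eqP.
move: (n.*2.+1%:R : R) (n.+1.*2%:R : R) p1 p2 => p q p1 p2.
by field; rewrite b_neq0 p1 p2.
Qed.

Lemma bnd_b_std w : bnd (fun n => b n * std w n).
Proof.
exists 1 => n; have /andP[h0 h1] := std_bounds w n.
rewrite ger0_norm ?mulr_ge0 ?(ltW (b_gt0 _ _)) //.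
by rewrite -(divff (b_neq0 R n)) ler_wpM2l // ltW // b_gt0.
Qed.

Lemma bnd_mul c (f : nat -> R) : bnd c -> (forall n, `|f n| <= 1) -> bnd (fun n => c n * f n).
Proof.
by move=> [M cM] f1; exists M => n; rewrite normrM (le_trans _ (cM n)) // ler_piMr.
Qed.

Definition kap k u : R := match k with
  | K1 => 1 | Ktan => sn u / cs u | Kcsc => (sn u)^-1 | Kcscsec => (sn u * cs u)^-1 end.

Lemma param_neq0 u : 0 < u < 1 ->
  [/\ u != 0, 1 + u ^+ 2 != 0, 1 - u ^+ 2 != 0 & 1 - u ^+ 4 != 0].
Proof.
move=> /andP[u0 u1].
have h k : (0 < k)%N -> 1 - u ^+ k != 0.
  by move=> k0; rewrite subr_eq0 eq_sym lt_eqF // expr_lt1 // ltW.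
by rewrite !h // !gt_eqF ?sqr1_gt0.
Qed.

Lemma letter_ofE k u : 0 < u < 1 -> tau u * kap k u = phi (letter_of k) u.
Proof.
move=> /param_neq0[n0 n1 n2 n3].
case: k; rewrite /phi /kap /tau /sn /cs /=; field; rewrite ?n0 ?n1 ?n2 ?n3 //.
Qed.

Lemma letter_cotE u : 0 < u < 1 -> tau u * (cs u / sn u) = phi letter_cot u.
Proof.
move=> /param_neq0[n0 n1 n2 n3].
by rewrite /phi /tau /sn /cs /=; field; rewrite ?n0 ?n1 ?n2 ?n3.
Qed.

(** The boolean counts modulo 2 the letters with imaginary Fourier coefficients, the number counts
    all letters. A pole at 0 is forbidden in the innermost letter; afterwards the series vanishes at
    0 and absorbs it. *)
Inductive lseq : bool -> nat -> (nat -> R) -> Prop :=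
| lseq0 : lseq false 0 delta0
| lseqS p q n a l : lseq p n a -> l0 l = 0 \/ n <> 0%N -> parity_letter q l ->
    lseq (p (+) q) n.+1 (letop l a).

Lemma bnd_lseq p n a : lseq p n a -> bnd a.
Proof.
elim=> [|p' q m a' l _ ba _ _]; last exact: bnd_letop.
by exists 1 => m; rewrite /delta0; case: (m == 0%N); rewrite ?normr0 ?normr1.
Qed.

Lemma lseq_at0 p n a : lseq p n a -> n <> 0%N -> a 0%N = 0.
Proof. by case=> // p' q m a' l _ _ _ _; rewrite /letop invr0 mulr0. Qed.

Lemma lseq_int p q n a l (g : R -> R) : lseq p n a -> l0 l = 0 \/ n <> 0%N ->
  parity_letter q l ->
  (forall u, 0 < u < 1 -> is_derive u (1 : R) g (phi l u * PS a u)) ->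
  g u @[u --> 0^'+] --> (0 : R) ->
  exists2 a', lseq (p (+) q) n.+1 a' & forall u, 0 < u < 1 -> g u = PS a' u.
Proof.
move=> la ln pl gd g0; exists (letop l a); first exact: lseqS.
apply: int_letter gd g0; first exact: bnd_lseq la.
by case: ln => [->|n0]; [rewrite mul0r|rewrite (lseq_at0 la n0) mulr0].
Qed.

Lemma std_even_at0 s w : std ((false, s) :: w) 0 = 0.
Proof. by rewrite /= series0 mul0r. Qed.

Lemma stdS o s w : std ((o, s.+1) :: w) =
  (fun n => std ((o, s) :: w) n * (if o then Bi n else Ai n)).
Proof. by apply/funext => n /=; case: o; rewrite exprSr mulrA. Qed.

Lemma der_Phi_even c c' u : bnd (fun n => b n * c' n) ->
  (forall n, c' n = series c n * Ai n) -> 0 < u < 1 ->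
  is_derive u (1 : R) (fun u => cs u / sn u * Phi c' u) (tau u * Phi c u).
Proof.
move=> bc cE u01; apply: der_cot_PX => //; first exact: bnd_conv.
  by rewrite cE series0 mul0r mulr0.
move=> n; rewrite !cE seriesSr /Ai bS_div.
have p1 : n.*2.+1%:R != 0 :> R by rewrite pnatr_eq0.
have p2 : n.+1.*2%:R != 0 :> R by rewrite pnatr_eq0.
(* The factor 2n cancels at n = 0 too, because the partial sum is empty there. *)
have H : n.*2%:R * (b n * (series c n / n.*2%:R)) = b n * series c n.
  case: n {p1 p2} => [|n]; first by rewrite series0 !(mul0r, mulr0).
  have p3 : n.+1.*2%:R != 0 :> R by rewrite pnatr_eq0.
  by move: (n.+1.*2%:R : R) p3 => p p3; field.
rewrite H.
move: (n.*2.+1%:R : R) (n.+1.*2%:R : R) p1 p2 => p q p1 p2.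
by field; rewrite p1 p2.
Qed.

(** The series starts at x^2, so the simple pole of cot t still leaves a factor sin t. *)
Lemma cot_Phi_cvg0 c' : bnd (fun n => b n * c' n) -> c' 0%N = 0 ->
  cs u / sn u * Phi c' u @[u --> 0^'+] --> (0 : R).
Proof.
move=> bc c0.
have cc := conv_tail (bnd_conv bc).
have H : cs u * sn u * PX ((fun n => b n * c' n) \o S) u @[u --> 0^'+] --> (0 : R).
  rewrite -[X in _ --> X](mul0r (((fun n => b n * c' n) \o S) 0%N)); apply: cvgM; last exact: PX0.
  rewrite -[X in _ --> X](mulr0 (1 : R)); apply: cvgM; [exact: cs_cvg0|exact: sn_cvg0].
apply: cvg_trans H; apply: near_eq_cvg; near=> u.
have u0 : 0 < u by near: u; apply: nbhs_right_gt.
have u1 : u < 1 by near: u; apply: nbhs_right_lt.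
have y1 : `|sn u ^+ 2| < 1 by apply: sn2_lt1; rewrite ltW.
have x0 : sn u != 0 by rewrite gt_eqF // sn_gt0.
by rewrite /Phi /PX (PSS (bnd_conv bc) y1) c0; field.
Unshelve. all: by end_near. Qed.

Lemma Phi_cvg0 c : bnd (fun n => b n * c n) -> Phi c u @[u --> 0^'+] --> c 0%N.
Proof. by move=> bc; have := PX0 (bnd_conv bc); rewrite b0 mul1r. Qed.

Lemma der_Phi_A c c' u : bnd (fun n => b n * c' n) -> c 0%N = 0 ->
  (forall n, c' n = c n * Ai n) -> 0 < u < 1 ->
  is_derive u (1 : R) (Phi c') (cs u / sn u * tau u * Phi c u).
Proof.
move=> bc c0 cE u01; apply: (is_derive_eq (der_PX (bnd_conv bc) u01)).
congr (_ * PS _ _); apply/funext => n; rewrite /twice_mul cE /Ai.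
case: n => [|n]; first by rewrite c0 mul0r !mulr0.
have p3 : n.+1.*2%:R != 0 :> R by rewrite pnatr_eq0.
by move: (n.+1.*2%:R : R) p3 => p p3; field.
Qed.

Lemma der_Phi_odd c c' u : bnd (fun n => b n * c n) -> bnd (fun n => b n * c' n) ->
  (forall n, c' n = series c n.+1 * Bi n) -> 0 < u < 1 ->
  is_derive u (1 : R) (fun u => sn u * cs u * Phi c' u) (tau u * Phi c u).
Proof.
move=> bc bc' cE u01; apply: der_sncs_PX => //; try exact: bnd_conv.
  by rewrite cE seriesSr series0 add0r Bi0 mulr1.
move=> n; rewrite !cE (seriesSr c n.+1) /Bi bS_div.
have p1 : n.*2.+1%:R != 0 :> R by rewrite pnatr_eq0.
have p2 : n.+1.*2.+1%:R != 0 :> R by rewrite pnatr_eq0.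
move: (n.*2.+1%:R : R) (n.+1.*2.+1%:R : R) (n.+1.*2%:R : R) p1 p2 => p q r p1 p2.
by field; rewrite p1 p2.
Qed.

Lemma der_Phi_B c c' u : bnd (fun n => b n * c' n) ->
  (forall n, c' n = c n * Bi n) -> 0 < u < 1 ->
  is_derive u (1 : R) (fun u => sn u * Phi c' u) (cs u * tau u * Phi c u).
Proof.
move=> bc cE u01; apply: der_sn_PX => //; first exact: bnd_conv.
move=> n; rewrite cE /Bi.
have p1 : n.*2.+1%:R != 0 :> R by rewrite pnatr_eq0.
by move: (n.*2.+1%:R : R) p1 => p p1; field.
Qed.

Lemma sn_Phi_cvg0 c : bnd (fun n => b n * c n) -> sn u * Phi c u @[u --> 0^'+] --> (0 : R).
Proof.
move=> bc; rewrite -[X in _ --> X](mul0r (c 0%N)); apply: cvgM; first exact: sn_cvg0.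
exact: Phi_cvg0.
Qed.

Lemma PS_delta0 u : PS delta0 u = 1.
Proof.
rewrite /PS (_ : pseries delta0 u = (fun n => if n is 0%N then 0 else 1)); last first.
  apply/funext => -[|n]; first by rewrite /pseries series0.
  rewrite /pseries /series /= big_nat_recl //= big1 ?addr0 ?mulr1 //.
  by move=> i _; rewrite mul0r.
by apply/cvg_lim => //; rewrite -cvg_shiftS; exact: cvg_cst.
Qed.

Lemma Phi_nil u : Phi (std [::]) u = 1.
Proof.
rewrite -(PS_delta0 (sn u ^+ 2)) /Phi /PX; congr (PS _ _); apply/funext => k.
by rewrite /= /delta0; case: k => [|k]; rewrite ?b0 ?mulr0 ?mulr1.
Qed.

(** The parity is tied to the factor: whenever dt is integrated, the factor passes between 1 and one
    of the other three, and no other letter changes the parity. *)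
Lemma std_repr w : exists2 a, lseq (~~ is_K1 (kind_of w)) (weight w) a &
  forall u, 0 < u < 1 -> Phi (std w) u = kap (kind_of w) u * PS a u.
Proof.
elim: w => [|x w [a la aE]]; last (case: x => o s).
  exists delta0; first exact: lseq0.
  by move=> u _; rewrite mul1r PS_delta0; exact: Phi_nil.
have nz u : 0 < u < 1 -> sn u != 0 /\ cs u != 0.
  by move=> u01; rewrite !gt_eqF ?cs_gt0 ?sn_gt0 //; case/andP: u01.
have pk k : parity_letter (is_K1 k) (letter_of k) by case: k.
have ok : l0 (letter_of (kind_of w)) = 0 \/ weight w <> 0%N.
  by case: (w) => [|x w'] /=; [left|right].
elim: s => [|s IHs].
  (* An exponent 1 is a summation, integrated against dt times the factor of [w]. This form is dt
     itself exactly when the factor is 1, so the new parity is imaginary in every case. *)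
  have [a' la' a'E] : exists2 a', lseq (~~ is_K1 (kind_of w) (+) is_K1 (kind_of w)) (weight w).+1 a' &
     forall u, 0 < u < 1 -> (if o then sn u * cs u else cs u / sn u) * Phi (std ((o, 0%N) :: w)) u = PS a' u.
    apply: (lseq_int la ok (pk _)).
      move=> u u01; rewrite -letter_ofE // -mulrA -aE //.
      case: o; [apply: der_Phi_odd|apply: der_Phi_even] => //; try exact: bnd_b_std.
    case: o; last by apply: cot_Phi_cvg0; [exact: bnd_b_std|exact: std_even_at0].
    have H : sn u * Phi (std ((true, 0%N) :: w)) u * cs u @[u --> 0^'+] --> (0 : R).
      rewrite -[X in _ --> X](mul0r (1 : R)); apply: cvgM; last exact: cs_cvg0.
      by apply: sn_Phi_cvg0; exact: bnd_b_std.
    apply: cvg_trans H; apply: near_eq_cvg; near=> u.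
    by rewrite mulrAC.
  exists a'.
    by move: la'; case: (kind_of w); case: (o); rewrite /weight /= add1n.
  move=> u u01; have [x0 y0] := nz u u01; rewrite -a'E //.
  by case: (o); rewrite /=; field; rewrite x0 y0.
have wS : weight ((o, s.+1) :: w) = (weight ((o, s) :: w)).+1 by [].
have okS l : l0 l = 0 \/ weight ((o, s) :: w) <> 0%N by right.
case: IHs => b' lb bE.
have bw := bnd_b_std ((o, s.+1) :: w).
case: o wS okS bw lb bE => wS okS bw lb bE.
  have lb' : lseq true (weight ((true, s) :: w)) b' by move: lb; case: (s).
  have [a' la' a'E] : exists2 a', lseq (true (+) false) (weight ((true, s.+1) :: w)) a' &
     forall u, 0 < u < 1 -> sn u * Phi (std ((true, s.+1) :: w)) u = PS a' u.
    (* Each further 1/(2n+1) integrates against cos t dt: times csc t sec t this is csc t dt, times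
       csc t it is cot t dt, both of rational parity. *)
    rewrite wS; apply: (lseq_int (l := if s is 0%N then letter_csc else letter_cot) lb').
    - exact: okS.
    - by case: (s).
    - move=> u u01; have [x0 y0] := nz u u01.
      have -> : phi (if s is 0%N then letter_csc else letter_cot) u =
         cs u * tau u * kap (kind_of ((true, s) :: w)) u.
        case: (s) => [|s']; last by rewrite -letter_cotE //= mulrCA mulrA.
        by rewrite -(letter_ofE Kcsc) //=; field; rewrite x0 y0.
      by rewrite -mulrA -bE //; apply: der_Phi_B => //; move=> n; rewrite stdS.
    - exact: sn_Phi_cvg0.
  exists a'; first exact: la'.
  by move=> u u01; have [x0 y0] := nz u u01; rewrite -a'E //=; field.
have [a' la' a'E] : exists2 a', lseq (~~ is_K1 (kind_of ((false, s) :: w)) (+) (s == 0%N)) (weight ((false, s.+1) :: w)) a' &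
     forall u, 0 < u < 1 -> Phi (std ((false, s.+1) :: w)) u = PS a' u.
  (* The first further 1/(2n) meets cot t tan t = 1, hence dt, which makes the parity rational
     again; later ones use cot t dt. *)
  rewrite wS; apply: (lseq_int (l := if s is 0%N then letter_tau else letter_cot) lb).
  - exact: okS.
  - by case: (s).
  - move=> u u01; have [x0 y0] := nz u u01.
    have -> : phi (if s is 0%N then letter_tau else letter_cot) u =
         cs u / sn u * tau u * kap (kind_of ((false, s) :: w)) u.
      case: (s) => [|s']; last by rewrite -letter_cotE //= mulr1 mulrC.
      by rewrite -(letter_ofE K1) //=; field; rewrite x0 y0.
    rewrite -mulrA -bE //; apply: der_Phi_A => //; first exact: std_even_at0.
    by move=> n; rewrite stdS.
  - rewrite -[X in _ --> X](std_even_at0 s.+1 w); exact: Phi_cvg0.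
exists a'; first by move: la'; case: (s).
by move=> u u01; rewrite -a'E // mul1r.
Unshelve. all: by end_near. Qed.

End StdWords.

(** * Taylor coefficients as summands of colored values, and their convergence *)

Section Colored.
Variable R : realType.
Local Notation C := R[i].
Local Notation b := (bseq R).
Implicit Types (z x : C) (F G : nat -> C).

Definition lword := seq (nat * C).

Fixpoint liw (w : lword) (m : nat) : C :=
  match w with
  | [::] => (m == 0%N)%:R
  | (k, z) :: w' => z ^+ m / m%:R ^+ k * series (liw w') m
  end.

Definition good n (w : lword) : Prop :=
  [/\ all (fun p => (0 < p.1)%N) w, all (fun p => p.2 ^+ 4 == 1) w
    & sumn [seq p.1 | p <- w] = n].

Definition adm n (w : lword) : Prop :=
  good n w /\ exists k z w', w = (k, z) :: w' /\ (k, z) <> (1%N, 1).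

(* K-linear combinations of the summands of the Li attached to words in P. *)
Inductive LS (K : C -> Prop) (P : lword -> Prop) : (nat -> C) -> Prop :=
| LS0 : LS K P (fun=> 0)
| LSadd x w F : K x -> P w -> LS K P F -> LS K P (fun m => x * liw w m + F m).

Lemma LS_ext K P F G : (forall m, F m = G m) -> LS K P F -> LS K P G.
Proof. by move=> /funext ->. Qed.

Lemma LS_D K P F G : LS K P F -> LS K P G -> LS K P (fun m => F m + G m).
Proof.
move=> hF hG; elim: hF => [|x w F' Kx Pw _ IH].
  by apply: LS_ext hG => m; rewrite add0r.
by apply: LS_ext (LSadd Kx Pw IH) => m; rewrite addrA.
Qed.

Lemma LS_one (K : C -> Prop) P x w : K x -> P w -> LS K P (fun m => x * liw w m).
Proof.
by move=> Kx Pw; apply: LS_ext (LSadd Kx Pw (LS0 K P)) => m; rewrite addr0.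
Qed.

Lemma LS_Z (K1 K2 K3 : C -> Prop) P x F :
  (forall x y, K1 x -> K2 y -> K3 (x * y)) -> K1 x -> LS K2 P F ->
  LS K3 P (fun m => x * F m).
Proof.
move=> KK Kx; elim=> [|y w F' Ky Pw _ IH].
  by apply: LS_ext (LS0 _ _) => m; rewrite mulr0.
by apply: LS_ext (LSadd (KK _ _ Kx Ky) Pw IH) => m; rewrite mulrDr mulrA.
Qed.

Lemma LS_bind (K1 K2 K3 : C -> Prop) P Q (op : (nat -> C) -> nat -> C) F :
  (forall x y, K1 x -> K2 y -> K3 (x * y)) ->
  (forall x F G m, op (fun m => x * F m + G m) m = x * op F m + op G m) ->
  (forall m, op (fun=> 0) m = 0) ->
  (forall w, P w -> LS K2 Q (op (liw w))) ->
  LS K1 P F -> LS K3 Q (op F).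
Proof.
move=> KK opL op0 opw; elim=> [|x w F' Kx Pw _ IH].
  by apply: LS_ext (LS0 _ _) => m; rewrite op0.
apply: (@LS_ext _ _ (fun m => x * op (liw w) m + op F' m)) => [m|]; first by rewrite opL.
exact: (LS_D (LS_Z KK Kx (opw w Pw)) IH).
Qed.

Definition Kp (p : bool) x : Prop := exists q : rat, x = ratr q * 'i%C ^+ p.

Lemma Kp_mul p q x y : Kp p x -> Kp q y -> Kp (p (+) q) (x * y).
Proof.
move=> [r ->] [s ->]; have ii : ('i%C : C) * 'i%C = -1 by rewrite -expr2 sqr_i.
case: p; case: q => /=; rewrite ?expr0 ?expr1 ?mulr1.
- by exists (- (r * s)); rewrite mulr1 mulrACA ii rmorphN rmorphM /= mulrN1.
- by exists (r * s); rewrite rmorphM /= mulrAC.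
- by exists (r * s); rewrite rmorphM /= mulrA.
- by exists (r * s); rewrite rmorphM /= mulr1.
Qed.

Lemma Kp_Qi p x : Kp p x -> Qiset x.
Proof.
case: p => -[q ->]; first by exists 0, q; rewrite rmorph0 add0r.
by exists q, 0; rewrite rmorph0 mul0r addr0 mulr1.
Qed.

Definition letopC l F (m : nat) : C :=
  ((l0 l)%:~R * F m + \sum_(k < m) (eps l (m - k)%N)%:~R * F k) / m%:R.

Lemma letop_letopC l (a : nat -> R) m :
  (letop l a m)%:C%C = letopC l (fun m => (a m)%:C%C) m.
Proof.
rewrite /letop /letopC /letconv !rmorphM !rmorphD rmorphM rmorph_sum /=.
rewrite fmorphV rmorph_nat rmorph_int; congr ((_ + _) / _).
by apply: eq_bigr => k _; rewrite rmorphM rmorph_int.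
Qed.

(** Dividing the leading root by z absorbs a factor z^(-k). This is what turns the convolution with
    z^(m-k) into z^m times a partial sum, as in [sum_twist]. *)
Definition twist z (w : lword) : lword :=
  if w is (k, z') :: w' then (k, z' / z) :: w' else [::].

Lemma liw_twist z w k : z != 0 -> liw (twist z w) k = z ^- k * liw w k.
Proof.
move=> z0; case: w => [|y w] /=; last first.
  by case: y => k' z' /=; rewrite exprMn exprVn -!mulrA mulrCA.
by case: k => [|k]; rewrite ?expr0 ?invr1 ?mul1r ?mulr0.
Qed.

Definition e1 l : C := (l1 l)%:~R.
Definition e2 l : C := (l2 l)%:~R.
Definition e3 l : C := (l3 l)%:~R.
Definition e4 l : C := (l4 l)%:~R.

(** The [hat] constants are the Fourier coefficients of the 4-periodic part of [eps]; [hat1] is up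
    to sign the residue of the form at u = 1. *)
Definition hat1 l : C := (e1 l + e2 l + e3 l + e4 l) / 4.
Definition hatm l : C := (- e1 l + e2 l - e3 l + e4 l) / 4.
Definition hati l : C := (- 'i%C * e1 l - e2 l + 'i%C * e3 l + e4 l) / 4.
Definition hatmi l : C := ('i%C * e1 l - e2 l - 'i%C * e3 l + e4 l) / 4.

Lemma eps_fourier l m : (0 < m)%N -> (eps l m)%:~R =
  hat1 l * 1 ^+ m + hatm l * (-1) ^+ m + hati l * 'i%C ^+ m + hatmi l * (- 'i%C) ^+ m.
Proof.
case: m => // m _; rewrite /eps.
have ii : ('i%C : C) ^+ 2 = -1 by rewrite sqr_i.
have i4 : ('i%C : C) ^+ 4 = 1 by rewrite (exprM _ 2 2) ii sqrrN expr1n.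
have mi4 : (- 'i%C : C) ^+ 4 = 1 by rewrite (exprM _ 2 2) sqrrN ii sqrrN expr1n.
have m4 : (-1 : C) ^+ 4 = 1 by rewrite (exprM _ 2 2) sqrrN !expr1n.
have red (y : C) : y ^+ 4 = 1 -> y ^+ m.+1 = y * y ^+ (m %% 4).
  by move=> y4; rewrite exprS {1}(divn_eq m 4) exprD mulnC exprM y4 expr1n mul1r.
rewrite !red ?expr1n //.
have : (m %% 4 < 4)%N by rewrite ltn_mod.
rewrite /hat1 /hatm /hati /hatmi.
have -> : (match (m %% 4)%N with 0%N => l1 l | 1%N => l2 l | 2%N => l3 l | _ => l4 l end)%:~R =
  match (m %% 4)%N with 0%N => e1 l | 1%N => e2 l | 2%N => e3 l | _ => e4 l end.
  by case: (m %% 4)%N => [|[|[|k]]].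
move: ('i%C : C) ii => j jj.
by case: (m %% 4)%N => [|[|[|[|//]]]] _; field: jj.
Qed.

Lemma letopC_linear l x F G m :
  letopC l (fun m => x * F m + G m) m = x * letopC l F m + letopC l G m.
Proof.
rewrite /letopC; under eq_bigr do rewrite mulrDr mulrCA.
by rewrite big_split /= -mulr_sumr; ring.
Qed.

Lemma letopC0 l m : letopC l (fun=> 0) m = 0.
Proof. by rewrite /letopC big1 ?mulr0 ?addr0 ?mul0r // => i _; rewrite mulr0. Qed.

Lemma sum_twist z w m : z != 0 ->
  \sum_(k < m) z ^+ (m - k) * liw w k = z ^+ m * series (liw (twist z w)) m.
Proof.
move=> z0; rewrite /series /= big_mkord mulr_sumr; apply: eq_bigr => k _.
rewrite liw_twist // mulrA; congr (_ * _).
have h : z ^+ (m - k) * z ^+ k = z ^+ m by rewrite -exprD subnK // ltnW.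
by rewrite -h mulfK // expf_neq0.
Qed.

Lemma sum_lin4 m (x1 x2 x3 x4 : C) (f1 f2 f3 f4 : 'I_m -> C) :
  \sum_k (x1 * f1 k + (x2 * f2 k + (x3 * f3 k + x4 * f4 k))) =
  x1 * \sum_k f1 k + (x2 * \sum_k f2 k + (x3 * \sum_k f3 k + x4 * \sum_k f4 k)).
Proof. by rewrite !big_split /= -!mulr_sumr. Qed.

Definition bump_head (w : lword) : lword :=
  if w is (k, z) :: w' then (k.+1, z) :: w' else [::].

(** The pole at 0 raises the leading exponent, and the pole belonging to each root of unity z
    prefixes an entry (1, z). The word is twisted because the roots of Li belong to single indices,
    those of a convolution to differences of indices. *)
Lemma letopC_liw l w m : l0 l = 0 \/ w <> [::] -> letopC l (liw w) m =
  (l0 l)%:~R * liw (bump_head w) m + (hat1 l * liw ((1%N, 1) :: twist 1 w) m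
  + (hatm l * liw ((1%N, -1) :: twist (-1) w) m
  + (hati l * liw ((1%N, 'i%C) :: twist 'i%C w) m
  + hatmi l * liw ((1%N, - 'i%C) :: twist (- 'i%C) w) m))).
Proof.
move=> lw.
have i0 : ('i%C : C) != 0 by rewrite -sqrf_eq0 sqr_i oppr_eq0 oner_neq0.
have h0 : (l0 l)%:~R * liw w m / m%:R = (l0 l)%:~R * liw (bump_head w) m.
  case: lw => [->|]; first by rewrite !mul0r.
  case: w => // -[k z] w _ /=.
  by rewrite exprS invfM; ring.
rewrite /letopC mulrDl h0; congr (_ + _).
have -> : \sum_(k < m) (eps l (m - k)%N)%:~R * liw w k =
  hat1 l * (1 ^+ m * series (liw (twist 1 w)) m) + (hatm l * ((-1) ^+ m * series (liw (twist (-1) w)) m)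
  + (hati l * ('i%C ^+ m * series (liw (twist 'i%C w)) m)
  + hatmi l * ((- 'i%C) ^+ m * series (liw (twist (- 'i%C) w)) m))).
  pose t z (k : nat) := z ^+ (m - k) * liw w k.
  transitivity (\sum_(k < m) (hat1 l * t 1 k + (hatm l * t (-1) k + (hati l * t 'i%C k
      + hatmi l * t (- 'i%C) k)))).
    apply: eq_bigr => k _; rewrite /t eps_fourier ?subn_gt0 //.
    by move: (liw w k) (1 ^+ _) ((-1) ^+ _) ('i%C ^+ _) ((- 'i%C) ^+ _) => *; ring.
  rewrite sum_lin4; congr (_ * _ + (_ * _ + (_ * _ + _ * _))); apply: sum_twist;
    by rewrite ?oppr_eq0 ?oner_neq0.
by rewrite /= expr1; ring.
Qed.

Definition root4 z := z ^+ 4 = 1.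

Lemma good_cons k z n w : (0 < k)%N -> root4 z -> good n w -> good (k + n) ((k, z) :: w).
Proof. by move=> k0 /eqP z4 [w1 w2 w3]; split=> /=; rewrite ?k0 ?z4 //= w3. Qed.

Lemma good_twist n z w : root4 z -> good n w -> good n (twist z w).
Proof.
move=> z4; case: w => [|[k z'] w] // [/= w1 /andP[/eqP w2 w2'] w3]; split=> //=.
by rewrite expr_div_n z4 w2 divr1 eqxx.
Qed.

Lemma good_bump n w : w <> [::] -> good n w -> good n.+1 (bump_head w).
Proof.
by case: w => [|[k z] w] // _ [/= /andP[w1 w1'] w2 w3]; split=> //=; rewrite -w3.
Qed.

Lemma good_gt0 n w : good n w -> n <> 0%N -> w <> [::].
Proof. by case: w => // -[_ _ <-]. Qed.

Lemma hat_parity p l : parity_letter p l ->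
  [/\ Kp p (l0 l)%:~R, Kp p (hat1 l), Kp p (hatm l), Kp p (hati l) & Kp p (hatmi l)].
Proof.
have ri (k : int) : (k%:~R : C) = ratr k%:~R by rewrite ratr_int.
rewrite /Kp /hat1 /hatm /hati /hatmi /e1 /e2 /e3 /e4; case: p => [[-> -> -> ->]|/= ->].
  split; [exists 0|exists 0|exists 0|exists (- (l1 l)%:~R / 2)|exists ((l1 l)%:~R / 2)];
   rewrite ?rmorphM ?rmorphN ?fmorphV ?ratr_int ?rmorph0 /= ?mulrNz; by field.
split; [exists (l0 l)%:~R|exists ((2 * l3 l + l2 l + l4 l)%:~R / 4)|exists ((- 2 * l3 l + l2 l + l4 l)%:~R / 4)
  |exists ((l4 l - l2 l)%:~R / 4)|exists ((l4 l - l2 l)%:~R / 4)];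
   rewrite ?rmorphM ?fmorphV ?ratr_int ?rmorphD ?rmorphN ?rmorphM /= ?mulr1; by field.
Qed.

Lemma root4_units : [/\ root4 1, root4 (-1), root4 'i%C & root4 (- 'i%C)].
Proof.
have ii : ('i%C : C) ^+ 2 = -1 by rewrite sqr_i.
by rewrite /root4; split; rewrite ?expr1n // (exprM _ 2 2) ?sqrrN ?ii ?sqrrN ?expr1n ?sqrrN ?expr1n.
Qed.

Lemma LS_letopC p n l w : parity_letter p l -> good n w -> l0 l = 0 \/ n <> 0%N ->
  LS (Kp p) (good n.+1) (letopC l (liw w)).
Proof.
move=> pl gw ln; have [k0 k1 k2 k3 k4] := hat_parity pl; have [r1 r2 r3 r4] := root4_units.
have lw : l0 l = 0 \/ w <> [::] by case: ln; [left|right; exact: good_gt0 gw _].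
apply: LS_ext; first by move=> m; rewrite letopC_liw.
apply: LS_D; last first.
  by apply: (LS_D (LS_one k1 _) (LS_D (LS_one k2 _) (LS_D (LS_one k3 _) (LS_one k4 _))));
   rewrite -add1n; apply: good_cons => //; exact: good_twist.
case: lw => [->|w0]; last by apply: LS_one => //; exact: good_bump.
by apply: LS_ext (LS0 _ _) => m; rewrite mul0r.
Qed.

(** A vanishing residue at u = 1 suppresses the only words that begin with (1, 1); a raised leading
    exponent is at least 2. *)
Lemma LS_letopC_adm p n l w : parity_letter p l -> good n w -> l0 l = 0 \/ n <> 0%N ->
  l1 l + l2 l + l3 l + l4 l = 0 -> LS (Kp p) (adm n.+1) (letopC l (liw w)).
Proof.
move=> pl gw ln l10; have [k0 k1 k2 k3 k4] := hat_parity pl; have [r1 r2 r3 r4] := root4_units.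
have lw : l0 l = 0 \/ w <> [::] by case: ln; [left|right; exact: good_gt0 gw _].
have h10 : hat1 l = 0 by rewrite /hat1 /e1 /e2 /e3 /e4 -!rmorphD l10 rmorph0 mul0r.
apply: (@LS_ext _ _ (fun m => (l0 l)%:~R * liw (bump_head w) m
  + (hatm l * liw ((1%N, -1) :: twist (-1) w) m
  + (hati l * liw ((1%N, 'i%C) :: twist 'i%C w) m
  + hatmi l * liw ((1%N, - 'i%C) :: twist (- 'i%C) w) m)))).
  by move=> m; rewrite letopC_liw // h10 mul0r add0r.
have neq (z : C) : root4 z -> z <> 1 -> adm n.+1 ((1%N, z) :: twist z w).
  move=> z4 z1; split; first by rewrite -add1n; apply: good_cons => //; exact: good_twist.
  by exists 1%N, z, (twist z w); split=> // -[].
have m1 : (-1 : C) <> 1.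
  by move=> /eqP; rewrite eqNr oner_eq0.
have i1 : ('i%C : C) <> 1 by case=> /eqP; rewrite eq_sym oner_eq0.
have i2 : (- 'i%C : C) <> 1 by case=> /eqP; rewrite oppr0 eq_sym oner_eq0.
apply: LS_D; last first.
  by apply: (LS_D (LS_one k2 _) (LS_D (LS_one k3 _) (LS_one k4 _))); apply: neq.
case: lw => [->|w0]; first by apply: LS_ext (LS0 _ _) => m; rewrite mul0r.
apply: LS_one => //; split; first exact: good_bump.
case: w w0 gw {neq} => [|[k z] w] // _ [/= /andP[k0' _] _ _].
by exists k.+1, z, w; split=> // -[kk _]; move: k0'; rewrite kk.
Qed.

Lemma LS_lseq p n (a : nat -> R) : lseq p n a -> LS (Kp p) (good n) (fun m => (a m)%:C%C).
Proof.
elim=> [|p' q n' a' l _ IH ln pl].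
  apply: (@LS_ext _ _ (fun m => 1 * liw [::] m)).
    by move=> m; rewrite mul1r /delta0 /= rmorph_nat.
  by apply: LS_one => //; exists 1; rewrite rmorph1 mul1r.
apply: (@LS_ext _ _ (letopC l (fun m => (a' m)%:C%C))).
  by move=> m; rewrite letop_letopC.
apply: (LS_bind (op := letopC l) (@Kp_mul p' q) (letopC_linear l) (letopC0 l) _ IH).
by move=> w gw; exact: LS_letopC.
Qed.

Lemma LS_letop_adm p q n (a : nat -> R) l : lseq p n a -> l0 l = 0 \/ n <> 0%N ->
  parity_letter q l -> l1 l + l2 l + l3 l + l4 l = 0 ->
  LS (Kp (p (+) q)) (adm n.+1) (fun m => (letop l a m)%:C%C).
Proof.
move=> la ln pl l10; apply: (@LS_ext _ _ (letopC l (fun m => (a m)%:C%C))).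
  by move=> m; rewrite letop_letopC.
apply: (LS_bind (op := letopC l) (@Kp_mul p q) (letopC_linear l) (letopC0 l) _ (LS_lseq la)).
by move=> w gw; exact: LS_letopC_adm.
Qed.

Lemma normc_ge_Im (x : C) : `|complex.Im x|%:C%C <= `|x|.
Proof.
have := normc_ge_Re ('i%C * x); rewrite normrM.
have -> : `|'i%C : C| = 1 by rewrite normc_def /= expr0n expr1n /= add0r sqrtr1.
by rewrite mul1r mulrC ReiNIm normrN.
Qed.

Lemma rc_cvg (f : nat -> R) (l : R) : f @ \oo --> l ->
  (fun n => (f n)%:C%C : C^o) @ \oo --> (l%:C%C : C^o).
Proof.
move=> fl; apply/cvgrPdist_le => e e0.
have eE : e = (complex.Re e)%:C%C by rewrite RRe_real // gtr0_real.
have re0 : 0 < complex.Re e by move: e0; rewrite eE ltcR.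
move/cvgrPdist_le: fl => /(_ _ re0); apply: filterS => n h.
rewrite eE -rmorphB normc_def /= expr0n /= addr0 sqrtr_sqr lecR //.
Qed.

(** Convergence by real and imaginary parts lets the real comparison and squeeze theorems apply;
    [ccvg_cvg] returns to the topology of the modulus. *)
Definition ccvg (F : nat -> C) (L : C) : Prop :=
  ((fun n => complex.Re (F n)) @ \oo --> complex.Re L) /\
  ((fun n => complex.Im (F n)) @ \oo --> complex.Im L).

Lemma ccvg_cvg F L : ccvg F L -> (F : nat -> C^o) @ \oo --> (L : C^o).
Proof.
case=> hx hy; rewrite [X in _ --> X]complexE.
have -> : (F : nat -> C^o) = (fun n => (complex.Re (F n))%:C%C : C^o)
   + (fun n => ('i%C : C^o) * ((complex.Im (F n))%:C%C : C^o)).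
  by apply/funext => n; rewrite !fctE -complexE.
by apply: cvgD; [exact: rc_cvg|apply: cvgMr; exact: rc_cvg].
Qed.

Lemma ccvg_lim F L : ccvg F L -> limn (F : nat -> C^o) = L.
Proof. by move=> /ccvg_cvg h; apply/cvg_lim => //; exact: norm_hausdorff. Qed.

Lemma ccvgD F G L M : ccvg F L -> ccvg G M -> ccvg (fun n => F n + G n) (L + M).
Proof.
have rD (x y : C) : complex.Re (x + y) = complex.Re x + complex.Re y by case: x y => ? ? [? ?].
have iD (x y : C) : complex.Im (x + y) = complex.Im x + complex.Im y by case: x y => ? ? [? ?].
move=> [h1 h2] [h3 h4]; split; rewrite ?rD ?iD.
  by under eq_fun do rewrite rD; exact: cvgD.
by under eq_fun do rewrite iD; exact: cvgD.
Qed.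

Lemma ccvgZ x F L : ccvg F L -> ccvg (fun n => x * F n) (x * L).
Proof.
have rM (p q : C) : complex.Re (p * q) =
  complex.Re p * complex.Re q - complex.Im p * complex.Im q by case: p q => ? ? [? ?].
have iM (p q : C) : complex.Im (p * q) =
  complex.Re p * complex.Im q + complex.Im p * complex.Re q by case: p q => ? ? [? ?].
move=> [h1 h2]; split; rewrite ?rM ?iM.
  by under eq_fun do rewrite rM; apply: cvgB; apply: cvgMr.
by under eq_fun do rewrite iM; apply: cvgD; apply: cvgMr.
Qed.

Lemma ccvgS F L : ccvg F L -> ccvg (fun n => F n.+1) L.
Proof. by move=> [h1 h2]; split; rewrite (cvg_shiftS (fun n => _ (F n))). Qed.

Lemma ccvgSV F L : ccvg (fun n => F n.+1) L -> ccvg F L.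
Proof. by move=> [h1 h2]; split; rewrite -cvg_shiftS. Qed.

Lemma ccvg0 (f : nat -> C) (g : nat -> R) : (forall n, `|f n| <= (g n)%:C%C) ->
  g @ \oo --> (0 : R) -> ccvg f 0.
Proof.
move=> fg g0; have g0' : (- g n) @[n --> \oo] --> (0 : R) by rewrite -oppr0; exact: cvgN.
split.
  apply: (squeeze_cvgr _ g0' g0); apply: nearW => n; rewrite -ler_norml -lecR.
  exact: le_trans (normc_ge_Re _) (fg n).
apply: (squeeze_cvgr _ g0' g0); apply: nearW => n; rewrite -ler_norml -lecR.
exact: le_trans (normc_ge_Im _) (fg n).
Qed.

Lemma Re_series F n : complex.Re (series F n) = series (fun m => complex.Re (F m)) n.
Proof.
elim: n => [|n IH]; first by rewrite /series /= !big_geq.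
by rewrite !seriesSr -IH; case: (series F n) (F n) => [x1 y1] [x2 y2].
Qed.

Lemma Im_series F n : complex.Im (series F n) = series (fun m => complex.Im (F m)) n.
Proof.
elim: n => [|n IH]; first by rewrite /series /= !big_geq.
by rewrite !seriesSr -IH; case: (series F n) (F n) => [x1 y1] [x2 y2].
Qed.

Lemma abs_cvg F (v : nat -> R) : (forall m, `|F m| <= (v m)%:C%C) ->
  cvgn (series v) -> exists L, ccvg (series F) L.
Proof.
move=> Fv cv.
have v0 m : 0 <= v m by rewrite -ler0c (le_trans _ (Fv m)).
have H (f : nat -> R) : (forall m, `|f m|%:C%C <= `|F m|) -> cvgn (series f).
  move=> fF; apply: normed_cvg; apply: (series_le_cvg _ v0) cv => //= m.
  by rewrite -lecR (le_trans (fF m)).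
have /cvg_ex[x hx] : cvgn (series (fun m => complex.Re (F m))).
  by apply: H => m; exact: normc_ge_Re.
have /cvg_ex[y hy] : cvgn (series (fun m => complex.Im (F m))).
  by apply: H => m; exact: normc_ge_Im.
exists (x +i* y)%C; split => /=.
  by under eq_fun do rewrite Re_series.
by under eq_fun do rewrite Im_series.
Qed.

(** The difference of consecutive 1 / b is 1 / ((2m-1) b_m), so twice it dominates 1 / (m b_m) and
    telescopes. *)
Lemma invb_le (m : nat) : (b m)^-1 / m%:R <= 2 * ((b m.-1)^-1 - (b m)^-1).
Proof.
case: m => [|m]; first by rewrite invr0 mulr0 subrr mulr0.
rewrite /= bS_div.
have bm := b_gt0 R m.
have p0 : 0 <= m%:R :> R by [].
have -> : m.+1.*2%:R = 2 * m%:R + 2 :> R by rewrite -muln2 natrM -natr1; ring.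
have -> : m.*2.+1%:R = 2 * m%:R + 1 :> R by rewrite -muln2 -natr1 natrM; ring.
have -> : m.+1%:R = m%:R + 1 :> R by rewrite -natr1.
move: (m%:R : R) p0 => p p0.
have n1 : p + 1 != 0 by rewrite gt_eqF // ltr_wpDl.
have n2 : 2 * p + 2 != 0 by rewrite gt_eqF //; lra.
have n3 : 2 * p + 1 != 0 by rewrite gt_eqF //; lra.
have n4 : b m != 0 by rewrite gt_eqF.
rewrite -subr_ge0 (_ : _ - _ = (b m)^-1 * ((p + 1)^-1 * ((2 * p + 2)^-1))); last first.
  by field; rewrite n1 n2 n3 n4.
by rewrite !mulr_ge0 // invr_ge0; lra.
Qed.

Lemma invb_ge_half m : (b m)^-1 <= 2 * (b m.+1)^-1.
Proof.
have H : b m.+1 <= 2 * b m.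
  rewrite bS_div; move: (b m) (b_gt0 R m) => x x0.
  rewrite -mulrA mulrC ler_wpM2r ?(ltW x0) // ler_pdivrMr ?ltr0n // -natrM ler_nat; lia.
move: (b m) (b m.+1) (b_gt0 R m) (b_gt0 R m.+1) H => x y x0 y0 H.
by rewrite ler_pdivlMr // mulrC ler_pdivrMr.
Qed.

Lemma cvg_series_invb : cvgn (series (fun m => (b m)^-1 / m%:R)).
Proof.
apply: nondecreasing_is_cvgn.
  by apply: nondecreasing_series => n _; rewrite divr_ge0 // invr_ge0 ltW ?b_gt0.
exists 2 => _ [n _ <-].
have H : series (fun m => (b m)^-1 / m%:R) n.+1 <= 2 - 2 * (b n)^-1.
  elim: n => [|n IH]; first by rewrite /series /= big_nat1 b0 invr0 mulr0; lra.
  rewrite seriesSr /=; have := invb_le n.+1 => /=.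
    move: ((b n.+1)^-1 / n.+1%:R) => x.
    by move: (b n.+1)^-1 (b n)^-1 (series _ _) IH => y z t IH H; lra.
apply: (@le_trans _ _ (series (fun m => (b m)^-1 / m%:R) n.+1)).
  by rewrite seriesSr lerDl divr_ge0 // invr_ge0 ltW ?b_gt0.
by rewrite (le_trans H) // gerBl mulr_ge0 // invr_ge0 ltW ?b_gt0.
Qed.

Lemma b_sqr_ge n : n.+1%:R <= b n ^+ 2.
Proof.
elim: n => [|n IH]; first by rewrite b0 expr1n.
rewrite bS_div.
have p0 : 0 <= n%:R :> R by [].
have -> : n.+1.*2%:R = 2 * n%:R + 2 :> R by rewrite -muln2 natrM -natr1; ring.
have -> : n.*2.+1%:R = 2 * n%:R + 1 :> R by rewrite -muln2 -natr1 natrM; ring.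
have -> : n.+2%:R = n%:R + 2 :> R by rewrite -[n.+2]addn2 natrD.
have E : n.+1%:R = n%:R + 1 :> R by rewrite -natr1.
move: IH; rewrite E; move: (n%:R : R) p0 => p p0 IH.
rewrite expr_div_n exprMn ler_pdivlMr ?exprn_gt0 //; last by lra.
apply: (@le_trans _ _ ((p + 1) * (2 * p + 2) ^+ 2)); last by rewrite ler_wpM2r // sqr_ge0.
rewrite -subr_ge0 (_ : _ - _ = 3 * p + 2); [lra|ring].
Qed.

Lemma invb_cvg0 : (fun n => (b n)^-1) @ \oo --> (0 : R).
Proof.
apply/cvgr0Pnorm_le => e e0.
have e2 : 0 < e ^+ 2 by rewrite exprn_gt0.
have := @cvg_harmonic R => /cvgr0Pnorm_le /(_ _ e2); apply: filterS => n.
rewrite /harmonic /= => h.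
rewrite ger0_norm ?invr_ge0 ?(ltW (b_gt0 _ _)) //.
rewrite -(@ler_pXn2r _ 2) ?nnegrE ?(ltW e0) ?invr_ge0 ?(ltW (b_gt0 _ _)) //.
rewrite (le_trans _ h) // ger0_norm ?invr_ge0 // exprVn lef_pV2 ?posrE ?exprn_gt0 ?b_gt0 //.
exact: b_sqr_ge.
Qed.

Lemma root4_norm z : root4 z -> `|z| = 1.
Proof.
move=> z4; have : `|z| ^+ 4 == 1 by rewrite -normrX z4 normr1.
by rewrite pexpr_eq1 // => /eqP.
Qed.

Lemma natr_expr_le k m : (0 < k)%N -> (m.+1%:R ^+ k)^-1 <= m.+1%:R^-1 :> R.
Proof.
move=> k0; rewrite lef_pV2 ?posrE ?exprn_gt0 ?ltr0n //.
by rewrite -[X in X <= _]expr1 ler_weXn2l // ler1n.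
Qed.

Lemma liw_series_bound (M : R) w m : (forall m, `|liw w m| <= (M / b m)%:C%C) ->
  `|series (liw w) m.+1| <= (2 * M / b m.+1 * m.+1%:R)%:C%C.
Proof.
move=> hM; rewrite /series /= (le_trans (ler_norm_sum _ _ _)) //.
have : \sum_(0 <= i < m.+1) `|liw w i| <= \sum_(0 <= i < m.+1) (M / b i)%:C%C :> C.
  by apply: ler_sum => i _; exact: hM.
move/le_trans; apply; rewrite -rmorph_sum /= lecR -mulr_sumr.
have -> : \sum_(0 <= i < m.+1) (b i)^-1 = m.*2.+1%:R / b m :> R by rewrite -series_invb.
have -> : m.*2.+1%:R / b m = 2 * m.+1%:R / b m.+1.
  rewrite bS_div -[2 * _]natrM mul2n; move: (b m) (b_neq0 R m) => x x0.
  have p1 : m.*2.+1%:R != 0 :> R by rewrite pnatr_eq0.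
  have p2 : m.+1.*2%:R != 0 :> R by rewrite pnatr_eq0.
  move: (m.*2.+1%:R : R) (m.+1.*2%:R : R) p1 p2 => p q p1 p2.
  by field; rewrite x0 p1 p2.
by rewrite le_eqVlt; apply/orP; left; apply/eqP; ring.
Qed.

Lemma liw_cons_bound (M : R) k z w m : root4 z -> (0 < k)%N -> 0 <= M ->
  (forall m, `|liw w m| <= (M / b m)%:C%C) ->
  `|liw ((k, z) :: w) m| <= (2 * M * ((b m)^-1 / m%:R ^+ k.-1))%:C%C.
Proof.
move=> z4 k0 M0 hM; case: m => [|m].
  rewrite /= [series _ 0]big_geq // mulr0 normr0 ler0c.
  by rewrite !mulr_ge0 // invr_ge0 ?exprn_ge0 // ltW ?b_gt0.
rewrite [liw _ _]/= !normrM normrX root4_norm // expr1n mul1r.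
have -> : `|m.+1%:R ^- k : C| = (m.+1%:R ^- k)%:C%C.
  by rewrite normfV normrX normr_nat fmorphV rmorphXn rmorph_nat.
have h0 : 0 <= m.+1%:R ^- k :> R by rewrite invr_ge0 exprn_ge0.
apply: (@le_trans _ _ ((m.+1%:R ^- k)%:C%C * (2 * M / b m.+1 * m.+1%:R)%:C%C)).
  by rewrite ler_wpM2l ?ler0c // liw_series_bound.
rewrite -rmorphM lecR le_eqVlt; apply/orP; left; apply/eqP.
case: k k0 {h0} => // k _; rewrite exprS /=.
have p1 : m.+1%:R != 0 :> R by rewrite pnatr_eq0.
have p2 : m.+1%:R ^+ k != 0 :> R by rewrite expf_neq0.
move: (b m.+1) (b_neq0 R m.+1) (m.+1%:R : R) (m.+1%:R ^+ k : R) p1 p2 => x x0 y yk y0 yk0.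
by field; rewrite x0 y0 yk0.
Qed.

(** The summands are powers of a logarithm over m in size; the majorant M / b_m is cruder but
    reproduces itself along the word, at the price of doubling [M] at each entry. *)
Lemma liw_bound n w : good n w -> exists2 M : R, 0 <= M & forall m, `|liw w m| <= (M / b m)%:C%C.
Proof.
elim: w n => [|[k z] w IH] n.
  move=> _; exists 1 => // -[|m] /=; rewrite ?b0 ?divr1 ?normr1 ?rmorph1 // normr0.
  by rewrite ler0c divr_ge0 // ltW ?b_gt0.
move=> [/= /andP[k0 w1] /andP[/eqP z4 w2] _].
have [M M0 hM] := IH (sumn [seq p.1 | p <- w]) (And3 w1 w2 erefl).
exists (2 * M); first exact: mulr_ge0.
move=> m; apply: le_trans (liw_cons_bound m z4 k0 M0 hM) _.
rewrite lecR ler_wpM2l ?mulr_ge0 // ler_piMr ?invr_ge0 ?(ltW (b_gt0 _ _)) //.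
case: m => [|m]; last by rewrite invf_le1 ?exprn_gt0 ?ltr0n // exprn_ege1 // ler1n.
by case: (k.-1) => [|j]; rewrite ?expr0 ?invr1 // exprS mul0r invr0.
Qed.

Lemma abel_sum (z : C) (v : nat -> C) n : v 0%N = 0 ->
  (1 - z) * series (fun m => z ^+ m * v m) n.+1 =
  series (fun m => z ^+ m * (v m - v m.-1)) n.+1 - z ^+ n.+1 * v n.
Proof.
move=> v0; elim: n => [|n IH].
  by rewrite /series /= !big_nat1 v0 subrr !mulr0 subrr.
by rewrite seriesSr mulrDr IH [in RHS]seriesSr /= [z ^+ n.+2]exprS; ring.
Qed.

(** For a leading exponent at least 2 the series is dominated by the sum of 1 / (m b_m). For
    exponent 1 with z <> 1, summation by parts brings it back to that case. *)
Lemma liw_cvg n w : adm n w -> exists L, ccvg (series (liw w)) L.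
Proof.
move=> [[a1 a2 _] [k [z [w' [wE kz]]]]]; move: a1 a2; rewrite wE /=.
move=> /andP[k0 w1] /andP[/eqP z4 w2].
have [M M0 hM] := liw_bound (And3 w1 w2 erefl).
have hk m := liw_cons_bound m z4 k0 M0 hM.
case: k k0 kz hk {wE} => // -[|k] _ kz hk.
  have z1 : 1 - z != 0.
    by rewrite subr_eq0; apply/eqP => zz; apply: kz; rewrite -zz.
  pose v m := series (liw w') m / m%:R : C.
  have v0 : v 0%N = 0 by rewrite /v invr0 mulr0.
  have vb m : `|v m| <= (2 * M / b m)%:C%C.
    case: m => [|m]; first by rewrite v0 normr0 ler0c divr_ge0 ?mulr_ge0 // ltW ?b_gt0.
    rewrite /v normrM normfV normr_nat ler_pdivrMr ?ltr0n //.
    by rewrite (le_trans (liw_series_bound m hM)) // rmorphM rmorph_nat.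
  have E m : liw ((1%N, z) :: w') m = z ^+ m * v m by rewrite /= expr1 /v; ring.
  have -> : series (liw ((1%N, z) :: w')) = series (fun m => z ^+ m * v m).
    by congr series; apply/funext.
  have [l hl] : exists l, ccvg (series (fun m => z ^+ m * (v m - v m.-1))) l.
    (* The difference of consecutive v is (liw_(m-1) - v_(m-1)) / m, at most (M + 2M) / (m b_(m-1));
       replacing b_(m-1) by b_m costs the last factor 2. *)
    apply: (@abs_cvg _ (fun m => (6 * M) * ((b m)^-1 / m%:R))); last first.
      have -> : series (fun m => 6 * M * ((b m)^-1 / m%:R)) =
         (fun n => 6 * M * series (fun m => (b m)^-1 / m%:R) n).
        by apply/funext => i; rewrite /series /= mulr_sumr.
      by apply: is_cvgMr; exact: cvg_series_invb.
    case=> [|m]; first by rewrite v0 subrr mulr0 normr0 invr0 !mulr0.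
    rewrite normrM normrX root4_norm // expr1n mul1r /=.
    have p1 : m.+1%:R != 0 :> C by rewrite pnatr_eq0.
    have -> : v m.+1 - v m = (liw w' m - v m) / m.+1%:R.
      rewrite {1}/v seriesSr.
      have -> : series (liw w') m = v m * m%:R.
        rewrite /v; case: (m) => [|i]; first by rewrite mulr0 [series _ 0]big_geq.
        by rewrite divfK // pnatr_eq0.
      have h : m%:R = m.+1%:R - 1 :> C by rewrite -natr1 addrK.
      rewrite h; move: (m.+1%:R : C) p1 => y y0.
      by field.
    rewrite normrM normfV normr_nat ler_pdivrMr ?ltr0n //.
    apply: (@le_trans _ _ ((M / b m)%:C%C + (2 * M / b m)%:C%C)).
      by rewrite (le_trans (ler_normB _ _)) // lerD.
    rewrite -rmorphD -(rmorph_nat (real_complex R)) -rmorphM lecR.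
    rewrite -!mulrA mulVf ?pnatr_eq0 // mulr1.
    have := invb_ge_half m; move: (b m)^-1 (b m.+1)^-1 => x y xy; nra.
  have c2 : ccvg (fun n => z ^+ n.+1 * v n) 0.
    apply: (@ccvg0 _ (fun n => 2 * M * (b n)^-1)).
      by move=> i; rewrite normrM normrX root4_norm // expr1n mul1r.
    by rewrite -(mulr0 (2 * M)); apply: cvgMr; exact: invb_cvg0.
  exists ((1 - z)^-1 * (l + (-1) * 0)); apply: ccvgSV.
  have := ccvgZ (1 - z)^-1 (ccvgD (ccvgS hl) (ccvgZ (-1) c2)).
  by under eq_fun do rewrite mulN1r -abel_sum // mulKf //.
apply: (@abs_cvg _ (fun m => 2 * M * ((b m)^-1 / m%:R))).
  move=> m; rewrite (le_trans (hk m)) // lecR /= ler_wpM2l ?mulr_ge0 //.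
  rewrite ler_wpM2l ?invr_ge0 ?(ltW (b_gt0 _ _)) //.
  case: m => [|m]; first by rewrite exprS mul0r.
  exact: natr_expr_le.
have -> : series (fun m => 2 * M * ((b m)^-1 / m%:R)) =
   (fun n => 2 * M * series (fun m => (b m)^-1 / m%:R) n).
  by apply/funext => i; rewrite /series /= mulr_sumr.
by apply: is_cvgMr; exact: cvg_series_invb.
Qed.

End Colored.

(** * Sums over chains of indices as iterated partial sums *)

Section Nested.
Variable V : comPzRingType.

(** The sum over all chains with prescribed leading index [m]. The empty chain has leading index 0,
    which encodes n_(p+1) = 0, and a weak relation extends the inner summation by one term. *)
Fixpoint nest p : ('I_p -> bool) -> ('I_p -> nat -> V) -> nat -> V :=
  match p return ('I_p -> bool) -> ('I_p -> nat -> V) -> nat -> V with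
  | 0 => fun _ _ m => (m == 0%N)%:R
  | p'.+1 => fun st g m => g ord0 m *
      series (nest (fun j => st (lift ord0 j)) (fun j => g (lift ord0 j))) (m + ~~ st ord0)%N
  end.

Definition head_index p (n : 'I_p -> nat) : nat := oapp n 0%N (insub 0%N).

Lemma oapp_lift p (n : 'I_p.+1 -> nat) k :
  oapp n 0%N (insub k.+1) = oapp (fun j => n (lift ord0 j)) 0%N (insub k).
Proof.
case: (ltnP k p) => kp; last by rewrite !insubF // ?ltnS ltnNge kp.
rewrite (insubT (fun i => i < p.+1)%N (kp : (k.+1 < p.+1)%N)) (insubT (fun i => i < p)%N kp) /=.
by congr n; apply: val_inj.
Qed.

Lemma chainS p (st : 'I_p.+1 -> bool) (n : 'I_p.+1 -> nat) :
  chain st n = (head_index (fun j => n (lift ord0 j)) < n ord0 + ~~ st ord0)%N &&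
    chain (fun j => st (lift ord0 j)) (fun j => n (lift ord0 j)).
Proof.
have E0 : next_index n ord0 = head_index (fun j => n (lift ord0 j)).
  by rewrite /next_index oapp_lift.
have E1 j : next_index n (lift ord0 j) = next_index (fun j => n (lift ord0 j)) j.
  by rewrite /next_index oapp_lift.
have E2 : (head_index (fun j => n (lift ord0 j)) < n ord0 + ~~ st ord0)%N =
   (if st ord0 then (n ord0 > next_index n ord0)%N else (n ord0 >= next_index n ord0)%N).
  by rewrite E0; case: (st ord0); rewrite ?addn0 ?addn1.
rewrite E2; apply/forallP/andP => [h|[h0 /forallP h1] j].
  by split; [exact: h|apply/forallP => j; rewrite -E1; exact: h].
by case: (unliftP ord0 j) => [j' ->|-> //]; rewrite E1; exact: h1.
Qed.

Definition nested_at p N (st : 'I_p -> bool) (g : 'I_p -> nat -> V) (m : nat) : V :=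
  \sum_(n : {ffun 'I_p -> 'I_N} | chain st (fun j => n j) && (head_index (fun j => n j) == m))
    \prod_j g j (n j).

Lemma sum_by_level (T : finType) (P : pred T) (h : T -> nat) (F : T -> V) K :
  \sum_(n | P n && (h n < K)%N) F n = \sum_(i < K) \sum_(n | P n && (h n == i)) F n.
Proof.
rewrite (exchange_big_dep P) /=; last by move=> i n _ /andP[].
rewrite [LHS]big_mkcondr /=; apply: eq_bigr => n Pn; rewrite Pn /=.
case: ltnP => hK.
  by rewrite (big_pred1 (Ordinal hK)) // => i; rewrite -val_eqE /= eq_sym.
rewrite big_pred0 // => i; apply/eqP => hi; move: (ltn_ord i); rewrite -hi.
by rewrite ltnNge hK.
Qed.

(** The cutoff [N] is invisible: below a leading index m < N, the next index runs below m or m + 1,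
    neither of which exceeds [N]. *)
Lemma nested_atE p N (st : 'I_p -> bool) (g : 'I_p -> nat -> V) m : (m < N)%N ->
  nested_at N st g m = nest st g m.
Proof.
elim: p st g m => [|p IH] st g m mN.
  have c0 (n : 'I_0 -> nat) : chain st n by apply/forallP => -[].
  have h0 (n : 'I_0 -> nat) : head_index n = 0%N by rewrite /head_index insubF.
  have f0 : [ffun j : 'I_0 => Ordinal mN] = [ffun j : 'I_0 => Ordinal mN] by [].
  rewrite /nested_at /=.
  under eq_bigl do rewrite c0 h0 /= eq_sym.
  under eq_bigr do rewrite big_ord0.
  case: eqP => _; last by rewrite big_pred0.
  rewrite (big_pred1 [ffun j : 'I_0 => Ordinal mN]) // => n.
  by apply/esym/eqP/ffunP => -[].
pose cons (x : 'I_N * {ffun 'I_p -> 'I_N}) : {ffun 'I_p.+1 -> 'I_N} :=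
  [ffun j => if unlift ord0 j is Some j' then x.2 j' else x.1].
have c0 x : cons x ord0 = x.1 by rewrite ffunE unlift_none.
have cl x j : cons x (lift ord0 j) = x.2 j by rewrite ffunE liftK.
have bij : bijective cons.
  exists (fun n : {ffun 'I_p.+1 -> 'I_N} => (n ord0, [ffun j : 'I_p => n (lift ord0 j)])).
    case=> i n; rewrite c0; congr (_, _).
    by apply/ffunP => j; rewrite ffunE cl.
  move=> n; apply/ffunP => j; rewrite ffunE /=.
  by case: unliftP => [j' ->|-> //]; rewrite ffunE.
rewrite /nested_at (reindex cons) /=; last exact: onW_bij.
pose st' j := st (lift ord0 j); pose g' j := g (lift ord0 j).
have E (x : 'I_N * {ffun 'I_p -> 'I_N}) :
    chain st (fun j => nat_of_ord (cons x j)) && (head_index (fun j => nat_of_ord (cons x j)) == m) =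
    (x.1 == Ordinal mN) && (chain st' (fun j => x.2 j) && (head_index (fun j => x.2 j) < m + ~~ st ord0)%N).
  rewrite chainS c0.
  have -> : (fun j => nat_of_ord (cons x (lift ord0 j))) = (fun j => nat_of_ord (x.2 j)).
    by apply/funext => j; rewrite cl.
  have -> : head_index (fun j => nat_of_ord (cons x j)) = x.1.
    rewrite /head_index (insubT (fun i => i < p.+1)%N (ltn0Sn p)) /= -(c0 x).
    by congr (nat_of_ord (cons x _)); apply: val_inj.
  rewrite -val_eqE /=; case: eqP => [->|]; last by rewrite andbF.
  by rewrite andbT andbC.
under eq_bigl do rewrite E.
under eq_bigr do rewrite big_ord_recl c0.
rewrite -(pair_big_dep (fun i : 'I_N => i == Ordinal mN)
  (fun _ (n : {ffun 'I_p -> 'I_N}) => chain st' (fun j => n j) && (head_index (fun j => n j) < m + ~~ st ord0)%N)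
  (fun i n => g ord0 i * \prod_(j < p) g (lift ord0 j) (cons (i, n) (lift ord0 j)))) /=.
rewrite big_pred1_eq -mulr_sumr; congr (_ * _).
have bound : (m + ~~ st ord0 <= N)%N by case: (st ord0); lia.
rewrite /series /= big_mkord.
transitivity (\sum_(i < m + ~~ st ord0) nested_at N st' g' i); last first.
  by apply: eq_bigr => i _; apply: IH; exact: leq_trans (ltn_ord i) bound.
rewrite /nested_at -(sum_by_level _ (fun n : {ffun 'I_p -> 'I_N} => head_index (fun j => nat_of_ord (n j)))).
by apply: eq_bigr => n _; apply: eq_bigr => j _; rewrite cl.
Qed.

Lemma nested_psumE p (st : 'I_p.+1 -> bool) (g : 'I_p.+1 -> nat -> V) N :
  nested_psum st (fun n => \prod_j g j (n j)) N = series (nest st g) N.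
Proof.
transitivity (\sum_(m < N) nested_at N st g m); last first.
  rewrite [RHS]big_mkord; apply: eq_bigr => m _; exact: nested_atE.
rewrite /nested_at -sum_by_level; apply: eq_bigl => n.
rewrite /head_index (insubT (fun i => i < p.+1)%N (ltn0Sn p)) /= ltn_ord andbT.
by [].
Qed.

End Nested.

(** * From combinations of summands to spans of colored values *)

Section Membership.
Variable R : realType.
Local Notation C := R[i].
Implicit Types (x c g : C).

Lemma nest_liw (w : lword R) m :
  nest (fun=> true) (fun (j : 'I_(size w)) m => (nth (0%N, 0) w j).2 ^+ m / m%:R ^+ (nth (0%N, 0) w j).1) m
  = liw w m.
Proof.
elim: w m => [|[k z] w IH] m //=; rewrite addn0; congr (_ * series _ _).
by apply/funext => i; rewrite -IH.
Qed.

Lemma adm_Li n (w : lword R) L : adm n w -> ccvg (series (liw w)) L -> cmzv4 n L.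
Proof.
move=> [[w1 w2 w3] [k [z [w' [wE kz]]]]] hL; move: w1 w2 w3 hL; rewrite wE => w1 w2 w3 hL.
pose w0 := (k, z) :: w'.
exists (size w'), (fun j => (nth (0%N, 0) w0 j).1), (fun j => (nth (0%N, 0) w0 j).2).
split.
- by move=> j; apply: (allP w1); apply: mem_nth.
- by move=> j; apply/eqP; apply: (allP w2); apply: mem_nth.
- exact: kz.
- rewrite -w3 sumnE big_map (big_nth (0%N, 0)) big_mkord; by [].
- rewrite /Li; apply/esym; apply: ccvg_lim.
  have -> : nested_psum (fun=> true) (fun m : 'I_(size w').+1 -> nat =>
      \prod_(j < (size w').+1) ((nth (0%N, 0) w0 j).2 ^+ m j / (m j)%:R ^+ (nth (0%N, 0) w0 j).1)) = series (liw w0) :> (nat -> C).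
    apply/funext => N.
    rewrite (nested_psumE (fun=> true) (fun (j : 'I_(size w').+1) m => (nth (0%N, 0) w0 j).2 ^+ m / m%:R ^+ (nth (0%N, 0) w0 j).1)).
    by congr (series _ N); apply/funext => m; exact: (nest_liw w0).
  exact: hL.
Qed.

Lemma span_over0 (F G : set C) : span_over F G 0.
Proof. by exists 0%N, (fun=> 0), (fun=> 0); split; [case|case|rewrite big_ord0]. Qed.

Lemma span_overD (F G : set C) x y : span_over F G x -> span_over F G y -> span_over F G (x + y).
Proof.
move=> [m1 [c1 [g1 [h1 h2 ->]]]] [m2 [c2 [g2 [h3 h4 ->]]]].
exists (m1 + m2)%N, (fun i => match fintype.split i with inl j => c1 j | inr j => c2 j end),
  (fun i => match fintype.split i with inl j => g1 j | inr j => g2 j end); split.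
- by move=> i; case: (fintype.split i).
- by move=> i; case: (fintype.split i).
- rewrite big_split_ord /=; congr (_ + _); apply: eq_bigr => i _.
    by rewrite (unsplitK (inl i)).
  by rewrite (unsplitK (inr i)).
Qed.

Lemma span_over1 (F G : set C) c g : F c -> G g -> span_over F G (c * g).
Proof. by move=> Fc Gg; exists 1%N, (fun=> c), (fun=> g); split=> //; rewrite big_ord1. Qed.

Lemma span_overZ (F G : set C) x y : (forall x y, F x -> F y -> F (x * y)) ->
  F x -> span_over F G y -> span_over F G (x * y).
Proof.
move=> FM Fx [m [c [g [h1 h2 ->]]]]; exists m, (fun i => x * c i), g; split=> //.
  by move=> i; apply: FM.
by rewrite mulr_sumr; apply: eq_bigr => i _; rewrite mulrA.
Qed.

Lemma LS_sum (K : C -> Prop) n (F : nat -> C) : LS K (adm n) F ->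
  exists2 L, ccvg (series F) L & span_over K (@cmzv4 R n) L.
Proof.
elim=> [|x w F' Kx aw _ [L hL sL]].
  exists 0; last exact: span_over0.
  have -> : series (fun=> 0 : C) = (fun=> 0).
    by apply/funext => N; rewrite /series /= big1.
  by split; exact: cvg_cst.
have [M hM] := liw_cvg aw.
exists (x * M + L); last by apply: span_overD => //; apply: span_over1 => //; exact: adm_Li hM.
have := ccvgD (ccvgZ x hM) hL.
have -> // : (fun N => x * series (liw w) N + series F' N) = series (fun m => x * liw w m + F' m).
by apply/funext => N; rewrite /series /= mulr_sumr -big_split.
Qed.

Lemma span_over_sub (F F' G : set C) x : (forall c, F c -> F' c) -> span_over F G x -> span_over F' G x.
Proof. by move=> FF [m [c [g [h1 h2 ->]]]]; exists m, c, g; split=> // i; exact: FF. Qed.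

Lemma LS_sum_real (K : C -> Prop) n (t : nat -> R) : LS K (adm n) (fun m => (t m)%:C%C) ->
  exists2 T : R, series t @ \oo --> T & span_over K (@cmzv4 R n) T%:C%C.
Proof.
move=> /LS_sum[L [hL1 hL2] sL]; exists (complex.Re L).
  have -> // : series t = (fun N => complex.Re (series (fun m => (t m)%:C%C) N)).
  by apply/funext => N; rewrite Re_series.
suff -> : (complex.Re L)%:C%C = L by [].
have i0 : complex.Im L = 0.
  apply: (cvg_unique _ hL2) => //.
  have -> : (fun N => complex.Im (series (fun m => (t m)%:C%C) N)) = (fun=> 0 : R).
    by apply/funext => N; rewrite Im_series /series /= big1.
  exact: cvg_cst.
by rewrite [RHS]complexE i0 mulr0 addr0.
Qed.

End Membership.

(** * Convergent sums weighted by b_n^2, and their values at u = 1 *)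

Section Good.
Variable R : realType.
Local Notation C := R[i].
Local Notation b := (bseq R).
Local Notation Ai := (@Ai R).
Local Notation Bi := (@Bi R).
Local Notation std := (@std R).
Implicit Types (x : C) (f : nat -> R) (u : R).

Definition Tens (W : nat) : set C := tensor_Qi (@CMZV4_le R W).

Lemma QiM x y : Qiset x -> Qiset y -> Qiset (x * y).
Proof.
have ii : ('i%C : C) ^+ 2 = -1 by rewrite sqr_i.
move=> [p [q ->]] [r [s ->]]; exists (p * r - q * s), (p * s + q * r).
by rewrite !(rmorphM, rmorphD, rmorphN) /=; ring: ii.
Qed.

Lemma CMZV4_0 k : @CMZV4 R k 0.
Proof. by case: k => [|k]; [exists 0; rewrite rmorph0|exact: span_over0]. Qed.

Lemma CMZV4_le_in k W x : (k <= W)%N -> @CMZV4 R k x -> @CMZV4_le R W x.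
Proof.
move=> kW xk; exists (fun j : 'I_W.+1 => if (j == k :> nat) then x else 0).
  by move=> j; case: eqP => [->|_] //; exact: CMZV4_0.
rewrite (bigD1 (Ordinal (kW : k < W.+1)%N)) //= eqxx big1 ?addr0 //.
by move=> j jk; rewrite -val_eqE /= in jk; rewrite (negbTE jk).
Qed.

Lemma CMZV4_le_mono W W' x : (W <= W')%N -> @CMZV4_le R W x -> @CMZV4_le R W' x.
Proof.
move=> WW [y hy ->].
exists (fun j : 'I_W'.+1 => if (j < W.+1)%N then y (inord j) else 0).
  move=> j; case: ltnP => jW; last exact: CMZV4_0.
  by have := hy (inord j); rewrite inordK.
transitivity (\sum_(i < W.+1) y (inord i)); first by apply: eq_bigr => i _; rewrite inord_val.
by rewrite (big_ord_widen W'.+1 (fun j => y (inord j))) // big_mkcond.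
Qed.

Lemma Tens_span (K : C -> Prop) n W x : (forall c, K c -> Qiset c) -> (0 < n <= W)%N ->
  span_over K (@cmzv4 R n) x -> Tens W x.
Proof.
move=> KQ /andP[n0 nW] [m [c [g [h1 h2 ->]]]]; exists m, c, g; split=> // i; first exact: KQ.
apply: (CMZV4_le_in nW); case: n n0 nW h2 => // n _ _ h2.
rewrite -[g i]mul1r; apply: span_over1 => //.
by exists 1; rewrite rmorph1.
Qed.

Lemma Tens_CMZV4 k W x : (k <= W)%N -> @CMZV4 R k x -> Tens W x.
Proof.
move=> kW xk; rewrite -[x]mul1r; apply: span_over1; last exact: CMZV4_le_in xk.
by exists 1, 0; rewrite rmorph1 rmorph0 mul0r addr0.
Qed.

Lemma TensD W x y : Tens W x -> Tens W y -> Tens W (x + y).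
Proof. exact: span_overD. Qed.

Lemma TensZ W x y : Qiset x -> Tens W y -> Tens W (x * y).
Proof. by move=> ? ?; apply: span_overZ => //; exact: QiM. Qed.

Lemma TensW W W' x : (W <= W')%N -> Tens W x -> Tens W' x.
Proof.
move=> WW [m [c [g [h1 h2 ->]]]]; exists m, c, g; split=> // i.
exact: CMZV4_le_mono WW (h2 i).
Qed.

Lemma Qi_rat (q : rat) : Qiset (ratr q : C).
Proof. by exists q, 0; rewrite rmorph0 mul0r addr0. Qed.

Lemma Tens_rat W (q : rat) : Tens W (ratr q).
Proof. by apply: (@Tens_CMZV4 0) => //; exists q. Qed.

Lemma rc_rat (q : rat) : ((ratr q : R)%:C%C : C) = ratr q.
Proof. by rewrite fmorph_rat. Qed.

(** Convergence is part of the predicate, so that a reduction can only pass through series that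
    converge separately. *)
Definition Good (W : nat) f : Prop :=
  exists2 S : R, series (fun n => b n ^+ 2 * f n) @ \oo --> S & Tens W S%:C%C.

Lemma Good_ext W f g : (forall n, f n = g n) -> Good W f -> Good W g.
Proof. by move=> /funext ->. Qed.

Lemma GoodD W f g : Good W f -> Good W g -> Good W (fun n => f n + g n).
Proof.
move=> [S hS tS] [T hT tT]; exists (S + T); last by rewrite rmorphD; exact: TensD.
have -> : series (fun n => b n ^+ 2 * (f n + g n)) =
  series (fun n => b n ^+ 2 * f n) + series (fun n => b n ^+ 2 * g n).
  by apply/funext => n; rewrite /series fctE /= -big_split; apply: eq_bigr => i _; rewrite mulrDr.
exact: cvgD.
Qed.

Lemma GoodZ W (q : rat) f : Good W f -> Good W (fun n => ratr q * f n).
Proof.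
move=> [S hS tS]; exists (ratr q * S); last first.
  by rewrite rmorphM /= rc_rat; apply: TensZ => //; exact: Qi_rat.
have -> : series (fun n => b n ^+ 2 * (ratr q * f n)) =
  (fun N => ratr q * series (fun n => b n ^+ 2 * f n) N).
  by apply/funext => n; rewrite /series /= mulr_sumr; apply: eq_bigr => i _; rewrite mulrCA.
exact: cvgMr.
Qed.

Lemma GoodB W f g : Good W f -> Good W g -> Good W (fun n => f n - g n).
Proof.
move=> hf hg; have := GoodD hf (GoodZ (-1) hg); apply: Good_ext => n.
by rewrite rmorphN1 mulN1r.
Qed.

Lemma Good_delta0 W (q : rat) : Good W (fun n => ratr q * delta0 R n).
Proof.
exists (ratr q); last by rewrite rc_rat; exact: Tens_rat.
rewrite -cvg_shiftS.
have -> : [sequence series (fun n => b n ^+ 2 * (ratr q * delta0 R n)) n.+1]_n = fun=> ratr q.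
  apply/funext => n; rewrite /series /= big_nat_recl // big1 ?addr0.
    by rewrite b0 expr1n /delta0 !mulr1 mul1r.
  by move=> i _; rewrite /delta0 !mulr0.
exact: cvg_cst.
Qed.

(* b_{k+1} / b_k = (2 k + 2) / (2 k + 1). *)
Lemma Good_shift W f h : f 0%N = 0 ->
  (forall n, (n.+1.*2%:R * Bi n) ^+ 2 * f n.+1 = h n) -> Good W h -> Good W f.
Proof.
move=> f0 fh [S hS tS]; exists S => //; rewrite -cvg_shiftS.
have -> // : [sequence series (fun n => b n ^+ 2 * f n) n.+1]_n = series (fun n => b n ^+ 2 * h n).
apply/funext => n; rewrite /series /= big_nat_recl //= f0 mulr0 add0r.
by apply: eq_bigr => i _; rewrite -fh bS_div /Bi -[b i * _ / _]mulrA exprMn mulrA.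
Qed.

Lemma cvg_series_delta0 : cvgn (series (delta0 R)).
Proof.
apply/cvg_ex; exists 1; rewrite -cvg_shiftS.
have -> : [sequence series (delta0 R) n.+1]_n = fun=> 1.
  apply/funext => n; rewrite /series /= big_nat_recl // big1 ?addr0 //.
exact: cvg_cst.
Qed.

Lemma summable (M : R) f : (forall n, `|f n.+1| <= M / b n.+1 / n.+1%:R ^+ 2) ->
  cvgn (series (fun n => b n ^+ 2 * f n)).
Proof.
move=> fM; apply: normed_cvg.
have M0 : 0 <= M.
  have := le_trans (normr_ge0 _) (fM 0%N); rewrite expr1n divr1.
  by rewrite pmulr_lge0 // invr_gt0 b_gt0.
(* From b_n^2 <= 4 (n+1) <= 8 n for n > 0; the [delta0] term takes care of index 0. *)
apply: (@series_le_cvg _ _ (fun n => 8 * M * ((b n)^-1 / n%:R) + `|f 0%N| * delta0 R n)) => //=.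
- move=> n; apply: addr_ge0; last by rewrite /delta0 mulr_ge0.
  by apply: mulr_ge0; [rewrite mulr_ge0|rewrite divr_ge0 // invr_ge0 ltW // b_gt0].
- case=> [|n]; first by rewrite invr0 !mulr0 add0r b0 expr1n mul1r /delta0 mulr1.
  rewrite /delta0 mulr0 addr0 normrM (ger0_norm (sqr_ge0 _)).
  have bn := b_gt0 R n.+1; have B2 := b_sqr_le R n.+1.
  apply: (@le_trans _ _ (4 * n.+2%:R * (M / b n.+1 / n.+1%:R ^+ 2))).
    by apply: ler_pM => //; exact: sqr_ge0.
  apply: (@le_trans _ _ (8 * n.+1%:R * (M / b n.+1 / n.+1%:R ^+ 2))).
    rewrite ler_wpM2r ?divr_ge0 ?exprn_ge0 ?(ltW bn) //.
    by rewrite -!natrM ler_nat; lia.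
  have p1 : n.+1%:R != 0 :> R by rewrite pnatr_eq0.
  rewrite le_eqVlt; apply/orP; left; apply/eqP.
  move: (n.+1%:R : R) p1 (b n.+1) (b_neq0 R n.+1) => p p1 y y0.
  by field; rewrite p1 y0.
- have -> : series (fun n => 8 * M * ((b n)^-1 / n%:R) + `|f 0%N| * delta0 R n) =
    (fun N => 8 * M * series (fun n => (b n)^-1 / n%:R) N + `|f 0%N| * series (delta0 R) N).
    by apply/funext => N; rewrite /series /= !mulr_sumr -big_split.
  apply: is_cvgD; apply: is_cvgMr; [exact: cvg_series_invb|exact: cvg_series_delta0].
Qed.

Lemma Ai_le n : Ai n.+1 <= n.+1%:R^-1.
Proof. by rewrite /Ai lef_pV2 ?posrE ?ltr0n // ler_nat -addnn leq_addr. Qed.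

Lemma Bi_le n : Bi n.+1 <= n.+1%:R^-1.
Proof. rewrite /Bi lef_pV2 ?posrE ?ltr0n // ler_nat; lia. Qed.

Lemma summable_std w o f (g : nat -> R) :
  (forall n, f n.+1 = std ((o, 0%N) :: w) n.+1 * g n.+1) ->
  (forall n, 0 <= g n.+1 <= n.+1%:R^-1 ^+ 2) -> cvgn (series (fun n => b n ^+ 2 * f n)).
Proof.
move=> fE gb; apply: (@summable 1) => n; rewrite fE.
have /andP[s0 s1] := std_bounds R ((o, 0%N) :: w) n.+1; have /andP[g0 g1] := gb n.
by rewrite ger0_norm ?mulr_ge0 // mul1r -exprVn ler_pM.
Qed.

(** Regularity of the last letter at u = 1 makes the coefficients of the primitive summable, and
    Abel's theorem equates its limit with their sum. *)
Lemma regular_primitive p q n (a : nat -> R) l (g : R -> R) (S0 : R) :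
  lseq p n a -> l0 l = 0 \/ n <> 0%N -> parity_letter q l -> l1 l + l2 l + l3 l + l4 l = 0 ->
  (forall u, 0 < u < 1 -> is_derive u (1 : R) g (phi l u * PS a u)) ->
  g u @[u --> 0^'+] --> (0 : R) -> g u @[u --> 1^'-] --> S0 ->
  span_over (@Kp R (p (+) q)) (@cmzv4 R n.+1) S0%:C%C.
Proof.
move=> la ln pl l10 gd g0 g1.
have [T hT sT] := LS_sum_real (LS_letop_adm la ln pl l10).
suff -> : S0 = T by [].
apply: (cvg_unique _ g1) => //.
apply: cvg_trans (abel hT); apply: near_eq_cvg; near=> u.
apply/esym; apply: (int_letter _ _ gd g0).
- exact: bnd_lseq la.
- by case: ln => [->|n0]; [rewrite mul0r|rewrite (lseq_at0 la n0) mulr0].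
- by apply/andP; split; near: u; [apply: nbhs_left_gt|apply: nbhs_left_lt].
Unshelve. all: by end_near. Qed.

(** Two last letters of possibly different parity: rationality is lost, which is why the conclusion
    is over Q[i]. *)
Lemma regular_primitive2 p q q' n (a : nat -> R) l l' (g : R -> R) (S0 : R) :
  lseq p n a -> l0 l = 0 \/ n <> 0%N -> parity_letter q l -> l1 l + l2 l + l3 l + l4 l = 0 ->
  l0 l' = 0 \/ n <> 0%N -> parity_letter q' l' -> l1 l' + l2 l' + l3 l' + l4 l' = 0 ->
  (forall u, 0 < u < 1 -> is_derive u (1 : R) g (phi l u * PS a u + phi l' u * PS a u)) ->
  g u @[u --> 0^'+] --> (0 : R) -> g u @[u --> 1^'-] --> S0 ->
  Tens n.+1 S0%:C%C.
Proof.
move=> la ln pl l10 ln' pl' l10' gd g0 g1.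
have [T hT sT] := LS_sum_real (LS_letop_adm la ln pl l10).
have [T' hT' sT'] := LS_sum_real (LS_letop_adm la ln' pl' l10').
suff -> : S0 = T + T'.
  have nn : (0 < n.+1 <= n.+1)%N by rewrite leqnn.
  rewrite rmorphD; apply: TensD; [apply: Tens_span nn sT|apply: Tens_span nn sT'] => c; exact: Kp_Qi.
apply: (cvg_unique _ g1) => //.
have ba := bnd_lseq la.
have nz l'' : l0 l'' = 0 \/ n <> 0%N -> (l0 l'')%:~R * a 0%N = 0.
  by case=> [->|n0]; [rewrite mul0r|rewrite (lseq_at0 la n0) mulr0].
apply: cvg_trans (cvgD (abel hT) (abel hT')); apply: near_eq_cvg; near=> u.
apply/esym; suff E v : 0 < v < 1 -> g v = PS (letop l a) v + PS (letop l' a) v.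
  by apply: E; apply/andP; split; near: u; [apply: nbhs_left_gt|apply: nbhs_left_lt].
move: v; apply: (eq_of_derive gd).
  by move=> v v01; apply: der_add; apply: der_letop => //; exact: nz.
have PS00 l'' : PS (letop l'' a) u @[u --> 0^'+] --> (0 : R).
  by have := PS_right0 (bnd_letop l'' ba); rewrite {2}/letop invr0 mulr0.
rewrite -[X in _ --> X]subr0; apply: cvgB => //.
by rewrite -[X in _ --> X]addr0; apply: cvgD.
Unshelve. all: by end_near. Qed.

(** The last integration, against sin t dt or csc t dt, consumes one b_n and one of the leading
    factors. With leading exponent at least 3 the remaining series has factor csc t or 1
    respectively, so the last letter is dt or csc t dt: regular at u = 1 and of the same parity as
    the series, hence rational coefficients. *)
Lemma std_sum o s w : exists2 T : R,
  series (fun n => b n ^+ 2 * std ((o, s.+2) :: w) n) @ \oo --> T &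
  @CMZV4 R (weight ((o, s.+2) :: w)) T%:C%C.
Proof.
have /cvg_ex[T hT] : cvgn (series (fun n => b n ^+ 2 * std ((o, s.+2) :: w) n)).
  apply: (@summable_std w o _ (fun n => (if o then Bi n else Ai n) ^+ s.+2)).
    by move=> n /=; case: (o); rewrite -mulrA -exprS.
  move=> n; have [h0 h1] : 0 <= (if o then Bi n.+1 else Ai n.+1) /\ (if o then Bi n.+1 else Ai n.+1) <= n.+1%:R^-1.
    by case: (o); [split; [exact: Bi_ge0|exact: Bi_le]|split; [exact: Ai_ge0|exact: Ai_le]].
  have h2 : n.+1%:R^-1 <= 1 :> R by rewrite invf_le1 ?ltr0n // ler1n.
  rewrite exprn_ge0 //=; apply: (@le_trans _ _ ((if o then Bi n.+1 else Ai n.+1) ^+ 2)).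
    by apply: ler_wiXn2l => //; exact: le_trans h1 h2.
  by rewrite lerXn2r ?nnegrE // (le_trans h0).
exists T => //.
have [a la aE] := std_repr R ((o, s.+1) :: w).
have bw := bnd_b_std R ((o, s.+1) :: w).
have nz u : 0 < u < 1 -> sn u != 0 by move=> /andP[u0 _]; rewrite gt_eqF // sn_gt0.
suff H l (q : bool) g : q = ~~ is_K1 (kind_of ((o, s.+1) :: w)) -> parity_letter q l ->
    l1 l + l2 l + l3 l + l4 l = 0 ->
    (forall u, 0 < u < 1 -> is_derive u (1 : R) g (phi l u * PS a u)) ->
    g u @[u --> 0^'+] --> (0 : R) -> g u @[u --> 1^'-] --> T -> @CMZV4 R (weight ((o, s.+2) :: w)) T%:C%C.
  case: o hT la aE bw H => hT la aE bw H.
    have [|g [gd g0 g1]] := primitive_odd bw _ hT.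
      by move=> n; rewrite (stdS R true s.+1 w) mulrA.
    apply: (H letter_tau true g _ _ _ _ g0 g1) => // u u01; have x0 := nz u u01.
    apply: (is_derive_eq (gd u u01)).
    by rewrite -(letter_ofE K1) // aE //=; field.
  have [||g [gd g0 g1]] := primitive_even bw _ _ hT.
  - exact: std_even_at0.
  - by move=> n; rewrite (stdS R false s.+1 w) mulrA.
  apply: (H letter_csc false g _ _ _ _ g0 g1) => // u u01; have x0 := nz u u01.
  apply: (is_derive_eq (gd u u01)).
  by rewrite -(letter_ofE Kcsc) // aE //=; field.
move=> qE pl l10 gd g0 g1.
have wn : l0 l = 0 \/ weight ((o, s.+1) :: w) <> 0%N by right.
have := regular_primitive la wn pl l10 gd g0 g1.
rewrite -qE addbb; apply: span_over_sub => c [r ->].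
by exists r; rewrite mulr1.
Qed.

Lemma Good_std o s w : Good (weight ((o, s.+2) :: w)) (std ((o, s.+2) :: w)).
Proof. by have [T hT cT] := std_sum o s w; exists T => //; exact: Tens_CMZV4 cT. Qed.

Lemma sigma_AB c n : series c n * (Ai n * Bi n) = series c n * Ai n - series c n * Bi n.
Proof.
case: n => [|n]; first by rewrite series0 !mul0r subrr.
rewrite -mulrBr; congr (_ * _); rewrite /Ai /Bi.
have p1 : n.+1.*2%:R != 0 :> R by rewrite pnatr_eq0.
have -> : n.+1.*2.+1%:R = n.+1.*2%:R + 1 :> R by rewrite -natr1.
have p2 : n.+1.*2%:R + 1 != 0 :> R by rewrite natr1 pnatr_eq0.
by move: (n.+1.*2%:R : R) p1 p2 => p p1 p2; field; rewrite p1 p2.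
Qed.

(** A bounded sequence gives a series of order 1 / (1 - u); 1 - sin t and csc t - 1 have a double
    zero at u = 1, which beats it. *)
Lemma onem_PS_cvg1 (a : nat -> R) (M : R) (k : R -> R) : bnd a ->
  (forall u, 1/2 < u < 1 -> `|k u| <= M * (1 - u) ^+ 2) ->
  k u * PS a u @[u --> 1^'-] --> (0 : R).
Proof.
move=> [N aN] kM.
have N0 : 0 <= N by rewrite (le_trans _ (aN 0%N)).
have ba : conv a by exact: bounded_conv aN.
have PSle u : 0 <= u < 1 -> `|PS a u| * (1 - u) <= N.
  move=> /andP[u0 u1]; have un : `|u| < 1 by rewrite ger0_norm.
  have c1 : conv (fun=> 1 : R) by apply: (@bounded_conv _ _ 1) => n; rewrite normr1.
  have h : `|PS a u| <= N * PS (fun=> 1) u.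
    have H1 : (fun n => `|pseries a u n|) @ \oo --> `|PS a u| by apply: cvg_norm; exact: PS_cvg.
    have H2 : (fun n => N * pseries (fun=> 1) u n) @ \oo --> N * PS (fun=> 1) u.
      by apply: cvgMr; exact: PS_cvg.
    apply: (ler_cvg_to H1 H2); apply: nearW => n.
    rewrite /pseries /series /= (le_trans (ler_norm_sum _ _ _)) // mulr_sumr ler_sum // => i _.
    by rewrite mul1r normrM normrX (ger0_norm u0) ler_wpM2r // exprn_ge0.
  apply: (@le_trans _ _ (N * PS (fun=> 1) u * (1 - u))).
    by rewrite ler_wpM2r // subr_ge0 ltW.
  by rewrite -mulrA [_ * (1 - u)]mulrC PS_one // mulr1.
have M0 : 0 <= M.
  have h1 : (1/2 : R) < 3/4 by lra.
  have h2 : (3/4 : R) < 1 by lra.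
  have h : 1/2 < (3/4 : R) < 1 by rewrite h1 h2.
  have := le_trans (normr_ge0 _) (kM _ h); rewrite pmulr_lge0 // exprn_gt0 //; lra.
have H : M * N * (1 - u) @[u --> 1^'-] --> (0 : R).
  by rewrite -[X in _ --> X](mulr0 (M * N)); apply: cvgMr; exact: onem_cvg1.
have H' : - (M * N * (1 - u)) @[u --> 1^'-] --> (0 : R).
  by rewrite -[X in _ --> X]oppr0; exact: cvgN.
apply: (squeeze_cvgr _ H' H); near=> u; rewrite -ler_norml.
have u1 : u < 1 by near: u; apply: nbhs_left_lt.
have u0 : 1/2 < u by near: u; apply: nbhs_left_gt; lra.
have u01 : 1/2 < u < 1 by rewrite u0.
rewrite normrM; apply: (@le_trans _ _ (M * (1 - u) ^+ 2 * `|PS a u|)).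
  by rewrite ler_wpM2r // kM.
rewrite expr2 mulrA -!mulrA ler_wpM2l // mulrC -mulrA [leRHS]mulrC.
have u00 : 0 <= u < 1 by rewrite u1 andbT; apply: ltW; apply: lt_trans u0; lra.
by rewrite ler_wpM2l ?subr_ge0 ?(ltW u1) // PSle.
Unshelve. all: by end_near. Qed.

Lemma sn_onem u : 1 - sn u = (1 - u) ^+ 2 / (1 + u ^+ 2) :> R.
Proof. by rewrite /sn; field; rewrite gt_eqF // sqr1_gt0. Qed.

Lemma sn_onem_le u : 1/2 < u < 1 -> `|1 - sn u| <= 1 * (1 - u) ^+ 2 :> R.
Proof.
move=> _; have h := sqr1_gt0 u; rewrite sn_onem ger0_norm ?divr_ge0 ?sqr_ge0 ?(ltW h) //.
by rewrite mul1r ler_pdivrMr // ler_peMr ?sqr_ge0 // lerDl sqr_ge0.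
Qed.

Lemma csc_onem_le u : 1/2 < u < 1 -> `|(sn u)^-1 - 1| <= 1 * (1 - u) ^+ 2 :> R.
Proof.
move=> /andP[u0 u1]; have h := sqr1_gt0 u; have up : 0 < u by apply: lt_trans u0; lra.
have -> : (sn u)^-1 - 1 = (1 - u) ^+ 2 / (2 * u).
  by rewrite /sn; field; rewrite !gt_eqF.
have u2 : 0 < 2 * u by rewrite mulr_gt0.
rewrite ger0_norm ?divr_ge0 ?sqr_ge0 ?(ltW u2) // mul1r ler_pdivrMr //.
by rewrite ler_peMr ?sqr_ge0 //; lra.
Qed.

(** * Two sums of total degree three that resist partial fractions *)

Section Special.
Variable w : word.
Local Notation c := (std w).
Let W u := cs u / sn u * Phi (std ((false, 0%N) :: w)) u.

Let der_W u : 0 < u < 1 -> is_derive u (1 : R) W (tau u * Phi c u).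
Proof. by move=> u01; apply: der_Phi_even => //; exact: bnd_b_std. Qed.

Let W_cvg0 : W u @[u --> 0^'+] --> (0 : R).
Proof. by apply: cot_Phi_cvg0; [exact: bnd_b_std|exact: std_even_at0]. Qed.

(** Both summation steps integrate Phi(c) against dt, so one function [W] expresses both of them. *)
Let W_odd u : 0 < u < 1 -> sn u * cs u * Phi (std ((true, 0%N) :: w)) u = W u.
Proof.
move: u; apply: eq_of_derive der_W _.
  by move=> u u01; apply: der_Phi_odd => //; exact: bnd_b_std.
rewrite -[X in _ --> X]subr0; apply: cvgB; last exact: W_cvg0.
have H : sn u * Phi (std ((true, 0%N) :: w)) u * cs u @[u --> 0^'+] --> (0 : R).
  rewrite -[X in _ --> X](mul0r (1 : R)); apply: cvgM; last exact: cs_cvg0.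
  by apply: sn_Phi_cvg0; exact: bnd_b_std.
by apply: cvg_trans H; apply: near_eq_cvg; near=> u; rewrite mulrAC.
Unshelve. all: by end_near. Qed.

Let W_cvg1 M (k : R -> R) : (forall u, 1/2 < u < 1 -> `|k u| <= M * (1 - u) ^+ 2) ->
  k u * W u @[u --> 1^'-] --> (0 : R).
Proof.
move=> kM; have [a la aE] := std_repr R w.
have ok : l0 (letter_of (kind_of w)) = 0 \/ weight w <> 0%N.
  by case: (w) => [|x w'] /=; [left|right].
have [a' la' a'E] : exists2 a', lseq (~~ is_K1 (kind_of w) (+) is_K1 (kind_of w)) (weight w).+1 a' & forall u, 0 < u < 1 -> W u = PS a' u.
  apply: (lseq_int la ok (_ : parity_letter (is_K1 (kind_of w)) _)) W_cvg0; first by case: (kind_of w).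
  move=> u u01; apply: (is_derive_eq (der_W u01)).
  by rewrite aE // mulrA letter_ofE.
apply: cvg_trans (onem_PS_cvg1 (bnd_lseq la') kM); apply: near_eq_cvg; near=> u.
rewrite a'E //; apply/andP; split; near: u; [exact: nbhs_left_gt|exact: nbhs_left_lt].
Unshelve. all: by end_near. Qed.

Let PhiB f g h u : bnd (fun n => b n * f n) -> bnd (fun n => b n * g n) ->
  (forall n, h n = f n - g n) -> 0 < u < 1 -> Phi h u = Phi f u - Phi g u.
Proof.
move=> bf bg hE u01; have y1 : `|sn u ^+ 2| < 1 by apply: sn2_lt1; case/andP: u01 => /ltW -> ->.
rewrite /Phi /PX -(PSB (bnd_conv bf) (bnd_conv bg) y1); congr (PS _ _).
by apply/funext => n; rewrite hE mulrBr.
Qed.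

Let f0 n := series c n * (Ai n * Bi n).
Let f2 n := c n * Bi n.

Let bnd_f2 : bnd (fun n => b n * f2 n).
Proof.
rewrite (_ : (fun n => b n * f2 n) = (fun n => b n * std w n * Bi n)).
  by apply: bnd_mul; [exact: bnd_b_std|move=> n; rewrite ger0_norm ?Bi_ge0 ?Bi_le1].
by apply/funext => n; rewrite /f2 mulrA.
Qed.

Let f0E n : f0 n = std ((false, 0%N) :: w) n * Bi n.
Proof. by rewrite /f0 /= expr1 mulrA. Qed.

Let bnd_f0 : bnd (fun n => b n * f0 n).
Proof.
rewrite (_ : (fun n => b n * f0 n) = (fun n => b n * std ((false, 0%N) :: w) n * Bi n)).
  by apply: bnd_mul; [exact: bnd_b_std|move=> n; rewrite ger0_norm ?Bi_ge0 ?Bi_le1].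
by apply/funext => n; rewrite f0E mulrA.
Qed.

(** Write 1/(2n(2n+1)) = 1/(2n) - 1/(2n+1), then complete the second partial sum by its term m = n;
    that term accounts for Phi(f2). *)
Let Phi_f0 u : 0 < u < 1 -> Phi f0 u = sn u / cs u * W u - (sn u * cs u)^-1 * W u + Phi f2 u.
Proof.
move=> u01.
have x0 : sn u != 0 by rewrite gt_eqF // sn_gt0 //; case/andP: u01.
have y0 : cs u != 0 by rewrite gt_eqF // cs_gt0.
have b1 := bnd_b_std R ((false, 0%N) :: w); have b2 := bnd_b_std R ((true, 0%N) :: w).
have bB : bnd (fun n => b n * (std ((true, 0%N) :: w) n - f2 n)).
  rewrite (_ : (fun n => _) = (fun n => b n * std ((false, 0%N) :: w) n - b n * f0 n)).
    move: b1 bnd_f0 => [M hM] [N hN]; exists (M + N) => n.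
    by rewrite (le_trans (ler_normB _ _)) // lerD.
  apply/funext => n; rewrite -mulrBr; congr (_ * _).
  rewrite /f0 sigma_AB /f2 /= !expr1 seriesSr; ring.
rewrite (@PhiB _ _ f0 u b1 bB) //; last first.
  by move=> n; rewrite /f0 sigma_AB /f2 /= !expr1 seriesSr; ring.
rewrite (@PhiB _ _ (fun n => std ((true, 0%N) :: w) n - f2 n) u b2 bnd_f2) //.
have -> : Phi (std ((true, 0%N) :: w)) u = (sn u * cs u)^-1 * W u.
  by rewrite -W_odd //; field; rewrite x0 y0.
by rewrite /W; field; rewrite x0 y0.
Qed.

(* If g, g' are the primitives whose values at u = 1 are the two sums, then
   g - g' - (csc t - 1) W has derivative (1 - csc t) tau Phi(c), with letters
   regular at u = 1, and (csc t - 1) W vanishes at u = 1. *)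
Lemma special_even : (if w is (false, _) :: _ then True else False) ->
  Good (weight w).+2 (fun n => c n * (Ai n * Bi n)) ->
  Good (weight w).+3 (fun n => series c n * (Ai n ^+ 2 * Bi n)).
Proof.
move=> hw [S2 hS2 tS2].
have c0 : c 0%N = 0 by case: (w) hw => [|[[|] s] w'] //= _; rewrite series0 mul0r.
have /cvg_ex[S0 hS] : cvgn (series (fun n => b n ^+ 2 * (series c n * (Ai n ^+ 2 * Bi n)))).
  apply: (@summable_std w false _ (fun n => Ai n * Bi n)).
    by move=> n /=; rewrite expr1; ring.
  move=> n; rewrite mulr_ge0 ?Ai_ge0 ?Bi_ge0 //= expr2.
  by apply: ler_pM; rewrite ?Ai_ge0 ?Bi_ge0 ?Ai_le ?Bi_le.
exists S0 => //.
have [||g [gd g0 g1]] := @primitive_even R _ f0 S0 bnd_f0 _ _ hS.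
- by rewrite /f0 series0 mul0r.
- by move=> n; rewrite /f0 -/(Ai n) expr2; ring.
have [||g' [gd' g0' g1']] := @primitive_even R _ f2 S2 bnd_f2 _ _ hS2.
- by rewrite /f2 c0 mul0r.
- by move=> n; rewrite /f2 -/(Ai n); ring.
have [a la aE] := std_repr R w.
pose h u := g u - ((sn u)^-1 - 1) * W u - g' u.
have hd u : 0 < u < 1 -> is_derive u (1 : R) h ((1 - (sn u)^-1) * tau u * Phi c u).
  move=> u01.
  have x0 : sn u != 0 by rewrite gt_eqF // sn_gt0 //; case/andP: u01.
  have y0 : cs u != 0 by rewrite gt_eqF // cs_gt0.
  have d1 := der_add (der_inv x0 (der_sn u)) (der_opp (der_cst 1 u)).
  apply: (is_derive_eq (der_add (der_add (gd u u01) (der_opp (der_mul d1 (der_W u01)))) (der_opp (gd' u u01)))).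
  rewrite Phi_f0 //; move: (W u) (Phi f2 u) (Phi c u) => X Y Z.
  apply/eqP; rewrite -subr_eq0; apply/eqP.
  transitivity (tau u * X / (sn u ^+ 2 * cs u) * (cs u ^+ 2 - (1 - sn u ^+ 2))).
    by field; rewrite x0 y0.
  by rewrite sn2cs2 subrr mulr0.
(* One more csc t is harmless: the coefficient of x^2 in the series inside [W] contains the partial
   sum c_0, which is 0 for an even word. *)
have Wx0 : (sn u)^-1 * W u @[u --> 0^'+] --> (0 : R).
  pose al n := b n * std ((false, 0%N) :: w) n.
  have cal := bnd_conv (bnd_b_std R ((false, 0%N) :: w)).
  have H : cs u * PX (al \o S) u @[u --> 0^'+] --> (0 : R).
    rewrite -[X in _ --> X](mulr0 (1 : R)); apply: cvgM; first exact: cs_cvg0.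
    have e0 : (al \o S) 0%N = 0 by rewrite /al /= seriesSr series0 c0 addr0 mul0r mulr0.
    by have := PX0 (conv_tail cal); rewrite -/al e0.
  apply: cvg_trans H; apply: near_eq_cvg; near=> u.
  have u0 : 0 < u by near: u; apply: nbhs_right_gt.
  have u1 : u < 1 by near: u; apply: nbhs_right_lt.
  have y1 : `|sn u ^+ 2| < 1 by apply: sn2_lt1; rewrite ltW.
  have x0 : sn u != 0 by rewrite gt_eqF // sn_gt0.
  by rewrite /W /Phi /PX (PSS cal y1) std_even_at0 /al; field.
have h0 : h u @[u --> 0^'+] --> (0 : R).
  rewrite [X in _ --> X](_ : _ = 0 - (0 - 0) - 0 :> R); last by ring.
  apply: cvgB; [apply: cvgB => //|exact: g0'].
  have H : (sn u)^-1 * W u - W u @[u --> 0^'+] --> (0 - 0 : R) by exact: cvgB.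
  by apply: cvg_trans H; apply: near_eq_cvg; near=> u; rewrite /= mulrBl mul1r.
have h1 : h u @[u --> 1^'-] --> S0 - S2.
  have -> : S0 - S2 = S0 - 0 - S2 by rewrite subr0.
  by apply: cvgB => //; apply: cvgB => //; apply: W_cvg1; exact: csc_onem_le.
have wn l : l0 l = 0 \/ weight w <> 0%N by right; case: (w) hw => [|x w'].
have T1 : Tens (weight w).+1 (S0 - S2)%:C%C.
  (* The form (1 - csc t) dt times the factor of [w]. For tan t the poles of tan t dt and sec t dt
     at u = 1 cancel; for 1 the two parts dt and -csc t dt have different parity and are kept
     apart. *)
  pose l := if w is (false, 0%N) :: _ then Letter 0 (-2) 4 (-2) 0 else letter_tau.
  pose l' := if w is (false, 0%N) :: _ then Letter 0 0 0 0 0 else Letter (-1) 0 0 0 0.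
  pose q := if w is (false, 0%N) :: _ then false else true.
  apply: (@regular_primitive2 _ q false _ a l l' h _ la (wn _) _ _ (wn _) _ _ _ h0 h1).
  - by rewrite /l /q; case: (w) => [|[[|] [|s]] w'].
  - by rewrite /l; case: (w) => [|[[|] [|s]] w'].
  - by rewrite /l'; case: (w) => [|[[|] [|s]] w'].
  - by rewrite /l'; case: (w) => [|[[|] [|s]] w'].
  - move=> u u01; apply: (is_derive_eq (hd u u01)); rewrite aE // -mulrDl mulrA; congr (_ * _).
    have [n0 n1 n2 n3] := param_neq0 u01.
    rewrite /l /l'; case: (w) hw => [|[[|] [|s]] w'] // _; rewrite /phi /kap /tau /sn /cs /=;
      field; by rewrite ?n0 ?n1 ?n2 ?n3.
have -> : S0 = (S0 - S2) + S2 by rewrite subrK.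
by rewrite rmorphD; apply: TensD; [apply: TensW T1; lia|apply: TensW tS2; lia].
Unshelve. all: by end_near. Qed.

(** Here the derivative left over is (sin t - 1) dt Phi(c), with correction (1 - sin t) W. The split
    by the leading entry is forced: csc t times csc t, or sin t times tan t, would produce double
    poles in u. *)
Lemma special_odd : (if w is (false, _) :: _ then False else True) ->
  Good (weight w).+2 (fun n => c n * Bi n ^+ 2) ->
  Good (weight w).+3 (fun n => series c n * (Ai n * Bi n ^+ 2)).
Proof.
move=> hw [S2 hS2 tS2].
have /cvg_ex[S hS] : cvgn (series (fun n => b n ^+ 2 * (series c n * (Ai n * Bi n ^+ 2)))).
  apply: (@summable_std w false _ (fun n => Bi n ^+ 2)).
    by move=> n /=; rewrite expr1; ring.
  by move=> n; rewrite exprn_ge0 ?Bi_ge0 //= lerXn2r ?nnegrE ?Bi_ge0 ?Bi_le // invr_ge0.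
exists S => //.
have [|g [gd g0 g1]] := @primitive_odd R _ f0 S bnd_f0 _ hS.
  by move=> n; rewrite /f0 -/(Bi n) expr2; ring.
have [|g' [gd' g0' g1']] := @primitive_odd R _ f2 S2 bnd_f2 _ hS2.
  by move=> n; rewrite /f2 -/(Bi n); ring.
have [a la aE] := std_repr R w.
pose h u := g u - (1 - sn u) * W u - g' u.
have hd u : 0 < u < 1 -> is_derive u (1 : R) h ((sn u - 1) * tau u * Phi c u).
  move=> u01.
  have x0 : sn u != 0 by rewrite gt_eqF // sn_gt0 //; case/andP: u01.
  have y0 : cs u != 0 by rewrite gt_eqF // cs_gt0.
  have d1 := der_add (der_cst 1 u) (der_opp (der_sn u)).
  apply: (is_derive_eq (der_add (der_add (gd u u01) (der_opp (der_mul d1 (der_W u01)))) (der_opp (gd' u u01)))).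
  rewrite Phi_f0 //; move: (W u) (Phi f2 u) (Phi c u) => X Y Z.
  apply/eqP; rewrite -subr_eq0; apply/eqP.
  transitivity (tau u * X / cs u * (cs u ^+ 2 - (1 - sn u ^+ 2))).
    by field; rewrite x0 y0.
  by rewrite sn2cs2 subrr mulr0.
have h0 : h u @[u --> 0^'+] --> (0 : R).
  rewrite [X in _ --> X](_ : _ = 0 - (1 - 0) * 0 - 0 :> R); last by ring.
  apply: cvgB; [apply: cvgB => //|exact: g0'].
  by apply: cvgM; [apply: cvgB; [exact: cvg_cst|exact: sn_cvg0]|exact: W_cvg0].
have h1 : h u @[u --> 1^'-] --> S - S2.
  have -> : S - S2 = S - 0 - S2 by rewrite subr0.
  by apply: cvgB => //; apply: cvgB => //; apply: W_cvg1; exact: sn_onem_le.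
have T1 : Tens (weight w).+1 (S - S2)%:C%C.
  (* For the empty word sin t dt itself has double poles at i and -i. It is integrated explicitly to
     1 - cos t, which contributes the rational number 1; what is left is -dt. *)
  have [wE|wN] := eqVneq w [::].
    have c1 u : Phi c u = 1 by rewrite wE; exact: Phi_nil.
    have hd2 u : 0 < u < 1 -> is_derive u (1 : R) (fun u => h u - (1 - cs u))
        (phi (Letter 0 (-2) 0 2 0) u * PS (delta0 R) u).
      move=> u01; have d1 := der_add (der_cst 1 u) (der_opp (der_cs u)).
      apply: (is_derive_eq (der_add (hd u u01) (der_opp d1))).
      have [n0 n1 n2 n3] := param_neq0 u01.
      by rewrite c1 PS_delta0 /phi /tau /sn /=; field; rewrite ?n0 ?n1 ?n2 ?n3.
    have h02 : h u - (1 - cs u) @[u --> 0^'+] --> (0 : R).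
      rewrite [X in _ --> X](_ : _ = 0 - (1 - 1) :> R); last by ring.
      by apply: cvgB => //; apply: cvgB; [exact: cvg_cst|exact: cs_cvg0].
    have h12 : h u - (1 - cs u) @[u --> 1^'-] --> S - S2 - (1 - 0).
      by apply: cvgB => //; apply: cvgB; [exact: cvg_cst|exact: cs_cvg1].
    have H : Tens 1 (S - S2 - (1 - 0))%:C%C.
      apply: (@Tens_span _ 1 _ _ (@Kp_Qi R _)) => //.
      by apply: (@regular_primitive _ true _ _ _ _ _ (lseq0 R) _ _ _ hd2 h02 h12) => //; left.
    have -> : S - S2 = (S - S2 - (1 - 0)) + ratr 1 by rewrite rmorph1; ring.
    rewrite rmorphD; apply: TensD; first by apply: TensW H; lia.
    by rewrite /= rc_rat; exact: Tens_rat.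
  have wn l : l0 l = 0 \/ weight w <> 0%N by right; case: (w) wN.
  have hw' : if w is (true, _) :: _ then True else False by case: (w) hw wN => [|[[|] s] w'].
  (* For csc t sec t the form is sec t dt - csc t sec t dt, whose poles at u = 1 cancel; for csc t
     it is dt - csc t dt. *)
  pose l := if w is (true, 0%N) :: _ then Letter (-1) 2 (-2) 2 (-2) else letter_tau.
  pose l' := if w is (true, 0%N) :: _ then Letter 0 0 0 0 0 else Letter (-1) 0 0 0 0.
  pose q := if w is (true, 0%N) :: _ then false else true.
  apply: (@regular_primitive2 _ q false _ a l l' h _ la (wn _) _ _ (wn _) _ _ _ h0 h1).
  - by rewrite /l /q; case: (w) => [|[[|] [|s]] w'].
  - by rewrite /l; case: (w) => [|[[|] [|s]] w'].
  - by rewrite /l'; case: (w) => [|[[|] [|s]] w'].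
  - by rewrite /l'; case: (w) => [|[[|] [|s]] w'].
  - move=> u u01; apply: (is_derive_eq (hd u u01)); rewrite aE // -mulrDl mulrA; congr (_ * _).
    have [n0 n1 n2 n3] := param_neq0 u01.
    rewrite /l /l'; case: (w) hw' => [|[[|] [|s]] w'] // _; rewrite /phi /kap /tau /sn /cs /=;
      field; by rewrite ?n0 ?n1 ?n2 ?n3.
have -> : S = (S - S2) + S2 by rewrite subrK.
by rewrite rmorphD; apply: TensD; [apply: TensW T1; lia|apply: TensW tS2; lia].
Qed.

End Special.
End Good.

(** * Reduction of all products of total degree at least three *)

Section Reduction.
Variable R : realType.
Local Notation C := R[i].
Local Notation b := (bseq R).
Local Notation Ai := (@Ai R).
Local Notation Bi := (@Bi R).
Local Notation std := (@std R).
Local Notation Good := (@Good R).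
Implicit Types (f g : nat -> R).

Definition Di (n : nat) : R := (n.*2%:R - 1)^-1.

Definition mono i j k n : R := Ai n ^+ i * Bi n ^+ j * Di n ^+ k.

Lemma GoodW W W' f : (W <= W')%N -> Good W f -> Good W' f.
Proof. by move=> WW [S hS tS]; exists S => //; exact: TensW tS. Qed.

Lemma DiS n : Di n.+1 = Bi n.
Proof. by rewrite /Di /Bi doubleS -!natr1 addrK. Qed.

Lemma odd_neq0 n : n.*2%:R - 1 != 0 :> R.
Proof. by rewrite subr_eq0 (eqr_nat R n.*2 1); case: n => // n; rewrite doubleS. Qed.

(* The relations AB = A - B, AD = D - A, BD = (D - B) / 2 fail at n = 0, where
   A is 0 by convention; the partial sums series _ 0 vanish there. *)
Lemma partial_fractions n : (0 < n)%N ->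
  [/\ Ai n * Bi n = Ai n - Bi n, Ai n * Di n = Di n - Ai n & Bi n * Di n = (Di n - Bi n) / 2].
Proof.
case: n => // n _; rewrite /Ai /Bi /Di.
have p1 : n.+1.*2%:R != 0 :> R by rewrite pnatr_eq0.
have p3 := odd_neq0 n.+1.
have -> : n.+1.*2.+1%:R = n.+1.*2%:R + 1 :> R by rewrite -natr1.
have p2 : n.+1.*2%:R + 1 != 0 :> R by rewrite natr1 pnatr_eq0.
move: (n.+1.*2%:R : R) p1 p2 p3 => p p1 p2 p3.
by split; field; rewrite ?p1 ?p2 ?p3.
Qed.

Lemma eq_sigma (c : nat -> R) (x y : R) n :
  ((0 < n)%N -> x = y) -> series c n * x = series c n * y.
Proof. by case: n => [|n] xy; [rewrite series0 !mul0r|rewrite xy]. Qed.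

Lemma sigma_mono_AB c i j k n : series c n * mono i.+1 j.+1 k n =
  series c n * mono i.+1 j k n - series c n * mono i j.+1 k n.
Proof.
rewrite -mulrBr; apply: eq_sigma => n0; have [h _ _] := partial_fractions n0.
transitivity (Ai n * Bi n * mono i j k n); first by rewrite /mono !exprS; ring.
by rewrite h /mono !exprS; ring.
Qed.

Lemma sigma_mono_AD c i j k n : series c n * mono i.+1 j k.+1 n =
  series c n * mono i j k.+1 n - series c n * mono i.+1 j k n.
Proof.
rewrite -mulrBr; apply: eq_sigma => n0; have [_ h _] := partial_fractions n0.
transitivity (Ai n * Di n * mono i j k n); first by rewrite /mono !exprS; ring.
by rewrite h /mono !exprS; ring.
Qed.

Lemma ratr_half : ratr (1 / 2) = 1 / 2 :> R.
Proof. by rewrite fmorph_div rmorph1 rmorph_nat. Qed.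

Lemma sigma_mono_BD c i j k n : series c n * mono i j.+1 k.+1 n =
  ratr (1 / 2) * (series c n * mono i j k.+1 n - series c n * mono i j.+1 k n).
Proof.
rewrite ratr_half -mulrBr [RHS]mulrCA; apply: eq_sigma => n0; have [_ _ h] := partial_fractions n0.
transitivity (Bi n * Di n * mono i j k n); first by rewrite /mono !exprS; ring.
by rewrite h /mono !exprS; field.
Qed.

(** The subtraction is truncated: shifting b_n^2 costs two weights for a pure power of [Di], and
    each factor [Ai] or [Bi] saves one. *)
Definition sigma_good w := forall i j k, (3 <= i + j + k)%N ->
  Good (weight w + (i + j + k) + (2 - (i + j)))%N (fun n => series (std w) n * mono i j k n).

(** The companion without the outer partial sum, which appears whenever sums over m <= n and over m
    < n are exchanged. Degree two suffices, since [std w] supplies a further factor or is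
    concentrated at 0. *)
Definition term_good w := forall i j, (2 <= i + j)%N ->
  Good (weight w + (i + j))%N (fun n => std w n * mono i j 0 n).

Lemma term_good_nil : term_good [::].
Proof.
move=> i j _; have := @Good_delta0 R (i + j)%N ((i == 0%N)%:R); apply: Good_ext => -[|n] /=; last first.
  by rewrite /delta0 mulr0 mul0r.
rewrite rmorph_nat mulrC /mono Ai0 Bi0 expr1n expr0 !mulr1 expr0n.
by [].
Qed.

Lemma term_good_cons o s w : sigma_good w -> term_good w -> term_good ((o, s) :: w).
Proof.
move=> sg tg i j ij; case: o.
  have h1 := sg i (j + s.+1)%N 0%N; have h2 := tg i (j + s.+1)%N.
  have {}h1 := GoodW _ (h1 _); have {}h2 := GoodW _ (h2 _).
  apply: (@Good_ext _ _ (fun n => series (std w) n * mono i (j + s.+1) 0 n + std w n * mono i (j + s.+1) 0 n)).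
    by move=> n; rewrite -mulrDl -seriesSr /mono /= exprD; ring.
  by apply: GoodD; [apply: h1|apply: h2]; rewrite /weight /=; lia.
have h1 := sg (i + s.+1)%N j 0%N; have {}h1 := GoodW _ (h1 _).
apply: (@Good_ext _ _ (fun n => series (std w) n * mono (i + s.+1) j 0 n)).
  by move=> n; rewrite /mono /= exprD; ring.
by apply: h1; rewrite /weight /=; lia.
Qed.

Section Step.
Variable w : word.
Hypothesis tg : term_good w.
Local Notation sigma := (series (std w)).
Local Notation wt := (weight w).

Let gA t : Good (wt + t.+3)%N (fun n => sigma n * Ai n ^+ t.+3).
Proof. by apply: GoodW (Good_std R false t w); rewrite /weight /=; lia. Qed.

Let gB' t : Good (wt + t.+3)%N (fun n => sigma n.+1 * Bi n ^+ t.+3).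
Proof. by apply: GoodW (Good_std R true t w); rewrite /weight /=; lia. Qed.

Let gB t : Good (wt + t.+3)%N (fun n => sigma n * Bi n ^+ t.+3).
Proof.
have := GoodB (gB' t) (tg (i := 0%N) (j := t.+3) isT); apply: Good_ext => n.
by rewrite seriesSr /mono expr0 !(mul1r, mulr1); ring.
Qed.

(** The shift turns [Di] into [Bi] and brings the square of (2n+2) [Bi n] = 1 + [Bi n]. Each shifted
    [Ai] cancels one 2n+2, so the excess weight is 2 for D^3, 1 for A D^2 and 0 for A^2 D. *)
Let gshift W f h : (forall n, (n.+1.*2%:R * Bi n) ^+ 2 * f n.+1 = h n) ->
  Good W (fun n => sigma n.+1 * h n) -> Good W (fun n => sigma n * f n).
Proof.
move=> fh; apply: Good_shift; first by rewrite series0 mul0r.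
by move=> n; rewrite -fh mulrCA.
Qed.

Let nB n : n.+1.*2%:R * Bi n = 1 + Bi n.
Proof.
have p1 : n.*2.+1%:R != 0 :> R by rewrite pnatr_eq0.
rewrite doubleS -natr1 /Bi; move: (n.*2.+1%:R : R) p1 => p p1; by field.
Qed.

Let nA n : n.+1.*2%:R * Ai n.+1 = 1.
Proof. by rewrite /Ai mulfV // pnatr_eq0. Qed.

Let gA2D : Good (wt + 3)%N (fun n => sigma n * (Ai n ^+ 2 * Di n)).
Proof.
apply: gshift (gB' 0) => n; rewrite DiS.
transitivity ((n.+1.*2%:R * Ai n.+1) ^+ 2 * Bi n ^+ 3); first by ring.
by rewrite nA expr1n mul1r.
Qed.

Let gAD2 : Good (wt + 4)%N (fun n => sigma n * (Ai n * Di n ^+ 2)).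
Proof.
apply: (gshift (h := fun n => Bi n ^+ 3 + Bi n ^+ 4)) => [n|].
  rewrite DiS.
  transitivity ((n.+1.*2%:R * Ai n.+1) * (n.+1.*2%:R * Bi n) * Bi n ^+ 3); first by ring.
  by rewrite nA nB; ring.
apply: (@Good_ext _ _ (fun n => sigma n.+1 * Bi n ^+ 3 + sigma n.+1 * Bi n ^+ 4)).
  by move=> n; rewrite mulrDr.
by apply: GoodD; [apply: GoodW (gB' 0); lia|exact: (gB' 1)].
Qed.

Let gD t : Good (wt + t.+3 + 2)%N (fun n => sigma n * Di n ^+ t.+3).
Proof.
apply: (gshift (h := fun n => Bi n ^+ t.+3 + ratr 2 * Bi n ^+ t.+4 + Bi n ^+ t.+2.+3)) => [n|].
  rewrite DiS nB rmorph_nat (exprS _ t.+3) (_ : Bi n ^+ t.+2.+3 = Bi n ^+ 2 * Bi n ^+ t.+3); last by rewrite -exprD.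
  by move: (Bi n ^+ t.+3) => y; ring.
apply: (@Good_ext _ _ (fun n => sigma n.+1 * Bi n ^+ t.+3 + ratr 2 * (sigma n.+1 * Bi n ^+ t.+4)
    + sigma n.+1 * Bi n ^+ t.+2.+3)).
  by move=> n; ring.
apply: GoodD; last by apply: GoodW (gB' t.+2); lia.
by apply: GoodD; [apply: GoodW (gB' t); lia|apply: GoodZ; apply: GoodW (gB' t.+1); lia].
Qed.

(* Abel summation: b_n^2 (A_n^2 - B_n^2) = p_n - p_(n+1) for p_n = b_n^2 A_n^2. *)
Let gdiff : Good (wt + 2)%N (fun n => sigma n * (Ai n ^+ 2 - Bi n ^+ 2)).
Proof.
have [S hS tS] := tg (i := 0%N) (j := 2%N) isT; exists S => //.
pose p n := b n ^+ 2 * Ai n ^+ 2.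
have pS n : p n.+1 = b n ^+ 2 * Bi n ^+ 2.
  rewrite /p bS_div -[b n * _ / _]mulrA -/(Bi n).
  transitivity (b n ^+ 2 * Bi n ^+ 2 * (n.+1.*2%:R * Ai n.+1) ^+ 2); first by ring.
  by rewrite nA expr1n mulr1.
have E N : series (fun n => b n ^+ 2 * (sigma n * (Ai n ^+ 2 - Bi n ^+ 2))) N =
    series (fun n => b n ^+ 2 * (std w n * mono 0 2 0 n)) N - sigma N * p N.
  elim: N => [|N IH]; first by rewrite !series0 mul0r subr0.
  rewrite seriesSr IH [in RHS]seriesSr (seriesSr (std w)) pS /mono /p; ring.
have -> : series (fun n => b n ^+ 2 * (sigma n * (Ai n ^+ 2 - Bi n ^+ 2))) =
    (fun N => series (fun n => b n ^+ 2 * (std w n * mono 0 2 0 n)) N - sigma N * p N).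
  exact/funext.
rewrite -[X in _ --> X]subr0; apply: cvgB => //.
have H : 4 * (b n)^-1 @[n --> \oo] --> (0 : R).
  by rewrite -[X in _ --> X](mulr0 (4 : R)); apply: cvgMr; exact: invb_cvg0.
have H0 : (fun=> 0 : R) @ \oo --> (0 : R) by exact: cvg_cst.
apply: (squeeze_cvgr _ H0 H); apply: nearW => -[|n].
  by rewrite series0 mul0r lexx b0 invr1 mulr1 ler0n.
have /andP[s0 s1] := std_bounds R ((false, 0%N) :: w) n.+1; rewrite /= expr1 in s0 s1.
have bn := b_gt0 R n.+1; have A0 := Ai_ge0 R n.+1; have B2 := b_sqr_le R n.+1.
have -> : sigma n.+1 * p n.+1 = sigma n.+1 * Ai n.+1 * (b n.+1 ^+ 2 * Ai n.+1) by rewrite /p; ring.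
apply/andP; split; first by rewrite mulr_ge0 // mulr_ge0 // sqr_ge0.
rewrite [leRHS]mulrC; apply: ler_pM => //.
  by rewrite mulr_ge0 // sqr_ge0.
apply: (@le_trans _ _ (4 * n.+2%:R * Ai n.+1)); first by rewrite ler_wpM2r.
rewrite -mulrA ler_piMr // /Ai ler_pdivrMr ?ltr0n // mul1r ler_nat; lia.
Qed.

(** By AB = A - B the two products add up to A^2 - B^2, settled by Abel summation. One of them is
    integrated directly, chosen by the leading entry of [w], and the other follows. *)
Let gA2B_AB2 : Good (wt + 3)%N (fun n => sigma n * (Ai n ^+ 2 * Bi n)) /\
  Good (wt + 3)%N (fun n => sigma n * (Ai n * Bi n ^+ 2)).
Proof.
have gd := GoodW (leqnSn _) gdiff.
have rel n : sigma n * (Ai n ^+ 2 * Bi n) + sigma n * (Ai n * Bi n ^+ 2) = sigma n * (Ai n ^+ 2 - Bi n ^+ 2).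
  rewrite -mulrDr; apply: eq_sigma => n0; have [h _ _] := partial_fractions n0.
  transitivity (Ai n * Bi n * (Ai n + Bi n)); [by ring|by rewrite h; ring].
have [hw|hw] : (if w is (false, _) :: _ then True else False) \/ (if w is (false, _) :: _ then False else True).
- by case: (w) => [|[[|] s] w']; [right|right|left].
- have h : Good (wt + 3)%N (fun n => sigma n * (Ai n ^+ 2 * Bi n)).
    apply: (GoodW _ (special_even hw _)); first by lia.
    apply: (GoodW _ (Good_ext _ (tg (i := 1%N) (j := 1%N) isT))); first by lia.
    by move=> n; rewrite /mono !expr1 expr0 mulr1.
  split=> //; have {}gd : Good (wt + 3)%N (fun n => sigma n * (Ai n ^+ 2 - Bi n ^+ 2)) by apply: GoodW gd; lia.
  apply: (Good_ext _ (GoodB gd h)) => n.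
  by rewrite -rel addrC addKr.
have h : Good (wt + 3)%N (fun n => sigma n * (Ai n * Bi n ^+ 2)).
  apply: (GoodW _ (special_odd hw _)); first by lia.
  apply: (GoodW _ (Good_ext _ (tg (i := 0%N) (j := 2%N) isT))); first by lia.
  by move=> n; rewrite /mono expr0 mul1r mulr1.
split=> //; have {}gd : Good (wt + 3)%N (fun n => sigma n * (Ai n ^+ 2 - Bi n ^+ 2)) by apply: GoodW gd; lia.
apply: (Good_ext _ (GoodB gd h)) => n.
by rewrite -rel addrK.
Qed.

(** Dividing 2 (2n) = (2n-1) + (2n+1) by suitable products gives 2ABD = A^2 B + A^2 D, and for the
    next two sums 2B^2 D = A B^2 + ABD and 2B D^2 = ABD + A D^2. All terms keep degree three, hence
    converge. *)
Let gABD : Good (wt + 3)%N (fun n => sigma n * (Ai n * Bi n * Di n)).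
Proof.
have [h1 _] := gA2B_AB2.
have := GoodZ (1 / 2) (GoodD gA2D h1); apply: Good_ext => n.
have -> : ratr (1 / 2) = 1 / 2 :> R by rewrite fmorph_div rmorph1 rmorph_nat.
rewrite -mulrDr mulrCA; apply: eq_sigma => n0; have [h _ h'] := partial_fractions n0.
rewrite -[Ai n * Bi n * Di n]mulrA h'.
transitivity ((Ai n * (Ai n * Di n) + Ai n * (Ai n * Bi n)) / 2); first by field.
by have [-> -> _] := partial_fractions n0; field.
Qed.

Let gB2D : Good (wt + 3)%N (fun n => sigma n * (Bi n ^+ 2 * Di n)).
Proof.
have [_ h1] := gA2B_AB2.
have := GoodZ (1 / 2) (GoodD gABD h1); apply: Good_ext => n.
have -> : ratr (1 / 2) = 1 / 2 :> R by rewrite fmorph_div rmorph1 rmorph_nat.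
rewrite -mulrDr mulrCA; apply: eq_sigma => n0; have [hab _ hbd] := partial_fractions n0.
transitivity (((Ai n * Bi n) * Di n + (Ai n * Bi n) * Bi n) / 2); first by field.
rewrite hab.
transitivity ((Ai n * Di n - Bi n * Di n + Ai n * Bi n - Bi n ^+ 2) / 2); first by field.
rewrite expr2 -[Bi n * Bi n * Di n]mulrA hbd.
have [-> -> _] := partial_fractions n0; rewrite mulrA mulrBr hbd; by field.
Qed.

Let gBD2 : Good (wt + 4)%N (fun n => sigma n * (Bi n * Di n ^+ 2)).
Proof.
have g1 : Good (wt + 4)%N (fun n => sigma n * (Ai n * Bi n * Di n)) by apply: GoodW gABD; lia.
have := GoodZ (1 / 2) (GoodD gAD2 g1); apply: Good_ext => n.
have -> : ratr (1 / 2) = 1 / 2 :> R by rewrite fmorph_div rmorph1 rmorph_nat.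
rewrite -mulrDr mulrCA; apply: eq_sigma => n0; have [hab had hbd] := partial_fractions n0.
transitivity ((Ai n * Di n * Di n + Ai n * Bi n * Di n) / 2); first by field.
rewrite had hab; transitivity ((Di n ^+ 2 - Bi n * Di n) / 2); first by field.
rewrite expr2 [Bi n * (_ * _)]mulrA hbd; transitivity ((Di n ^+ 2 - Bi n * Di n) / 2); last by field.
by rewrite expr2 hbd.
Qed.

Lemma sigma_good_step : sigma_good w.
Proof.
move=> i j k; have [t] := ubnP (i + j + k)%N; elim: t i j k => // t IH i j k it t3.
pose G i j k := Good (wt + (i + j + k) + (2 - (i + j)))%N (fun n => sigma n * mono i j k n).
rewrite -/(G i j k).
have ext i' j' k' W f : Good W f -> (W <= wt + (i' + j' + k') + (2 - (i' + j')))%N ->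
    (forall n, f n = sigma n * mono i' j' k' n) -> G i' j' k'.
  by move=> g0 W0 e0; apply: GoodW W0 (Good_ext e0 g0).
(* From degree four on, a partial fraction lowers the degree by one and stays in the convergent
   range. *)
have [t4|t4] := leqP 4 (i + j + k); last first.
  have [h1 h2] := gA2B_AB2.
  have : (i + j + k = 3)%N by lia.
  (* The ten monomials of degree three, in lexicographic order of exponents. *)
  move=> {it t3 t4}; move: i j k => [|[|[|[|i]]]] [|[|[|[|j]]]] [|[|[|[|k]]]] // _;
  [ apply: (ext _ _ _ _ _ (gD 0)) | apply: (ext _ _ _ _ _ gBD2) | apply: (ext _ _ _ _ _ gB2D)
  | apply: (ext _ _ _ _ _ (gB 0)) | apply: (ext _ _ _ _ _ gAD2) | apply: (ext _ _ _ _ _ gABD)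
  | apply: (ext _ _ _ _ _ h2) | apply: (ext _ _ _ _ _ gA2D) | apply: (ext _ _ _ _ _ h1)
  | apply: (ext _ _ _ _ _ (gA 0))]; try lia; move=> n; rewrite /mono; ring.
case: i it t3 t4 => [|i] it t3 t4.
  case: j it t3 t4 => [|j] it t3 t4.
    case: k it t3 t4 => [|[|[|k]]] // it t3 t4.
    apply: (ext _ _ _ _ _ (gD k)); first lia.
    by move=> n; rewrite /mono; ring.
  case: k it t3 t4 => [|k] it t3 t4.
    case: j it t3 t4 => [|[|j]] // it t3 t4.
    apply: (ext _ _ _ _ _ (gB j)); first lia.
    by move=> n; rewrite /mono; ring.
  have h1 := IH 0%N j k.+1 ltac:(lia) ltac:(lia); have h2 := IH 0%N j.+1 k ltac:(lia) ltac:(lia).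
  have {}h1 := GoodZ (1 / 2) (GoodB (GoodW _ h1) (GoodW _ h2)).
  by rewrite /G; apply: (Good_ext _ (h1 _ _ _)); first [by move=> n; rewrite sigma_mono_BD|lia].
case: j it t3 t4 => [|j] it t3 t4.
  case: k it t3 t4 => [|k] it t3 t4.
    case: i it t3 t4 => [|[|i]] // it t3 t4.
    apply: (ext _ _ _ _ _ (gA i)); first lia.
    by move=> n; rewrite /mono; ring.
  have h1 := IH i 0%N k.+1 ltac:(lia) ltac:(lia); have h2 := IH i.+1 0%N k ltac:(lia) ltac:(lia).
  have {}h1 := GoodB (GoodW _ h1) (GoodW _ h2).
  by rewrite /G; apply: (Good_ext _ (h1 _ _ _)); first [by move=> n; rewrite sigma_mono_AD|lia].
have h1 := IH i.+1 j k ltac:(lia) ltac:(lia); have h2 := IH i j.+1 k ltac:(lia) ltac:(lia).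
have {}h1 := GoodB (GoodW _ h1) (GoodW _ h2).
by rewrite /G; apply: (Good_ext _ (h1 _ _ _)); first [by move=> n; rewrite sigma_mono_AB|lia].
Qed.

End Step.

Lemma std_good w : sigma_good w /\ term_good w.
Proof.
elim: w => [|x w [sg tg]]; last case: x => o s.
  have tg := term_good_nil; split=> //; exact: sigma_good_step.
have tg' := term_good_cons o s sg tg; split=> //; exact: sigma_good_step.
Qed.

End Reduction.

(** * Inner sums for arbitrary relations between the indices *)

Section Chains.
Variable R : realType.
Local Notation C := R[i].
Local Notation b := (bseq R).
Local Notation Ai := (@Ai R).
Local Notation Bi := (@Bi R).
Local Notation Di := (@Di R).
Local Notation mono := (@mono R).
Local Notation std := (@std R).
Local Notation Good := (@Good R).
Local Notation delta0 := (@delta0 R).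

Definition Xi (l : lform) (n : nat) : R := (lval l n)%:~R^-1.

Lemma XiE l : Xi l = match l with L2m => Ai | L2m_plus1 => Bi | L2m_minus1 => Di end.
Proof.
have E n : (2 * n%:Z)%:~R = n.*2%:R :> R by rewrite -mul2n intrM natrM.
apply/funext => n; rewrite /Xi; case: l; rewrite /= /Ai /Bi /Di ?rmorphB ?rmorphD /= E //.
by rewrite natr1.
Qed.

Definition deg (l : lform) : nat * nat * nat :=
  match l with L2m => (1, 0, 0) | L2m_plus1 => (0, 1, 0) | L2m_minus1 => (0, 0, 1) end%N.

Lemma mono_Xi l e i j k n : mono i j k n * Xi l n ^+ e =
  mono (i + (deg l).1.1 * e) (j + (deg l).1.2 * e) (k + (deg l).2 * e) n.
Proof.
by rewrite XiE /mono; case: l; rewrite /= !(mul0n, mul1n, addn0) exprD; ring.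
Qed.

(** The value at n = 0 of a positive power: 0 for 2m by the convention 0^-1 = 0, and a power of -1
    for 2m - 1. *)
Definition Xi0_pow (l : lform) e : rat :=
  match l with L2m => 0 | L2m_plus1 => 1 | L2m_minus1 => (-1) ^+ e end.

Lemma Xi0E l e : Xi l 0 ^+ e.+1 = ratr (Xi0_pow l e.+1).
Proof.
rewrite XiE; case: l; rewrite /Xi0_pow; first by rewrite Ai0 exprS mul0r rmorph0.
  by rewrite Bi0 expr1n rmorph1.
by rewrite /Di sub0r invrN1 rmorphXn /= rmorphN1.
Qed.

(* Filtered Q-span, stable under multiplication by the X_l and under the
   partial summation of any multiple of X_l. *)
Inductive tail_class (W : nat) : (nat -> R) -> Prop :=
| tail_delta0 : tail_class W delta0
| tail_sigma w i j k : (weight w + (i + j + k) <= W)%N ->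
    tail_class W (fun n => series (std w) n * mono i j k n)
| tail_add f g : tail_class W f -> tail_class W g -> tail_class W (fun n => f n + g n)
| tail_scale (q : rat) f : tail_class W f -> tail_class W (fun n => ratr q * f n).

Lemma tail_ext W f g : (forall n, f n = g n) -> tail_class W f -> tail_class W g.
Proof. by move=> /funext ->. Qed.

Lemma tail_mono W W' f : (W <= W')%N -> tail_class W f -> tail_class W' f.
Proof.
move=> WW; elim=> [|w i j k h|g h _ ? _ ?|q g _ ?]; first exact: tail_delta0.
- by apply: tail_sigma; exact: leq_trans h WW.
- exact: tail_add.
- exact: tail_scale.
Qed.

Lemma tail_sub W f g : tail_class W f -> tail_class W g -> tail_class W (fun n => f n - g n).
Proof.
move=> hf hg; apply: tail_ext (tail_add hf (tail_scale (-1) hg)) => n.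
by rewrite rmorphN1 mulN1r.
Qed.

Lemma delta0_Xi l e n : delta0 n * Xi l n ^+ e.+1 = ratr (Xi0_pow l e.+1) * delta0 n.
Proof. by case: n => [|n]; rewrite /delta0 ?mul0r ?mulr0 // mul1r mulr1 Xi0E. Qed.

Lemma tail_mul W f l e : tail_class W f -> tail_class (W + e) (fun n => f n * Xi l n ^+ e).
Proof.
elim=> [|w i j k h|g h _ h1 _ h2|q g _ h].
- case: e => [|e]; first by apply: tail_ext (tail_delta0 _) => n; rewrite mulr1.
  by apply: tail_ext (tail_scale _ (tail_delta0 _)) => n; rewrite delta0_Xi.
- apply: (tail_ext (f := fun n => series (std w) n *
     mono (i + (deg l).1.1 * e) (j + (deg l).1.2 * e) (k + (deg l).2 * e) n)).
    by move=> n; rewrite -mono_Xi mulrA.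
  by apply: tail_sigma; move: h; case: l => /=; rewrite !(mul0n, mul1n); lia.
- by apply: tail_ext (tail_add h1 h2) => n; rewrite mulrDl.
- by apply: tail_ext (tail_scale q h) => n; rewrite mulrA.
Qed.

Lemma series_add (f g : nat -> R) N : series (fun n => f n + g n) N = series f N + series g N.
Proof. by rewrite /series /= big_split. Qed.

Lemma series_scale (x : R) (f : nat -> R) N : series (fun n => x * f n) N = x * series f N.
Proof. by rewrite /series /= mulr_sumr. Qed.

Lemma series_sub (f g : nat -> R) N : series (fun n => f n - g n) N = series f N - series g N.
Proof. by rewrite /series /= sumrB. Qed.

Lemma tail_std w : tail_class (weight w) (series (std w)).
Proof.
have h : (weight w + (0 + 0 + 0) <= weight w)%N by rewrite !addn0.
by apply: tail_ext (tail_sigma h) => n; rewrite /mono !expr0 !mulr1.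
Qed.

(** The counterpart of [sigma_good] for partial sums without b_n^2. Convergence is no issue, so
    degree one is enough, and shifting costs no weight. *)
Definition sigma_tail w := forall i j k, (1 <= i + j + k)%N ->
  tail_class (weight w + (i + j + k)) (series (fun n => series (std w) n * mono i j k n)).

Definition term_tail w := forall i j, (1 <= i + j)%N ->
  tail_class (weight w + (i + j)) (series (fun n => std w n * mono i j 0 n)).

Lemma term_tail_nil : term_tail [::].
Proof.
move=> i j _; have h : (weight [::] <= weight [::] + (i + j))%N by [].
apply: tail_ext (tail_scale ((i == 0%N)%:R) (tail_mono h (tail_std [::]))) => n.
rewrite -series_scale; congr (series _ n); apply/funext => -[|m] /=; last first.
  by rewrite /delta0 mulr0 mul0r.
by rewrite rmorph_nat mulrC /mono Ai0 Bi0 expr1n expr0 !mulr1 expr0n.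
Qed.

Lemma term_tail_cons o s w : sigma_tail w -> term_tail w -> term_tail ((o, s) :: w).
Proof.
move=> sg tg i j ij; case: o.
  have h1 := sg i (j + s.+1)%N 0%N; have h2 := tg i (j + s.+1)%N.
  have {}h1 := tail_mono _ (h1 _); have {}h2 := tail_mono _ (h2 _).
  apply: (tail_ext _ (tail_add (h1 _ _ _) (h2 _ _ _))); try by rewrite /weight /=; lia.
  move=> N; rewrite -series_add; congr (series _ N); apply/funext => n.
  by rewrite -mulrDl -seriesSr /mono /= exprD; ring.
have h1 := sg (i + s.+1)%N j 0%N; have {}h1 := tail_mono _ (h1 _).
apply: (tail_ext _ (h1 _ _ _)); try by rewrite /weight /=; lia.
move=> N; congr (series _ N); apply/funext => n.
by rewrite /mono /= exprD; ring.
Qed.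

Lemma sigma_tail_step w : term_tail w -> sigma_tail w.
Proof.
move=> tg i j k; have [t] := ubnP (i + j + k)%N; elim: t i j k => // t IH i j k it t1.
have up f W W' : tail_class W f -> (W <= W')%N -> tail_class W' f by move=> h WW; exact: tail_mono WW h.
have two f g h W : (forall n, h n = f n - g n) -> tail_class W (series f) -> tail_class W (series g) ->
    tail_class W (series h).
  move=> E hf hg; apply: tail_ext (tail_sub hf hg) => N.
  by rewrite -series_sub; congr (series _ N); apply/funext => n; rewrite E.
have std_head o s : tail_class (weight w + s.+1) (series (std ((o, s) :: w))).
  by apply: tail_mono (tail_std _); rewrite /weight /=; lia.
case: i it t1 => [|i] it t1.
  case: j it t1 => [|j] it t1.
    case: k it t1 => // k it t1.
    have h : (weight w + (0 + 0 + k.+1) <= weight w + k.+1)%N by [].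
    (* As [Di] at n + 1 is [Bi n], the sum below N is that of [std] for (true, k) :: w below N - 1.
       The term missing up to N equals the partial sum at N times a power of [Di N], again in the
       class. *)
    apply: tail_ext (tail_sub (std_head true k) (tail_sigma h)) => -[|N].
      by rewrite !series0 mul0r subr0.
    have -> : series (fun n => series (std w) n * mono 0 0 k.+1 n) N.+1 = series (std ((true, k) :: w)) N.
      rewrite {1}/series /= big_nat_recl // series0 mul0r add0r /series /=; apply: eq_bigr => n _.
      by rewrite /mono !expr0 !mul1r DiS.
    by rewrite [X in X - _]seriesSr /mono !expr0 !mul1r DiS addrK.
  case: k it t1 => [|k] it t1; last first.
    have [h1 h2] := (IH 0%N j k.+1 ltac:(lia) ltac:(lia), IH 0%N j.+1 k ltac:(lia) ltac:(lia)).
    have {}h1 := up _ _ (weight w + (0 + j.+1 + k.+1))%N h1 ltac:(lia).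
    have {}h2 := up _ _ (weight w + (0 + j.+1 + k.+1))%N h2 ltac:(lia).
    apply: tail_ext (tail_scale (1 / 2) (tail_sub h1 h2)) => N.
    rewrite -series_sub -series_scale; congr (series _ N); apply/funext => n.
    by rewrite sigma_mono_BD.
  have h : (1 <= 0 + j.+1)%N by [].
  have E1 : (weight w + (0 + j.+1 + 0) = weight w + j.+1)%N by lia.
  rewrite E1; apply: two (std_head true j) (tg _ _ h) => n.
  by rewrite /= seriesSr /mono !expr0 !(mul1r, mulr1); ring.
case: j it t1 => [|j] it t1; last first.
  have [h1 h2] := (IH i.+1 j k ltac:(lia) ltac:(lia), IH i j.+1 k ltac:(lia) ltac:(lia)).
  have {}h1 := up _ _ (weight w + (i.+1 + j.+1 + k))%N h1 ltac:(lia).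
  have {}h2 := up _ _ (weight w + (i.+1 + j.+1 + k))%N h2 ltac:(lia).
  by apply: two h1 h2 => n; rewrite sigma_mono_AB.
case: k it t1 => [|k] it t1; last first.
  have [h1 h2] := (IH i 0%N k.+1 ltac:(lia) ltac:(lia), IH i.+1 0%N k ltac:(lia) ltac:(lia)).
  have {}h1 := up _ _ (weight w + (i.+1 + 0 + k.+1))%N h1 ltac:(lia).
  have {}h2 := up _ _ (weight w + (i.+1 + 0 + k.+1))%N h2 ltac:(lia).
  by apply: two h1 h2 => n; rewrite sigma_mono_AD.
have E1 : (weight w + (i.+1 + 0 + 0) = weight w + i.+1)%N by lia.
rewrite E1; apply: tail_ext (std_head false i) => N; congr (series _ N); apply/funext => n /=.
by rewrite /mono !expr0 !mulr1.
Qed.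

Lemma std_tail w : sigma_tail w.
Proof.
suff [] : sigma_tail w /\ term_tail w by [].
elim: w => [|x w [sg tg]]; last case: x => o s.
  have tg := term_tail_nil; split=> //; exact: sigma_tail_step.
have tg' := term_tail_cons o s sg tg; split=> //; exact: sigma_tail_step.
Qed.

Lemma tail_series W f l e : tail_class W f ->
  tail_class (W + e.+1) (series (fun n => f n * Xi l n ^+ e.+1)).
Proof.
elim=> [|w i j k h|g h _ h1 _ h2|q g _ h].
- have h : (weight [::] <= W + e.+1)%N by [].
  apply: tail_ext (tail_scale (Xi0_pow l e.+1) (tail_mono h (tail_std [::]))) => N.
  rewrite -series_scale; congr (series _ N); apply/funext => n.
  by rewrite delta0_Xi.
- apply: (tail_ext (f := series (fun n => series (std w) n *
     mono (i + (deg l).1.1 * e.+1) (j + (deg l).1.2 * e.+1) (k + (deg l).2 * e.+1) n))).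
    by move=> N; congr (series _ N); apply/funext => n; rewrite -mono_Xi mulrA.
  have := @std_tail w (i + (deg l).1.1 * e.+1)%N (j + (deg l).1.2 * e.+1)%N (k + (deg l).2 * e.+1)%N.
  by move=> H; apply: tail_mono (H _); move: h; case: (l) => /=; lia.
- apply: tail_ext (tail_add h1 h2) => N; rewrite -series_add; congr (series _ N); apply/funext => n.
  by rewrite mulrDl.
- apply: tail_ext (tail_scale q h) => N; rewrite -series_scale; congr (series _ N); apply/funext => n.
  by rewrite mulrA.
Qed.

(** The leading exponent, at least three, brings every product into the range of [sigma_good]. If
    the leading form is 2m or 2m+1, its exponent alone cancels the excess weight; otherwise the
    excess is at most 2. *)
Lemma tail_good W f l e : tail_class W f ->
  Good (W + e.+3 + 2 * nu l) (fun n => f n * Xi l n ^+ e.+3).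
Proof.
elim=> [|w i j k h|g h _ h1 _ h2|q g _ h].
- by apply: Good_ext (Good_delta0 R _ _) => n; rewrite [RHS]delta0_Xi.
- apply: (@Good_ext _ _ (fun n => series (std w) n *
     mono (i + (deg l).1.1 * e.+3) (j + (deg l).1.2 * e.+3) (k + (deg l).2 * e.+3) n)).
    by move=> n; rewrite -mono_Xi mulrA.
  have [H _] := std_good R w.
  have {}H := H (i + (deg l).1.1 * e.+3)%N (j + (deg l).1.2 * e.+3)%N (k + (deg l).2 * e.+3)%N.
  by apply: GoodW (H _); move: h; case: (l) => /=; lia.
- by apply: Good_ext (GoodD h1 h2) => n; rewrite mulrDl.
- by apply: Good_ext (GoodZ q h) => n; rewrite mulrA.
Qed.

Lemma tail_upto W f (strict : bool) : tail_class W f -> tail_class W (series f) ->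
  tail_class W (fun m => series f (m + ~~ strict)%N).
Proof.
move=> hf hsf; case: strict; first by apply: tail_ext hsf => m; rewrite addn0.
by apply: tail_ext (tail_add hsf hf) => m; rewrite addn1 seriesSr.
Qed.

Definition chain_term p (l : 'I_p -> lform) (s : 'I_p -> nat) (j : 'I_p) n := Xi (l j) n ^+ s j.

Lemma tail_nest p st (l : 'I_p -> lform) s : (forall j, (0 < s j)%N) ->
  tail_class (\sum_j s j) (nest st (chain_term l s)) /\
  tail_class (\sum_j s j) (series (nest st (chain_term l s))).
Proof.
elim: p st l s => [|p IH] st l s s0.
  rewrite big_ord0; split; first exact: tail_delta0.
  exact: (tail_std [::]).
rewrite big_ord_recl addnC.
set W := (\sum_(i < p) s (lift ord0 i))%N.
set f := nest (st \o lift ord0) (chain_term (l \o lift ord0) (s \o lift ord0)).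
have [hf hsf] : tail_class W f /\ tail_class W (series f) by apply: IH => j; exact: s0.
have hV := tail_upto (st ord0) hf hsf.
have E : nest st (chain_term l s) = (fun m => series f (m + ~~ st ord0)%N * Xi (l ord0) m ^+ s ord0).
  by apply/funext => m; rewrite mulrC.
rewrite E; split; first exact: tail_mul.
by case: (s ord0) (s0 ord0) => // e _; exact: tail_series.
Qed.

Lemma apery_psumE d (l : 'I_d.+1 -> lform) s st : apery_psum R st l s =
  series (fun n => b n ^+ 2 * nest st (chain_term l s) n).
Proof.
(* The weight b^2 is attached to the leading factor, which makes the summand a product over the
   indices. *)
pose g (j : 'I_d.+1) n := (if j == ord0 then b n ^+ 2 else 1) * chain_term l s j n.
apply/funext => N; transitivity (nested_psum st (fun n => \prod_j g j (n j)) N).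
  apply: eq_bigr => n _; rewrite /g big_split /=.
  rewrite [X in _ = X * _](bigD1 ord0) //= [X in _ = _ * X * _]big1 ?mulr1; last by move=> j /negbTE ->.
  by congr (_ * _); rewrite -prodfV; apply: eq_bigr => j _; rewrite /chain_term /Xi exprVn.
rewrite nested_psumE; congr (series _ N); apply/funext => n /=.
have -> : g ord0 n = b n ^+ 2 * chain_term l s ord0 n by rewrite /g eqxx.
have -> : (fun j => g (lift ord0 j)) = (fun j => chain_term l s (lift ord0 j)).
  by apply/funext => j; apply/funext => m; rewrite /g mul1r.
by rewrite mulrA.
Qed.

End Chains.

(** * The case of pure weight and rational coefficients *)

Section Homogeneous.
Variable R : realType.
Local Notation C := R[i].
Local Notation b := (bseq R).
Local Notation Ai := (@Ai R).
Local Notation Bi := (@Bi R).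
Local Notation std := (@std R).
Local Notation delta0 := (@delta0 R).
Local Notation Xi := (@Xi R).
Local Notation chain_term := (@chain_term R).

(** Besides the exact weight, a lower bound on the leading exponent is recorded, for convergence,
    and whether the leading entry must be odd, so that further factors 1/(2n+1) can be absorbed into
    it. *)
Definition std_class (odd : bool) (h W : nat) (w : word) : bool :=
  (weight w == W) && (if w is (o, s) :: _ then (odd ==> o) && (h <= s.+1)%N
                      else ~~ odd && (h == 0%N)).

Inductive std_span (odd : bool) (h W : nat) : (nat -> R) -> Prop :=
| span_std w : std_class odd h W w -> std_span odd h W (std w)
| span_add f g : std_span odd h W f -> std_span odd h W g -> std_span odd h W (fun n => f n + g n)
| span_scale (q : rat) f : std_span odd h W f -> std_span odd h W (fun n => ratr q * f n).

Lemma span_ext o h W f g : (forall n, f n = g n) -> std_span o h W f -> std_span o h W g.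
Proof. by move=> /funext ->. Qed.

Lemma span_mono (o o' : bool) h h' W f : o' ==> o -> (h' <= h)%N -> (0 < W)%N ->
  std_span o h W f -> std_span o' h' W f.
Proof.
move=> oo hh W0; elim=> [w|g k _ ? _ ?|q g _ ?]; last 2 first.
- exact: span_add.
- exact: span_scale.
move=> /andP[/eqP wW hw]; apply: span_std; rewrite /std_class wW eqxx /=.
case: w wW hw => [|x w] wW; first by rewrite -wW in W0.
case: x {wW} => p t /andP[op ht]; rewrite (leq_trans hh ht) andbT.
by apply/implyP => o1; exact: (implyP op (implyP oo o1)).
Qed.

Lemma span_even_step s W h f : std_span false h W f ->
  std_span false s.+1 (W + s.+1) (fun n => series f n * Ai n ^+ s.+1).
Proof.
elim=> [w /andP[/eqP wW _]|g k _ h1 _ h2|q g _ h1].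
- apply: (@span_std _ _ _ ((false, s) :: w)).
  by rewrite /std_class /weight /= -/(weight w) wW addnC eqxx leqnn.
- by apply: span_ext (span_add h1 h2) => n; rewrite series_add mulrDl.
- by apply: span_ext (span_scale q h1) => n; rewrite series_scale mulrA.
Qed.

Lemma span_odd_step s W h f : std_span false h W f ->
  std_span true s.+1 (W + s.+1) (fun n => series f n.+1 * Bi n ^+ s.+1).
Proof.
elim=> [w /andP[/eqP wW _]|g k _ h1 _ h2|q g _ h1].
- apply: (@span_std _ _ _ ((true, s) :: w)).
  by rewrite /std_class /weight /= -/(weight w) wW addnC eqxx leqnn.
- by apply: span_ext (span_add h1 h2) => n; rewrite series_add mulrDl.
- by apply: span_ext (span_scale q h1) => n; rewrite series_scale mulrA.
Qed.

Lemma span_mul_B s W h f : std_span true h W f ->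
  std_span true (h + s) (W + s) (fun n => f n * Bi n ^+ s).
Proof.
elim=> [w /andP[/eqP wW]|g k _ h1 _ h2|q g _ h1].
- case: w wW => // x w; case: x => o t wW /andP[/= ot ht]; rewrite ot in wW *.
  apply: (@span_ext _ _ _ (std ((true, t + s)%N :: w))) => [n|]; first by rewrite /= -addSn exprD mulrA.
  apply: span_std; rewrite /std_class /= -addSn leq_add2r ht andbT -wW /weight /= addSn.
  by apply/eqP; lia.
- by apply: span_ext (span_add h1 h2) => n; rewrite mulrDl.
- by apply: span_ext (span_scale q h1) => n; rewrite mulrA.
Qed.

Lemma span_sub o h W f g : std_span o h W f -> std_span o h W g ->
  std_span o h W (fun n => f n - g n).
Proof.
move=> hf hg; apply: span_ext (span_add hf (span_scale (-1) hg)) => n.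
by rewrite rmorphN1 mulN1r.
Qed.

(** A leading 1/(2n-1) becomes 1/(2n+1) after the shift; the shifted sequence is the one that lies
    in the odd span. *)
Definition shifted h W f := f 0%N = 0 /\ std_span true h W (fun n => f n.+1).

Lemma series_shifted (f : nat -> R) n : f 0%N = 0 -> series f n.+1 = series (fun n => f n.+1) n.
Proof. by move=> f0; rewrite /series /= big_nat_recl // f0 add0r. Qed.

(** Summing a shifted sequence up to n means summing its shift below n, that is, up to n minus the
    term at n. That term is of odd type, so the new powers of 1/(2n+1) merge into it at the same
    weight. *)
Lemma span_odd_step_shifted s W h f : (0 < W)%N -> shifted h W f ->
  std_span true s.+1 (W + s.+1) (fun n => series f n.+1 * Bi n ^+ s.+1).
Proof.
move=> W0 [f0 hf].
have h1 := span_odd_step s (span_mono (h' := 0%N) (o' := false) isT (leq0n _) W0 hf).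
have h2 : std_span true s.+1 (W + s.+1) (fun n => f n.+1 * Bi n ^+ s.+1).
  apply: span_mono (span_mul_B s.+1 hf); rewrite ?implybb //; lia.
apply: span_ext (span_sub h1 h2) => n.
by rewrite (series_shifted n f0) (seriesSr (fun n => f n.+1)); ring.
Qed.

Definition homogeneous (l : lform) h W f :=
  if l is L2m_minus1 then shifted h W f else std_span false h W f.

(** An outer 2m over an inner 2m-1 is excluded because the correction term would be of odd type
    multiplied by 1/(2n), whose partial fractions mix weights. *)
Lemma homogeneous_step l l' h W s f : (l' = L2m_minus1 -> l <> L2m) -> (0 < W)%N ->
  homogeneous l' h W f ->
  homogeneous l s.+1 (W + s.+1) (fun m => Xi l m ^+ s.+1 * series f (m + ~~ std_strict l)%N).
Proof.
move=> ll W0 hf.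
have odd_case : std_span true s.+1 (W + s.+1) (fun n => series f n.+1 * Bi n ^+ s.+1).
  by move: hf; rewrite /homogeneous; case: (l') => hf;
    [exact: span_odd_step hf|exact: span_odd_step hf|exact: span_odd_step_shifted hf].
rewrite XiE; case: l ll => ll /=.
- have {}hf : std_span false h W f by move: hf ll; rewrite /homogeneous; case: (l') => // _ /(_ erefl).
  by apply: span_ext (span_even_step s hf) => n; rewrite addn0 mulrC.
- apply: span_mono (span_ext _ odd_case) => //; first by rewrite addnS.
  by move=> n; rewrite addn1 mulrC.
- split; first by rewrite series0 mulr0.
  by apply: span_ext odd_case => n; rewrite addn0 DiS mulrC.
Qed.

Lemma homogeneous_base l s :
  homogeneous l s.+1 s.+1 (fun m => Xi l m ^+ s.+1 * series delta0 (m + ~~ std_strict l)%N).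
Proof.
have h : std_span false 0 0 delta0 by apply: (@span_std _ _ _ [::]).
have odd_case := span_odd_step s h.
rewrite XiE; case: l => /=.
- by apply: span_ext (span_even_step s h) => n; rewrite addn0 mulrC.
- apply: span_mono (span_ext _ odd_case) => //.
  by move=> n; rewrite addn1 mulrC.
- split; first by rewrite series0 mulr0.
  by apply: span_ext odd_case => n; rewrite addn0 DiS mulrC.
Qed.

Lemma homogeneous_nest d (l : 'I_d.+1 -> lform) s : (forall j, (0 < s j)%N) ->
  (forall i j : 'I_d.+1, j = i.+1 :> nat -> l j = L2m_minus1 -> l i <> L2m) ->
  homogeneous (l ord0) (s ord0) (\sum_j s j) (nest (fun j => std_strict (l j)) (chain_term l s)).
Proof.
elim: d l s => [|d IH] l s s0 ll.
  rewrite big_ord_recl big_ord0 addn0.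
  have := homogeneous_base (l ord0) (s ord0).-1; rewrite prednK //.
rewrite big_ord_recl addnC.
have {IH} := IH (fun j => l (lift ord0 j)) (fun j => s (lift ord0 j)) (fun j => s0 _).
set W := (\sum_(i < d.+1) s (lift ord0 i))%N => IH.
have W0 : (0 < W)%N by rewrite /W big_ord_recl addn_gt0 s0.
have {IH} hf := IH (fun i j ij => ll (lift ord0 i) (lift ord0 j) (congr1 S ij)).
have h01 : l (lift ord0 ord0) = L2m_minus1 -> l ord0 <> L2m by apply: ll.
have := homogeneous_step (s ord0).-1 h01 W0 hf.
by rewrite prednK.
Qed.

Lemma QsetM (x y : C) : Qset x -> Qset y -> Qset (x * y).
Proof. by move=> [p ->] [q ->]; exists (p * q); rewrite rmorphM. Qed.

Lemma CMZV4D W (x y : C) : CMZV4 W x -> CMZV4 W y -> CMZV4 W (x + y).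
Proof.
case: W => [|W]; last exact: span_overD.
by move=> [p ->] [q ->]; exists (p + q); rewrite rmorphD.
Qed.

Lemma CMZV4Z W (q : rat) (x : C) : CMZV4 W x -> CMZV4 W (ratr q * x).
Proof.
have Qq : Qset (ratr q : C) by exists q.
case: W => [|W]; first by apply: QsetM.
by apply: span_overZ => // ? ?; exact: QsetM.
Qed.

Lemma span_sum o h W f : (3 <= h)%N -> std_span o h W f ->
  exists2 T : R, series (fun n => b n ^+ 2 * f n) @ \oo --> T & CMZV4 W T%:C%C.
Proof.
move=> h3; elim=> [w /andP[/eqP <-]|g k _ [S hS cS] _ [T hT cT]|q g _ [T hT cT]].
- case: w => [|x w]; first by move=> /andP[_ /eqP h0]; rewrite h0 in h3.
  case: x => p [|[|t]] /andP[_ ht]; try by have := leq_trans h3 ht.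
  exact: std_sum.
- exists (S + T); last by rewrite rmorphD; exact: CMZV4D.
  have -> : series (fun n => b n ^+ 2 * (g n + k n)) =
    series (fun n => b n ^+ 2 * g n) + series (fun n => b n ^+ 2 * k n).
    by apply/funext => n; rewrite fctE -series_add; congr (series _ n); apply/funext => m; rewrite mulrDr.
  exact: cvgD.
- exists (ratr q * T); last by rewrite rmorphM /= rc_rat; exact: CMZV4Z.
  have -> : series (fun n => b n ^+ 2 * (ratr q * g n)) =
    (fun N => ratr q * series (fun n => b n ^+ 2 * g n) N).
    by apply/funext => n; rewrite -series_scale; congr (series _ n); apply/funext => m; rewrite mulrCA.
  exact: cvgMr.
Qed.

(* b_{n+1} = b_n (1 + B_n) *)
Lemma shifted_sum h W f : (3 <= h)%N -> shifted h W f ->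
  exists2 T : R, series (fun n => b n ^+ 2 * f n) @ \oo --> T &
    sum_sets (fun k : 'I_3 => @CMZV4 R (W + k)%N) T%:C%C.
Proof.
move=> h3 [f0 hf].
have [T0 hT0 cT0] := span_sum h3 hf.
have [|T1 hT1 cT1] := span_sum _ (span_mul_B 1 hf); first lia.
have [|T2 hT2 cT2] := span_sum _ (span_mul_B 2 hf); first lia.
exists (T0 + 2 * T1 + T2); last first.
  exists (fun k : 'I_3 => if val k is 0%N then T0%:C%C else if val k is 1%N then (2 * T1)%:C%C else T2%:C%C).
    move=> [[|[|[|k]]] // hk] /=; rewrite ?addn0 //.
    by have := CMZV4Z 2 cT1; rewrite rmorphM /= !rmorph_nat.
  by rewrite !big_ord_recl big_ord0 /= addr0 !rmorphD addrA.
rewrite -cvg_shiftS.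
have -> : [sequence series (fun n => b n ^+ 2 * f n) n.+1]_n =
  (fun N => series (fun n => b n ^+ 2 * f n.+1) N + 2 * series (fun n => b n ^+ 2 * (f n.+1 * Bi n ^+ 1)) N
     + series (fun n => b n ^+ 2 * (f n.+1 * Bi n ^+ 2)) N).
  apply/funext => N /=; rewrite series_shifted ?f0 ?mulr0 // -series_scale -!series_add.
  congr (series _ N); apply/funext => n.
  have p1 : n.*2.+1%:R != 0 :> R by rewrite pnatr_eq0.
  rewrite bS_div doubleS -natr1 /Bi; move: (n.*2.+1%:R : R) p1 => p p1; by field.
by apply: cvgD => //; apply: cvgD => //; exact: cvgMr.
Qed.

End Homogeneous.

Theorem theorem4p7 (R : realType) (d : nat) (s : 'I_d.+1 -> nat)
  (l : 'I_d.+1 -> lform)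
  (s_gt0 : forall j, (0 < s j)%N) (s1_ge3 : (3 <= s ord0)%N) :
  let w := (\sum_j s j)%N in
  let std := fun j => std_strict (l j) in
  let T := apery_sum R std l s in
  let no_even_before_minus := forall i j : 'I_d.+1, j = i.+1 :> nat ->
        l j = L2m_minus1 -> l i <> L2m in
  [/\ cvgn (apery_psum R std l s),
      (* (a) *)
      [/\ l ord0 <> L2m_minus1 -> no_even_before_minus ->
            CMZV4 w T%:C%C,
          l ord0 = L2m_plus1 -> (forall j, l j <> L2m) ->
            CMZV4 w T%:C%C
        & l ord0 = L2m_minus1 -> no_even_before_minus ->
            sum_sets (fun k : 'I_3 => @CMZV4 R (w + k)%N) T%:C%C],
      (* (b) *)
      tensor_Qi (@CMZV4_le R (w + 2 * nu (l ord0))%N) T%:C%C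
    & (* (c) *)
      forall strict : 'I_d.+1 -> bool, apery_defined strict l ->
        cvgn (apery_psum R strict l s) /\
        tensor_Qi (@CMZV4_le R (w + 2 * nu (l ord0))%N)
          (apery_sum R strict l s)%:C%C].
Proof.
move=> w std T noeven.
(* Convergence, (b) and (c) are obtained together, for arbitrary relations between the indices; only
   (a) follows the homogeneous route. *)
have general st : cvgn (apery_psum R st l s) /\
    tensor_Qi (@CMZV4_le R (w + 2 * nu (l ord0))%N) (apery_sum R st l s)%:C%C.
  pose W := (\sum_(i < d) s (lift ord0 i))%N.
  have [hf hsf] := @tail_nest R d (fun j => st (lift ord0 j)) (fun j => l (lift ord0 j))
     (fun j => s (lift ord0 j)) (fun j => s_gt0 _).
  have hV := tail_upto (st ord0) hf hsf.
  have [S hS tS] := tail_good (l ord0) (s ord0 - 3) hV.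
  have hT : apery_psum R st l s @ \oo --> S.
    rewrite apery_psumE; move: hS; rewrite (_ : (s ord0 - 3).+3 = s ord0); last by lia.
    by under eq_fun do rewrite [X in _ * X]mulrC.
  split; first by apply/cvg_ex; exists S.
  rewrite /apery_sum (cvg_lim _ hT) //; move: tS; rewrite /w big_ord_recl -/W.
  by rewrite (_ : (s ord0 - 3).+3 = s ord0) ?[(W + _)%N]addnC //; lia.
have sum_eq S : series (fun n => bseq R n ^+ 2 * nest std (chain_term R l s) n) @ \oo --> S -> T = S.
  by rewrite -apery_psumE /T /apery_sum => h; apply: cvg_lim.
have homog := homogeneous_nest R s_gt0.
have regular : l ord0 <> L2m_minus1 -> noeven -> CMZV4 w T%:C%C.
  move=> l0 ne; have h := homog _ ne.
  have {}h : std_span false (s ord0) w (nest std (chain_term R l s)).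
    by move: h; rewrite /homogeneous; case: (l ord0) l0.
  by have [S hS cS] := span_sum s1_ge3 h; rewrite (sum_eq S).
split.
- by case: (general std).
- split=> //.
    by move=> l0 lj; apply: regular; [rewrite l0|move=> i j _ _; exact: lj].
  move=> l0 ne; have h := homog _ ne; rewrite l0 /= in h.
  by have [S hS cS] := shifted_sum s1_ge3 h; rewrite (sum_eq S).
- by case: (general std).
- by move=> st _; exact: general.
Qed.
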